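(* Let $p\in(3,\infty)$, let $\gamma\in W^{2-\frac2p,p}(\mathbb{R}/2\pi\mathbb{Z},\mathbb{R}^3)$ be simple and regular, and let $\Phi\in W^{2-\frac2p,p}(\mathbb{R}/2\pi\mathbb{Z},\mathbb{R}^3)$. Write $\gamma_\tau:=\gamma+\tau\Phi$ for $\tau\in\mathbb{R}$. Then the function $$\tau\mapsto \int_0^{2\pi}\int_{-\pi}^{\pi}\int_{-\pi}^{\pi} c_{\gamma_\tau}(s,s+v,s+w)^p\,|\gamma_\tau'(s)|\,|\gamma_\tau'(s+v)|\,|\gamma_\tau'(s+w)|\,dw\,dv\,ds$$ is continuously differentiable with respect to $\tau$ in a small neighbourhood of $0$. Consequently, the first variation $\delta\mathscr{M}_p(\gamma,\Phi)=\frac{d}{d\tau}\big|_{\tau=0}\mathscr{M}_p(\gamma+\tau\Phi)$ exists.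
   Context: Functions on $\mathbb{R}/2\pi\mathbb{Z}$ are $2\pi$-periodic functions on $\mathbb{R}$. For $p>2$ the periodic Sobolev-Slobodeckij space $W^{2-\frac2p,p}(\mathbb{R}/2\pi\mathbb{Z},\mathbb{R}^3)$ consists of all $\gamma\in W^{1,p}(\mathbb{R}/2\pi\mathbb{Z},\mathbb{R}^3)$ with $\int_0^{2\pi}\int_{-\pi}^{\pi}\frac{|\gamma'(x+w)-\gamma'(x)|^p}{|w|^{p-1}}\,dw\,dx<\infty$. For $p>3$ its elements are (represented by) $C^1$ functions. A closed curve $\gamma$ is simple if $\gamma(s)\ne\gamma(t)$ whenever $s-t\notin 2\pi\mathbb{Z}$; an absolutely continuous curve is regular if there is $C>0$ with $|\gamma'(x)|\ge C$ for almost every $x$. For a simple closed curve $\gamma$, $$c_\gamma(s,t,\sigma):=\frac{2\,|(\gamma(t)-\gamma(s))\wedge(\gamma(\sigma)-\gamma(s))|}{|\gamma(t)-\gamma(s)|\,|\gamma(s)-\gamma(\sigma)|\,|\gamma(\sigma)-\gamma(t)|},$$ where $\wedge$ is the cross product in $\mathbb{R}^3$; it is defined for all $(s,t,\sigma)\in\mathbb{R}^3$ outside the null set where two of the arguments differ by an element of $2\pi\mathbb{Z}$ (on this null set the integrand may be set to $0$). Integral Menger curvature of a closed, simple, regular absolutely continuous curve is $$\mathscr{M}_p(\gamma):=\int_0^{2\pi}\int_0^{2\pi}\int_0^{2\pi}c_\gamma(s,t,\sigma)^p\,|\gamma'(s)|\,|\gamma'(t)|\,|\gamma'(\sigma)|\,d\sigma\,dt\,ds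 .$$ By periodicity, $\mathscr{M}_p(\gamma_\tau)$ equals the displayed triple integral. For $\gamma,\Phi$ as in the claim, $\gamma_\tau$ is simple and regular for all sufficiently small $|\tau|$, so $c_{\gamma_\tau}$ and $\mathscr{M}_p(\gamma_\tau)$ make sense. *)

(* Defs.v *)
From mathcomp Require Import all_boot all_order all_algebra.
From mathcomp Require Import all_classical all_reals all_analysis.

Set Implicit Arguments.
Unset Strict Implicit.
Unset Printing Implicit Defensive.

Import Order.TTheory GRing.Theory Num.Theory.
Import numFieldNormedType.Exports.

Local Open Scope classical_set_scope.
Local Open Scope ring_scope.

Section Defs.
Variable R : realType.

Local Notation mu := (@lebesgue_measure R).
Local Notation V := 'rV[R]_3.
Local Notation period := (`[0%R, (pi *+ 2)%R]%classic : set R).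
Local Notation centered := (`[(- pi)%R, pi]%classic : set R).

(* The library norm `|v| on row vectors is the sup norm. *)
Definition enorm (v : V) : R := Num.sqrt (\sum_(i < 3) v 0 i ^+ 2).

(* Indices are taken mod 3: component i is u_(i+1) v_(i+2) - u_(i+2) v_(i+1). *)
Definition cross (u v : V) : V :=
  \row_(i < 3) (u 0 (i + 1) * v 0 (i + 2%:R) - u 0 (i + 2%:R) * v 0 (i + 1)).

Definition periodic_Lp (p : R) (f : R -> V) : Prop :=
  [/\ periodic f (pi *+ 2),
      forall i, measurable_fun setT (fun x => f x 0 i) &
      (\int[mu]_(x in period) (enorm (f x) `^ p)%:E < +oo)%E].

Definition smooth (phi : R -> R) : Prop :=
  forall n x, derivable (derive1n n phi) x 1.

Definition periodic_weak_derivative (f g : R -> V) : Prop :=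
  forall phi : R -> R, smooth phi -> periodic phi (pi *+ 2) ->
  forall i, Rintegral mu period (fun x : R => f x 0 i * derive1 phi x) =
          - Rintegral mu period (fun x : R => g x 0 i * phi x).

(* Membership in W^{2-2/p,p}(R/2piZ, R^3).  An element of a Sobolev space is a
   class of functions modulo null sets; the predicate describes its continuous
   representative, so that pointwise notions such as simplicity make sense.
   The function g is the weak derivative of f. *)
Definition sobolev_slobodeckij (p : R) (f : R -> V) : Prop :=
  [/\ continuous f, periodic_Lp p f &
   exists g : R -> V,
     [/\ periodic_Lp p g, periodic_weak_derivative f g &
      (\int[mu]_(x in period) \int[mu]_(w in centered)
         (enorm (g (x + w) - g x) `^ p / `|w| `^ (p - 1))%:E < +oo)%E]].

Definition simple_closed (gamma : R -> V) : Prop :=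
  forall s t, ~ (exists k : int, s - t = k%:~R * (pi *+ 2)) ->
  gamma s <> gamma t.

Definition regular_curve (gamma : R -> V) : Prop :=
  exists2 C : R, 0 < C & {ae mu, forall x, C <= enorm (derive1 gamma x)}.

(* Since 0^-1 = 0, this vanishes as soon as two of the three points coincide. *)
Definition menger_curvature (gamma : R -> V) (s t sigma : R) : R :=
  2%:R * enorm (cross (gamma t - gamma s) (gamma sigma - gamma s)) /
  (enorm (gamma t - gamma s) * enorm (gamma s - gamma sigma) *
   enorm (gamma sigma - gamma t)).

Definition menger_integrand (p : R) (gamma : R -> V) (s t sigma : R) : R :=
  menger_curvature gamma s t sigma `^ p *
  enorm (derive1 gamma s) * enorm (derive1 gamma t) * enorm (derive1 gamma sigma).

Definition integral_menger_curvature (p : R) (gamma : R -> V) : \bar R :=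
  (\int[mu]_(s in period) \int[mu]_(t in period)
    \int[mu]_(sigma in period) (menger_integrand p gamma s t sigma)%:E)%E.

Definition shifted_menger_integral (p : R) (gamma : R -> V) : \bar R :=
  (\int[mu]_(s in period) \int[mu]_(v in centered)
    \int[mu]_(w in centered)
      (menger_integrand p gamma s (s + v) (s + w))%:E)%E.

Definition perturb (gamma Phi : R -> V) (tau : R) : R -> V :=
  fun x => gamma x + tau *: Phi x.

(* Finiteness has to be required explicitly because fine sends +oo to 0. *)
Definition differentiable_at0 (E : R -> \bar R) : Prop :=
  (\forall tau \near (0 : R), E tau \is a fin_num) /\
  derivable (fun tau => fine (E tau)) 0 1.

Definition C1_near0 (E : R -> \bar R) : Prop :=
  exists2 delta : R, 0 < delta &
    forall tau : R, `|tau| < delta ->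
      [/\ E tau \is a fin_num,
          derivable (fun t => fine (E t)) tau 1 &
          {for tau, continuous (derive1 (fun t => fine (E t)))}].

End Defs.

(* Main.v *)
(** The averages of the weak derivatives over intervals of dyadic radius form a geometric
    Cauchy sequence when [p > 3], so [gamma] and [Phi] are closed curves of class C^1.  By
    compactness a simple regular C^1 curve is bilipschitz for the chordal distance
    [|sin ((t - s) / 2)|] of the circle, uniformly under small perturbations.

    In a triangle [s, t, sigma] whose longest side is opposite [s], the cross product in
    the numerator of the Menger curvature vanishes up to the first order Taylor defects of
    the curve at [s].  Hence the integrand and its derivative in [tau] are bounded, uniformly
    for small [tau], by a sum of kernels
      (|U t - U s - sin (t - s) U' s| / chord s t)^p * max (chord s t) (chord s sigma)^-p
    over the components [U] of [gamma] and [Phi].  Integrating in [sigma] leaves the weight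
    [(chord s t)^(1 - p)], and a Hardy type inequality in [t] then bounds the integral by the
    Slobodeckij energy of [U'].  The other two positions of the longest side reduce to this
    one by permuting the variables.  So the integrands are dominated together with their
    derivatives, and the integral is C^1 in [tau]. *)

(* The obstacle to differentiability is the numerator of the Menger curvature: it vanishes on
   collinear triples, where a norm is not smooth. It enters through the power [p / 2] of a squared
   Euclidean norm, and as [p / 2 > 1] this power is of class C^1 even at its zeros. Once sides and
   velocities are normalised, all other factors are powers of squared norms bounded away from zero,
   so any exponent is harmless there.

   The derivative in [tau] needs no geometric estimate of its own. For three fixed points the cross
   product of the perturbed curve is a quadratic polynomial in [tau]; its values at [0], [1] and
   [-1] bound the coefficients and hence the derivative.

   The vertex opposite the longest side is the right base point because the two sides that meet
   there cancel against the numerator. Only the longest side is left as a singular factor, and it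
   dominates both other chords.

   All kernels are periodic in every variable, so they can be integrated over one cube that is
   invariant under permutations. This is why chords and sines replace differences of parameters. *)
From HB Require Import structures.
Require Import Defs.
From mathcomp Require Import all_boot all_order all_algebra.
From mathcomp Require Import all_classical all_reals all_analysis.
From mathcomp Require Import measurable_realfun lebesgue_integral_under.
From mathcomp Require Import ring lra.
Import Order.TTheory GRing.Theory Num.Theory.
Import numFieldNormedType.Exports.
Local Open Scope classical_set_scope.
Local Open Scope ring_scope.

(** * Iterated and periodic integrals *)

Section Tonelli.
Context d1 d2 (T1 : measurableType d1) (T2 : measurableType d2) (R : realType).
Variables (m1 : {sigma_finite_measure set T1 -> \bar R})
          (m2 : {sigma_finite_measure set T2 -> \bar R}).
Variables (D1 : set T1) (D2 : set T2) (f : T1 -> T2 -> \bar R).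
Hypotheses (mD1 : measurable D1) (mD2 : measurable D2).
Hypothesis mf : measurable_fun setT ((fun z => f z.1 z.2) : T1 * T2 -> \bar R).
Hypothesis f0 : forall x y, (0 <= f x y)%E.

(** Extension by zero off the rectangle turns integrals over [D1] and [D2] into integrals over the
    whole spaces, where the Fubini-Tonelli theorem applies. *)
Let F := (fun z : T1 * T2 => f z.1 z.2) \_ (D1 `*` D2).

Let mF : measurable_fun setT F.
Proof.
apply/(measurable_restrictT _ _).1; first exact: measurableX.
exact: measurable_funTS.
Qed.

Let F0 z : (0 <= F z)%E.
Proof. by rewrite /F patchE; case: ifP. Qed.

Let FE1 x : ((fun x => \int[m2]_(y in D2) f x y) \_ D1)%E x =
  (\int[m2]_y F (x, y))%E.
Proof.
rewrite patchE; case: ifPn => xD.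
  rewrite integral_mkcond; apply: eq_integral => y _.
  by rewrite /F !patchE in_setX xD.
rewrite integral0_eq// => y _.
by rewrite /F patchE in_setX (negbTE xD).
Qed.

Let FE2 y : ((fun y => \int[m1]_(x in D1) f x y) \_ D2)%E y =
  (\int[m1]_x F (x, y))%E.
Proof.
rewrite patchE; case: ifPn => yD.
  rewrite integral_mkcond; apply: eq_integral => x _.
  by rewrite /F !patchE in_setX yD andbT.
rewrite integral0_eq// => x _.
by rewrite /F patchE in_setX (negbTE yD) andbF.
Qed.

Lemma tonelli_swap : (\int[m1]_(x in D1) \int[m2]_(y in D2) f x y =
  \int[m2]_(y in D2) \int[m1]_(x in D1) f x y)%E.
Proof.
rewrite integral_mkcond [RHS]integral_mkcond.
under eq_integral do rewrite FE1.
under [RHS]eq_integral do rewrite FE2.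
exact: (fubini_tonelli F).
Qed.

Lemma tonelli_prod : (\int[(m1 \x m2)%E]_(z in D1 `*` D2) f z.1 z.2 =
  \int[m1]_(x in D1) \int[m2]_(y in D2) f x y)%E.
Proof.
rewrite integral_mkcond [RHS]integral_mkcond.
under [RHS]eq_integral do rewrite FE1.
exact: (fubini_tonelli1 F).
Qed.

End Tonelli.

Lemma measurable_tonelli d1 d2 (T1 : measurableType d1) (T2 : measurableType d2)
    (R : realType) (m2 : {sigma_finite_measure set T2 -> \bar R})
    (D2 : set T2) (f : T1 -> T2 -> \bar R) :
  measurable D2 -> measurable_fun setT ((fun z => f z.1 z.2) : T1 * T2 -> \bar R) ->
  (forall x y, (0 <= f x y)%E) ->
  measurable_fun setT (fun x => \int[m2]_(y in D2) f x y)%E.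
Proof.
move=> mD2 mf f0.
pose F := (fun z : T1 * T2 => f z.1 z.2) \_ (setT `*` D2).
have mF : measurable_fun setT F.
  apply/(measurable_restrictT _ _).1; first exact: measurableX.
  exact: measurable_funTS.
have F0 z : (0 <= F z)%E by rewrite /F patchE; case: ifP.
rewrite [X in measurable_fun _ X](_ : _ = fun x => \int[m2]_y F (x, y))%E.
  exact: measurable_fun_fubini_tonelli_F.
apply/funext => x; rewrite integral_mkcond; apply: eq_integral => y _.
by rewrite /F !patchE in_setX in_setT.
Qed.

Section Translation.
Context {R : realType}.
Local Notation mu := (@lebesgue_measure R).

Lemma shift_preimage_itv (c a b : R) (x y : bool) :
  (fun t => c + t) @^-1` [set` Interval (BSide x a) (BSide y b)] =
  [set` Interval (BSide x (a - c)) (BSide y (b - c))].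
Proof.
apply/seteqP; split => t /=; rewrite !itv_boundlr/= => /andP[].
  by case: x; case: y; rewrite /= !bnd_simp ?lerBlDl ?ltrBlDl ?lerBrDl ?ltrBrDl => -> ->.
by case: x; case: y; rewrite /= !bnd_simp ?lerBlDl ?ltrBlDl ?lerBrDl ?ltrBrDl => -> ->.
Qed.

Lemma measurable_shift (c : R) :
  measurable_fun setT (fun t : measurableTypeR R => c + t : measurableTypeR R).
Proof. exact: measurable_funD. Qed.

(** Lebesgue measure is determined by its values on half-open intervals, and translation preserves
    their length. *)
Lemma lebesgue_measure_shift (c : R) (A : set R) : measurable A ->
  pushforward mu (fun t : measurableTypeR R => c + t : measurableTypeR R) A = mu A.
Proof.
move=> mA; apply/esym/lebesgue_measure_unique => //=.
  exact: measurable_shift.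
move=> mc _ [[a b]] _ <-.
rewrite /pushforward shift_preimage_itv !lebesgue_measure_itv/=.
by rewrite !lte_fin ltrD2r -EFinB; congr (if _ then _ else _); rewrite -EFinB; congr EFin; ring.
Qed.

Lemma ge0_integral_shift (c : R) (D : set R) (f : R -> \bar R) :
  measurable D -> measurable_fun setT f -> (forall x, 0 <= f x)%E ->
  (\int[mu]_(x in (fun t : R => (c + t)%R) @^-1` D) f (c + x)%R = \int[mu]_(x in D) f x)%E.
Proof.
move=> mD mf f0.
have mc := measurable_shift c.
rewrite -(@ge0_integral_pushforward _ _ _ _ _ _ mc mu D f)//.
- by apply: eq_measure_integral => //= A mA AS; exact: lebesgue_measure_shift.
- exact: measurable_funTS.
Qed.

Lemma ge0_integral_shift_itv (c a b : R) (f : R -> \bar R) :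
  measurable_fun setT f -> (forall x, 0 <= f x)%E ->
  (\int[mu]_(x in `[a, b]) f (c + x)%R = \int[mu]_(x in `[(a + c)%R, (b + c)%R]) f x)%E.
Proof.
move=> mf f0; rewrite -[RHS](ge0_integral_shift c)//.
by rewrite shift_preimage_itv !addrK.
Qed.

Lemma ge0_integral_itv_split (a b c : R) (f : R -> \bar R) :
  measurable_fun setT f -> (forall x, 0 <= f x)%E -> a <= b -> b <= c ->
  (\int[mu]_(x in `[a, c]) f x =
   \int[mu]_(x in `[a, b]) f x + \int[mu]_(x in `[b, c]) f x)%E.
Proof.
move=> mf f0 ab bc.
rewrite (@itv_bndbnd_setU _ _ _ (BRight b)) ?bnd_simp//.
rewrite ge0_integral_setU//=.
- by rewrite (@integral_itv_obnd_cbnd _ b)//; exact: measurable_funTS.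
- exact: measurable_funTS.
- apply/disj_setPS => y [/=]; rewrite !in_itv/= => /andP[_ yb] /andP[by' _].
  by move: (le_lt_trans yb by'); rewrite ltxx.
Qed.

Lemma period_intmul (T : Type) (f : R -> T) (t : R) :
  (forall x, f (x + t) = f x) -> forall (k : int) x, f (x + k%:~R * t) = f x.
Proof.
move=> pf; have pn n x : f (x + n%:R * t) = f x.
  elim: n x => [|n IH] x; first by rewrite mul0r addr0.
  by rewrite -natr1 mulrDl mul1r addrA pf IH.
case=> n x; first exact: pn.
rewrite -[LHS](pn n.+1); congr f.
by rewrite NegzE mulrNz mulNr subrK.
Qed.

(** Reducing [c] modulo [T] leaves a starting point [c'] in [[0, T]]. The interval is then cut at
    [T], and the overhang beyond [T] is moved back to [[0, c']]. *)
Lemma ge0_integral_period (h : R -> \bar R) (T c : R) : 0 < T ->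
  measurable_fun setT h -> (forall x, 0 <= h x)%E -> (forall x, h (x + T)%R = h x) ->
  (\int[mu]_(x in `[c, (c + T)%R]) h x = \int[mu]_(x in `[0%R, T]) h x)%E.
Proof.
move=> T0 mh h0 ph.
pose k := Num.floor (c / T); pose c' := c - k%:~R * T.
have c'0 : 0 <= c'.
  by rewrite /c' subr_ge0 -ler_pdivlMr// floor_le.
have c'T : c' <= T.
  rewrite /c' lerBlDr -{1}(mul1r T) -mulrDl -ler_pdivrMr//.
  by have /andP[_ /ltW] := floor_itv (c / T); rewrite intrD addrC.
have -> : (\int[mu]_(x in `[c, (c + T)%R]) h x =
    \int[mu]_(x in `[c', (c' + T)%R]) h x)%E.
  rewrite [RHS](_ : _ = \int[mu]_(x in `[c', (c' + T)%R]) h (k%:~R * T + x)%R)%E.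
    rewrite (ge0_integral_shift_itv (k%:~R * T))//.
    by rewrite /c' subrK addrAC subrK.
  by apply: eq_integral => x _; rewrite addrC period_intmul.
rewrite (@ge0_integral_itv_split c' T)//; last by rewrite lerDr.
rewrite (@ge0_integral_itv_split 0 c' T)// addeC; congr (_ + _)%E.
rewrite -[LHS](_ : \int[mu]_(x in `[0%R, c']) h (T + x)%R = _)%E.
  by apply: eq_integral => x _; rewrite addrC ph.
by rewrite (ge0_integral_shift_itv T)// add0r.
Qed.

Lemma ge0_integral_centered (h : R -> \bar R) (c : R) :
  measurable_fun setT h -> (forall x, 0 <= h x)%E -> (forall x, h (x + pi *+ 2)%R = h x) ->
  (\int[mu]_(x in `[(- pi)%R, pi]) h (c + x)%R =
   \int[mu]_(x in `[0%R, (pi *+ 2)%R]) h x)%E.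
Proof.
move=> mh h0 ph; rewrite ge0_integral_shift_itv//.
rewrite -(@ge0_integral_period h (pi *+ 2) (- pi + c))//.
  by have -> : pi + c = - pi + c + pi *+ 2 :> R by ring.
by rewrite pmulrn_rgt0 ?pi_gt0.
Qed.

End Translation.

(** * Elementary facts on real numbers and null sets *)

Section RealLemmas.
Context {R : realType}.

(* Integrated and then optimised in [l], this replaces Hölder's inequality. *)
Lemma le_split_powR (p l t : R) : 1 < p -> 0 < l -> 0 <= t ->
  t <= l + l `^ (1 - p) * t `^ p.
Proof.
move=> p1 l0 t0; have [tl|lt] := leP t l.
  by rewrite (le_trans tl)// lerDl mulr_ge0 ?powR_ge0.
have tp : 0 < t by apply: lt_trans lt.
rewrite (@le_trans _ _ (l `^ (1 - p) * t `^ p))//; last by rewrite lerDr ltW.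
rewrite -(mulr_powRB1 t0); last lra.
rewrite mulrCA -[leLHS]mulr1 ler_wpM2l//.
rewrite (_ : 1 - p = - (p - 1)); last ring.
rewrite powRN mulrC ler_pdivlMr ?powR_gt0// mul1r.
by apply: ge0_ler_powR; rewrite ?nnegrE; lra.
Qed.

Lemma gt0_powRD (x r s : R) : 0 < x -> x `^ (r + s) = x `^ r * x `^ s.
Proof. by move=> x0; rewrite powRD//; apply/implyP => _; rewrite gt_eqF. Qed.

Lemma measurable_invr : measurable_fun setT (fun x : R => x^-1).
Proof.
(* This reduces the inverse to a real power of a nonnegative number; at [0] both sides are [0]. *)
rewrite [X in measurable_fun _ X](_ : _ = fun x : R => x * (x ^+ 2) `^ (-1)).
  apply: measurable_funM => //.
  apply: (measurableT_comp (measurable_powR (-1))); exact: measurable_funX.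
apply/funext => x; rewrite powR_inv1 ?sqr_ge0//.
have [->|x0] := eqVneq x 0; first by rewrite invr0 mul0r.
by field.
Qed.

Lemma geometric_cauchy (u : nat -> R) (C q : R) : 0 <= C -> 0 < q -> q < 1 ->
  (forall k, `|u k.+1 - u k| <= C * q ^+ k) ->
  exists l, forall k, `|l - u k| <= C / (1 - q) * q ^+ k.
Proof.
move=> C0 q0 q1 uC; pose K := C / (1 - q).
have K0 : 0 <= K by rewrite divr_ge0// subr_ge0 ltW.
have KC : K - K * q = C by rewrite /K; field; lra.
(* As [K - K * q = C], the sequence [v] is nondecreasing and [w] nonincreasing. The nested intervals
   [[v k, w k]] all contain the supremum of [v], which is the limit. *)
pose v k := u k - K * q ^+ k; pose w k := u k + K * q ^+ k.
have vS k : v k <= v k.+1.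
  rewrite /v; have := uC k; rewrite -KC ler_norml => /andP[+ _].
  by rewrite exprS; lra.
have wS k : w k.+1 <= w k.
  rewrite /w; have := uC k; rewrite -KC ler_norml => /andP[_ +].
  by rewrite exprS; lra.
have vw k : v k <= w k.
  by rewrite /v /w; have := mulr_ge0 K0 (exprn_ge0 k (ltW q0)); lra.
have vmono i j : (i <= j)%N -> v i <= v j.
  by move=> /subnK <-; elim: (j - i)%N => // k /le_trans; apply; rewrite addSn.
have wmono m n : (m <= n)%N -> w n <= w m.
  by move=> /subnK <-; elim: (n - m)%N => // k; apply: le_trans; rewrite addSn.
have vwmn m n : v m <= w n.
  rewrite (le_trans (vmono _ _ (leq_maxl m n)))// (le_trans (vw _))//.
  exact/wmono/leq_maxr.
exists (sup (range v)) => k.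
have hs : has_sup (range v).
  split; first by exists (v 0), 0%N.
  by exists (w 0%N) => _ [m _ <-].
have h1 : v k <= sup (range v) by apply: ub_le_sup; [exact: hs.2|exists k].
have h2 : sup (range v) <= w k by apply: ge_sup; [exact: hs.1|move=> _ [m _ <-]].
by rewrite ler_norml; move: h1 h2; rewrite /v /w -/K; lra.
Qed.

Lemma exprn_small (t C eps : R) : 0 < t -> t < 1 -> 0 <= C -> 0 < eps ->
  exists k, C * t ^+ k < eps.
Proof.
move=> t0 t1 C0 eps0.
have t_cvg : (fun k => t ^+ k) @ \oo --> (0 : R) by apply: cvg_expr; rewrite gtr0_norm.
have /cvgrPdist_lt/(_ (eps / (C + 1)))[] := t_cvg; first by rewrite divr_gt0//; lra.
move=> k _ /(_ k (leqnn k)); rewrite sub0r normrN gtr0_norm ?exprn_gt0// => h.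
exists k; move: h; rewrite ltr_pdivlMr; last lra.
by have := exprn_gt0 k t0; rewrite mulrDr mulr1 (mulrC C); lra.
Qed.

(** The periods to the right and to the left of the origin are numbered by [nat], so that properties
    that hold almost everywhere on each period can be collected by [ae_all]. *)
Lemma itv_cover (T x : R) : 0 < T -> exists n : nat,
  n%:R * T <= x <= n%:R * T + T \/ - n.+1%:R * T <= x <= - n.+1%:R * T + T.
Proof.
move=> T0; have /andP[k1 k2] := floor_itv (x / T).
move: k1 k2; rewrite ler_pdivlMr// ltr_pdivrMr// intrD mulrDl mul1r.
case: (Num.floor _) => n k1 k2; exists n; [left|right].
  by rewrite k1 ltW.
by move: k1 k2; rewrite NegzE mulrNz => -> /ltW ->.
Qed.

End RealLemmas.

Section AlmostEverywhere.
Context {R : realType}.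
Local Notation mu := (@lebesgue_measure R).

Lemma ae_imp (P Q : R -> Prop) : (forall x, P x -> Q x) ->
  {ae mu, forall x, P x} -> {ae mu, forall x, Q x}.
Proof.
move=> PQ hP; have : mu.-negligible (~` [set x | P x]) := hP.
by apply: negligibleS => x nQ Px; apply: nQ; exact: PQ.
Qed.

Lemma ae_imp2 (P Q S : R -> Prop) : (forall x, P x -> Q x -> S x) ->
  {ae mu, forall x, P x} -> {ae mu, forall x, Q x} -> {ae mu, forall x, S x}.
Proof.
move=> PQ hP hQ.
have hP' : mu.-negligible (~` [set x | P x]) := hP.
have hQ' : mu.-negligible (~` [set x | Q x]) := hQ.
apply: negligibleS (negligibleU hP' hQ') => x nS.
have [Px|nPx] := pselect (P x); [right=> Qx|by left].
by apply: nS; exact: PQ.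
Qed.

Lemma ae_all (P : nat -> R -> Prop) : (forall n, {ae mu, forall x, P n x}) ->
  {ae mu, forall x, forall n, P n x}.
Proof. by move=> h; apply: ae_foralln. Qed.

End AlmostEverywhere.

(** * Continuous representatives *)

Section Morrey.
Context {R : realType}.
Local Notation mu := (@lebesgue_measure R).
Variables (p : R) (g : R -> R).
Hypothesis hp : 3%:R < p.
Hypothesis mg : measurable_fun setT g.
Hypothesis pg : forall x, g (x + pi *+ 2) = g x.
Hypothesis Lpg : (\int[mu]_(x in `[0%R, (pi *+ 2)%R]) (`|g x| `^ p)%:E)%E \is a fin_num.

Let q (x w : R) : \bar R := (`|g (x + w) - g x| `^ p / `|w| `^ (p - 1))%:E.
Let e (x : R) : \bar R := (\int[mu]_(w in `[(- pi)%R, pi]) q x w)%E.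
Hypothesis Eg : (\int[mu]_(x in `[0%R, (pi *+ 2)%R]) e x)%E \is a fin_num.

Let p1 : 1 < p. Proof. by move: hp; lra. Qed.

Let twopi_gt0 : 0 < pi *+ 2 :> R. Proof. by rewrite pmulrn_rgt0 ?pi_gt0. Qed.

Let q0 x w : (0 <= q x w)%E.
Proof. by rewrite lee_fin divr_ge0 ?powR_ge0. Qed.

Let mq2 : measurable_fun setT ((fun z => q z.1 z.2) : R * R -> \bar R).
Proof.
apply/measurable_EFinP; apply: measurable_funM.
  apply: (measurableT_comp (measurable_powR p)).
  apply: measurableT_comp => //; apply: measurable_funB.
    apply: measurableT_comp => //; exact: measurable_funD.
  exact: measurableT_comp.
apply: (measurableT_comp measurable_invr).
apply: (measurableT_comp (measurable_powR (p - 1))).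
exact: measurableT_comp.
Qed.

Let mq x : measurable_fun setT (q x).
Proof. exact: (measurableT_comp mq2 (measurable_pair1 x)). Qed.

Let me : measurable_fun setT e.
Proof. exact: measurable_tonelli. Qed.

Let e0 x : (0 <= e x)%E.
Proof. exact: integral_ge0. Qed.

Let pe x : e (x + pi *+ 2) = e x.
Proof. by apply: eq_integral => w _; rewrite /q addrAC !pg. Qed.

Let E : R := fine (\int[mu]_(x in `[0%R, (pi *+ 2)%R]) e x).

Let EE a : (\int[mu]_(x in `[a, (a + pi *+ 2)%R]) e x = E%:E)%E.
Proof.
by rewrite ge0_integral_period// fineK.
Qed.

Let E0 : 0 <= E. Proof. by apply: fine_ge0; apply: integral_ge0 => *; exact: e0. Qed.

(** The pointwise bound [|g| <= 1 + |g| ^ p] and periodicity turn the [L^p] hypothesis into local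
    integrability. *)
Let intg (a r : R) : r <= pi -> mu.-integrable `[(a - r)%R, (a + r)%R] (EFin \o g).
Proof.
move=> rpi.
suff H : mu.-integrable `[(a - pi)%R, (a - pi + pi *+ 2)%R] (EFin \o g).
  by apply: integrableS H => //; apply: subset_itv; rewrite bnd_simp; lra.
apply/integrableP; split; first exact/measurable_EFinP/measurable_funTS.
pose h x : \bar R := (1 + `|g x| `^ p)%:E.
have mh : measurable_fun setT h.
  apply/measurable_EFinP; apply: measurable_funD => //.
  by apply: (measurableT_comp (measurable_powR p)); exact: measurableT_comp.
have h0 x : (0 <= h x)%E by rewrite lee_fin addr_ge0 ?powR_ge0.
apply: (@le_lt_trans _ _ (\int[mu]_(x in `[(a - pi)%R, (a - pi + pi *+ 2)%R]) h x)%E).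
  apply: ge0_le_integral => //=.
  - by apply/measurable_EFinP/measurable_funTS; exact: measurableT_comp.
  - exact: measurable_funTS.
  - move=> x _; rewrite lee_fin.
    have [g1|g1] := leP `|g x| 1; first by have := powR_ge0 `|g x| p; lra.
    by rewrite (le_trans (le1r_powR (ltW g1) (ltW p1)))// lerDr.
rewrite ge0_integral_period//; last by move=> x; rewrite /h pg.
under eq_integral do rewrite /h EFinD.
rewrite ge0_integralD//=; last first.
  apply/measurable_EFinP/measurable_funTS.
  by apply: (measurableT_comp (measurable_powR p)); exact: measurableT_comp.
rewrite lte_add_pinfty ?ltey_eq ?Lpg// integral_cst//= mul1e lebesgue_measure_itv/=.
by case: ifP => _; rewrite ?ltry// -EFinB ltry.
Qed.

Let muI (a r : R) : 0 < r -> mu `[(a - r)%R, (a + r)%R] = (r *+ 2)%:E.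
Proof.
move=> r0; rewrite lebesgue_measure_itv/= lte_fin ifT; last lra.
by rewrite -EFinB; congr EFin; ring.
Qed.

Let icst (a r c : R) : 0 < r -> mu.-integrable `[(a - r)%R, (a + r)%R] (EFin \o cst c).
Proof.
move=> r0; apply: continuous_compact_integrable; first exact: segment_compact.
by apply: continuous_subspaceT => x; exact: cvg_cst.
Qed.

Let igc (a r c : R) : 0 < r -> r <= pi ->
  mu.-integrable `[(a - r)%R, (a + r)%R] (EFin \o (fun z => g z - c)).
Proof.
move=> r0 rpi.
have mI : measurable (`[(a - r)%R, (a + r)%R]%classic : set (measurableTypeR R)) by [].
by have := integrableB mI (intg a r rpi) (icst a r c r0); apply: eq_integrable.
Qed.

Let m (a r : R) : R := (r *+ 2)^-1 * \int[mu]_(z in `[(a - r)%R, (a + r)%R]) g z.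

(** The increment is split by [le_split_powR], and [|z - y| <= r *+ 2] pays for the weight in the
    energy. The restriction [r <= pi / 2] keeps [z - y] in the centered period over which [e y]
    integrates. *)
Let shift_bound (a r l y : R) : 0 < r -> r <= pi / 2 -> 0 < l -> a - r <= y <= a + r ->
  (\int[mu]_(z in `[(a - r)%R, (a + r)%R]) (`|g z - g y|)%:E <=
   (l * (r *+ 2))%:E + (l `^ (1 - p) * (r *+ 2) `^ (p - 1))%:E * e y)%E.
Proof.
move=> r0 rpi l0 /andP[yl yr].
pose C := l `^ (1 - p) * (r *+ 2) `^ (p - 1).
have C0 : 0 <= C by rewrite mulr_ge0 ?powR_ge0.
have mqy : measurable_fun setT (fun z : R => q y (z - y)).
  by apply: (measurableT_comp (mq y)); exact: measurable_funB.
have mgy : measurable_fun setT (fun z : R => (`|g z - g y|)%:E).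
  by apply/measurable_EFinP; apply: measurableT_comp => //; exact: measurable_funB.
apply: (@le_trans _ _ (\int[mu]_(z in `[(a - r)%R, (a + r)%R]) (l%:E + C%:E * q y (z - y)))%E).
  apply: ge0_le_integral => //.
  - exact: measurable_funTS.
  - by apply: emeasurable_funD => //; apply: measurable_funeM; exact: measurable_funTS.
  - move=> z /=; rewrite in_itv/= => /andP[zl zr].
    rewrite /q subrKC -EFinM -EFinD lee_fin.
    rewrite (le_trans (@le_split_powR _ p l _ p1 l0 (normr_ge0 _)))// lerD2l.
    rewrite /C -mulrA ler_wpM2l ?powR_ge0//.
    have [->|zy] := eqVneq z y.
      rewrite subrr normr0 powR0; last by move: p1; lra.
      by rewrite mul0r mulr0.
    rewrite mulrCA -[leLHS]mulr1 ler_wpM2l ?powR_ge0//.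
    rewrite ler_pdivlMr ?mul1r; last by rewrite powR_gt0// normr_gt0 subr_eq0.
    apply: ge0_ler_powR; rewrite ?nnegrE ?normr_ge0//; try (by move: p1; lra).
    by rewrite ler_norml; lra.
rewrite ge0_integralD//; last 3 first.
  - by move=> z _; rewrite lee_fin ltW.
  - by move=> z _; rewrite mule_ge0.
  - by apply: measurable_funeM; exact: measurable_funTS.
rewrite integral_cst//.
rewrite ge0_integralZl; [|by []|exact: (measurable_funTS mqy)|by move=> *; exact: q0|by rewrite lee_fin].
apply: leeD; first by rewrite [X in (_ * X)%E]muI.
apply: lee_pmul; [by rewrite lee_fin|by apply: integral_ge0 => *; exact: q0|exact: lexx|].
rewrite -(@ge0_integral_shift _ y _ _ _ mqy (fun z => q0 _ _)); last by [].
rewrite shift_preimage_itv.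
under eq_integral do rewrite addrAC subrr add0r.
apply: ge0_subset_integral => //; first exact: (measurable_funTS (mq y)).
by apply: subset_itv; rewrite bnd_simp; lra.
Qed.

Let mean_dist (a r l y : R) : 0 < r -> r <= pi / 2 -> 0 < l -> a - r <= y <= a + r ->
  (`|g y - m a r|%:E <= l%:E + (l `^ (1 - p) * (r *+ 2) `^ (p - 2))%:E * e y)%E.
Proof.
move=> r0 rpi l0 yr.
have r2 : 0 < r *+ 2 by lra.
have pi0 := @pi_gt0 R.
have rpi' : r <= pi by lra.
have igy := igc a r (g y) r0 rpi'.
have -> : g y - m a r = - ((r *+ 2)^-1 * \int[mu]_(z in `[(a - r)%R, (a + r)%R]) (g z - g y)).
  rewrite RintegralB//; [|exact: intg|exact: icst].
  by rewrite Rintegral_cst//= muI//= /m; field; lra.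
rewrite normrN normrM gtr0_norm ?invr_gt0// EFinM.
apply: (@le_trans _ _ ((r *+ 2)^-1%:E * (\int[mu]_(z in `[(a - r)%R, (a + r)%R]) (`|g z - g y|)%:E))%E).
  apply: lee_pmul; [by rewrite lee_fin invr_ge0 ltW|by rewrite lee_fin|exact: lexx|].
  rewrite EFin_normr_Rintegral//.
  by apply: le_abse_integral => //; exact: measurable_int igy.
apply: le_trans.
  apply: lee_pmul; last exact: (shift_bound _ _ _ _ r0 rpi l0 yr).
  - by rewrite lee_fin invr_ge0 ltW.
  - exact: integral_ge0.
  - exact: lexx.
have c0 : (0 <= (l * (r *+ 2))%:E)%E by rewrite lee_fin mulr_ge0// ltW.
have c1 : (0 <= (l `^ (1 - p) * (r *+ 2) `^ (p - 1))%:E * e y)%E.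
  by rewrite mule_ge0// lee_fin mulr_ge0 ?powR_ge0.
rewrite ge0_muleDr//.
rewrite -EFinM muleA -EFinM.
apply: leeD; first by rewrite lee_fin mulrCA mulVf ?mulr1 ?gt_eqF.
apply: lee_pmul => //; first by rewrite lee_fin ?mulr_ge0 ?powR_ge0 ?invr_ge0 ?ltW.
rewrite lee_fin mulrCA ler_wpM2l ?powR_ge0//.
rewrite (_ : p - 1 = 1 + (p - 2)); last ring.
rewrite (gt0_powRD _ 1)//.
rewrite powRr1; last exact: ltW.
by rewrite mulKf// gt_eqF.
Qed.

(** The Hölder exponent [1 - 3 / p] of the embedding of W^{1-2/p,p} on the line. For [l = r ^ al]
    the two terms of [mean_dist], integrated over an interval of length comparable to [r], are both
    of order [r ^ al * r]. It is positive exactly because [p > 3]. *)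
Let al : R := (p - 3) / p.

Let al_gt0 : 0 < al. Proof. by rewrite divr_gt0//; move: hp; lra. Qed.

Let scale_exponent (r : R) : 0 < r ->
  (r `^ al) `^ (1 - p) * (r *+ 2) `^ (p - 2) = 2 `^ (p - 2) * (r `^ al * r).
Proof.
move=> r0; have -> : r *+ 2 = 2 * r by ring.
rewrite powRM//; last exact: ltW.
rewrite -powRrM mulrCA; congr (_ * _).
rewrite -[X in _ = _ * X]powRr1; last exact: ltW.
rewrite -!gt0_powRD//; congr (_ `^ _).
by rewrite /al; field; move: p1; lra.
Qed.

Let M : R := 1 + 2 `^ (p - 2) * E.

Let M_ge0 : 0 <= M. Proof. by rewrite addr_ge0// mulr_ge0 ?powR_ge0. Qed.

(** The bound of [mean_dist] is integrated over the smaller interval, where [e] contributes at most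
    the full energy; [r / 2 <= r'] makes the division by the length harmless. The smaller interval
    need not be concentric, so the same estimate serves for halving the radius and for moving the
    centre. *)
Let mean_compare (a b r r' : R) : 0 < r -> r <= pi / 2 -> r / 2 <= r' -> r' <= r ->
  a - r <= b - r' -> b + r' <= a + r -> `|m b r' - m a r| <= M * r `^ al.
Proof.
move=> r0 rpi rr' r'r lb ub.
have r'0 : 0 < r' by lra.
have pi0 := @pi_gt0 R.
have r'pi : r' <= pi by lra.
pose l := r `^ al; have l0 : 0 < l by rewrite powR_gt0.
pose C := l `^ (1 - p) * (r *+ 2) `^ (p - 2).
have C0 : 0 <= C by rewrite mulr_ge0 ?powR_ge0.
have igm := igc b r' (m a r) r'0 r'pi.
have -> : m b r' - m a r =
    (r' *+ 2)^-1 * \int[mu]_(z in `[(b - r')%R, (b + r')%R]) (g z - m a r).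
  rewrite RintegralB//; [|exact: intg|exact: icst].
  by rewrite Rintegral_cst//= muI//= /m; field; lra.
have r'2 : 0 < r' *+ 2 by lra.
rewrite normrM gtr0_norm ?invr_gt0// ler_pdivrMl//.
rewrite -lee_fin EFin_normr_Rintegral//.
apply: (le_trans (le_abse_integral _ _ _)) => //; first exact: measurable_int igm.
apply: (@le_trans _ _ (\int[mu]_(z in `[(b - r')%R, (b + r')%R]) (l%:E + C%:E * e z))%E).
  apply: ge0_le_integral => //.
  - by apply: measurableT_comp => //; exact: measurable_int igm.
  - by apply: emeasurable_funD => //; apply: measurable_funeM; exact: measurable_funTS.
  - move=> z /=; rewrite in_itv/= => /andP[zl zr].
    by apply: mean_dist => //; apply/andP; split; lra.
rewrite ge0_integralD//; last 3 first.
  - by move=> z _; rewrite lee_fin ltW.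
  - by move=> z _; rewrite mule_ge0.
  - by apply: measurable_funeM; exact: measurable_funTS.
rewrite integral_cst//.
rewrite ge0_integralZl//; last exact: measurable_funTS.
have eE : (\int[mu]_(z in `[(b - r')%R, (b + r')%R]) e z <= E%:E)%E.
  rewrite -(EE (b - pi)); apply: ge0_subset_integral => //; first exact: measurable_funTS.
  by apply: subset_itv; rewrite bnd_simp; lra.
apply: (@le_trans _ _ ((l * (r' *+ 2))%:E + (C * E)%:E)%E).
  apply: leeD; first by rewrite [X in (_ * X)%E]muI.
  by rewrite (EFinM C E); apply: lee_pmul => //; exact: integral_ge0.
rewrite -EFinD lee_fin /C scale_exponent// -/l /M.
have : 0 <= 2 `^ (p - 2) * E * l by rewrite !mulr_ge0 ?powR_ge0.
set Y := 2 `^ (p - 2) => X0.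
have -> : l * (r' *+ 2) + Y * (l * r) * E = l * (r' *+ 2) + (Y * E * l) * r by ring.
have -> : r' *+ 2 * ((1 + Y * E) * l) = l * (r' *+ 2) + (Y * E * l) * (r' *+ 2) by ring.
by rewrite lerD2l ler_wpM2l//; lra.
Qed.

Let rad (k : nat) : R := 2^-1 ^+ k.
Let th : R := 2^-1 `^ al.

Let rad_gt0 k : 0 < rad k. Proof. by rewrite exprn_gt0. Qed.

Let rad_le k : rad k <= pi / 2.
Proof.
have := @pi_ge2 R; have : rad k <= 1 by apply: exprn_ile1; lra.
by lra.
Qed.

Let radS k : rad k.+1 = rad k / 2. Proof. by rewrite /rad exprSr. Qed.

Let rad_al k : rad k `^ al = th ^+ k.
Proof.
rewrite /rad /th -(@powR_mulrn _ 2^-1 k) ?invr_ge0//.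
rewrite -[RHS]powR_mulrn; last exact: powR_ge0.
exact: powRAC.
Qed.

Let th_gt0 : 0 < th. Proof. by rewrite powR_gt0. Qed.

Let th_lt1 : th < 1.
Proof.
have := @gt0_ltr_powR R al al_gt0 2^-1 1.
by rewrite powR1; apply; rewrite ?nnegrE//; lra.
Qed.

Let mean_succ a k : `|m a (rad k.+1) - m a (rad k)| <= M * th ^+ k.
Proof.
by rewrite -rad_al; have := rad_gt0 k => rk; apply: mean_compare => //; rewrite radS; lra.
Qed.

Let lim_exists a := geometric_cauchy _ _ _ M_ge0 th_gt0 th_lt1 (mean_succ a).
(** The representative is the limit of the dyadic means, which exists at every point. The function
    [g] is compared with it only where [e] is finite. *)
Let gt (a : R) : R := sval (cid (lim_exists a)).
Let K : R := M / (1 - th).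

Let gtP a k : `|gt a - m a (rad k)| <= K * th ^+ k.
Proof. exact: (svalP (cid (lim_exists a))). Qed.

Let K_ge0 : 0 <= K. Proof. by rewrite divr_ge0// subr_ge0 ltW. Qed.

Let small_th (C eps : R) : 0 <= C -> 0 < eps -> exists k, C * th ^+ k < eps.
Proof. exact: exprn_small. Qed.

(** The intervals of radius [rad k.+1] about [a] and [b] both lie in the one of radius [rad k] about
    [a], whose mean links the two limits. *)
Let gt_holder a b k : `|a - b| <= rad k.+1 ->
  `|gt a - gt b| <= (K + K + M + M) * th ^+ k.
Proof.
move=> ab; have rk := rad_gt0 k.
have h1 : `|m a (rad k.+1) - m a (rad k)| <= M * th ^+ k := mean_succ a k.
have h2 : `|m b (rad k.+1) - m a (rad k)| <= M * th ^+ k.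
  rewrite -rad_al; move: ab; rewrite radS ler_norml => ab.
  by apply: mean_compare => //; lra.
have ths : th ^+ k.+1 <= th ^+ k.
  by rewrite exprS ger_pMl ?exprn_gt0// ltW.
have ha := gtP a k.+1; have hb := gtP b k.+1.
have Kt : K * th ^+ k.+1 <= K * th ^+ k by rewrite ler_wpM2l.
have {}ha := le_trans ha Kt; have {}hb := le_trans hb Kt.
move: h1 h2 ha hb; rewrite !ler_norml.
move: (m a _) (m b _) (m a _) (gt a) (gt b) => x1 x2 x3 x4 x5.
by move: (th ^+ k) => t; lra.
Qed.

Lemma morrey_continuous_representative :
  exists gt : R -> R, [/\ continuous gt, forall x, gt (x + pi *+ 2) = gt x &
    {ae mu, forall x, g x = gt x}].
Proof.
exists gt; split.
- move=> a; apply/cvgrPdist_lt => eps eps0.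
  have C0 : 0 <= K + K + M + M by move: K_ge0 M_ge0; lra.
  have [k kP] := small_th _ _ C0 eps0.
  near=> b; apply: le_lt_trans kP; apply: gt_holder.
  by near: b; apply: cvgr_dist_le => //; exact: rad_gt0.
- move=> a; apply/eqP; rewrite -subr_eq0 -normr_eq0; apply/negPn/negP => n0.
  have {}n0 : 0 < `|gt (a + pi *+ 2) - gt a| by rewrite lt_def n0 /=.
  have C0 : 0 <= K + K by move: K_ge0; lra.
  have [k kP] := small_th _ _ C0 n0.
  have ma : m (a + pi *+ 2) (rad k) = m a (rad k).
    rewrite /m; congr (_ * fine _).
    (* Translation of integrals is available for nonnegative functions, hence the passage to
       positive and negative parts. *)
    rewrite integralE [RHS]integralE.
    have S (f : R -> \bar R) : measurable_fun setT f -> (forall x, 0 <= f x)%E ->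
        (forall x, f (x + pi *+ 2) = f x) ->
        (\int[mu]_(x in `[(a + pi *+ 2 - rad k)%R, (a + pi *+ 2 + rad k)%R]) f x =
        \int[mu]_(x in `[(a - rad k)%R, (a + rad k)%R]) f x)%E.
      move=> mf f0 pf.
      rewrite -[RHS](_ : (\int[mu]_(x in `[(a - rad k)%R, (a + rad k)%R]) f (pi *+ 2 + x)%R)%E = _).
        rewrite ge0_integral_shift_itv//.
        by rewrite !(addrAC _ (pi *+ 2)).
      by apply: eq_integral => x _; rewrite addrC pf.
    have mEg : measurable_fun setT (EFin \o g) by exact/measurable_EFinP.
    congr (_ - _)%E; apply: S => //.
    + exact: measurable_funepos.
    + by move=> x; rewrite !funeposE /= pg.
    + exact: measurable_funeneg.
    + by move=> x; rewrite !funenegE /= pg.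
  have h1 := gtP (a + pi *+ 2) k; have h2 := gtP a k.
  rewrite ma in h1.
  suff : `|gt (a + pi *+ 2) - gt a| <= (K + K) * th ^+ k by move=> /le_lt_trans/(_ kP); rewrite ltxx.
  rewrite mulrDl -(subrK (m a (rad k)) (gt (a + pi *+ 2))) -addrA.
  by rewrite (le_trans (ler_normD _ _))// lerD// distrC.
(* Where the energy density is finite, [mean_dist] shows that the dyadic means also converge to
   [g y]. *)
- have fin_eq y : e y \is a fin_num -> g y = gt y.
    move=> ey; apply/eqP; rewrite -subr_eq0 -normr_eq0; apply/negPn/negP => n0.
    have {}n0 : 0 < `|g y - gt y| by rewrite lt_def n0 /=.
    have ey0 : 0 <= fine (e y) by rewrite fine_ge0.
    have D0 : 0 <= K + (1 + 2 `^ (p - 2) * fine (e y)).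
      by rewrite addr_ge0// addr_ge0// mulr_ge0 ?powR_ge0.
    have [k kP] := small_th _ _ D0 n0.
    have l0 : 0 < rad k `^ al by rewrite powR_gt0.
    have := mean_dist _ _ _ _ (rad_gt0 k) (rad_le k) l0 (_ : y - rad k <= y <= y + rad k).
    rewrite scale_exponent// -(fineK ey) -EFinM -EFinD lee_fin => h.
    have {}h : `|g y - m y (rad k)| <= (1 + 2 `^ (p - 2) * fine (e y)) * th ^+ k.
      apply: (le_trans (h _)); first by have := rad_gt0 k; lra.
      rewrite -rad_al mulrDl mul1r lerD2l.
      set X := 2 `^ (p - 2); set Y := fine (e y); set Z := rad k `^ al.
      have -> : X * (Z * rad k) * Y = (X * Y * Z) * rad k by ring.
      rewrite ler_piMr ?mulr_ge0 ?powR_ge0//.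
      by apply: exprn_ile1; lra.
    have h2 := gtP y k.
    suff : `|g y - gt y| <= (K + (1 + 2 `^ (p - 2) * fine (e y))) * th ^+ k.
      by move=> /le_lt_trans/(_ kP); rewrite ltxx.
    by rewrite (le_trans (ler_distD (m y (rad k)) _ _))// mulrDl [leRHS]addrC lerD// distrC.
  have fin_ae a : {ae mu, forall x, `[a, (a + pi *+ 2)%R]%classic x -> e x \is a fin_num}.
    apply: integrable_ae => //; apply/integrableP; split; first exact: measurable_funTS.
    by under eq_integral do rewrite gee0_abs//; rewrite EE ltry.
  pose P (n : nat) (x : R) := (n%:R * (pi *+ 2) <= x <= n%:R * (pi *+ 2) + pi *+ 2 ->
      e x \is a fin_num) /\
     (- n.+1%:R * (pi *+ 2) <= x <= - n.+1%:R * (pi *+ 2) + pi *+ 2 -> e x \is a fin_num).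
  have Pn n : {ae mu, forall x, P n x}.
    apply: (ae_imp2 _ _ _ _ (fin_ae (n%:R * (pi *+ 2))) (fin_ae (- n.+1%:R * (pi *+ 2)))) => x.
    by rewrite /P /= !in_itv/=; split.
  apply: (ae_imp _ _ _ (ae_all _ Pn)) => x h; apply: fin_eq.
  have [n [nx|nx]] := itv_cover _ x twopi_gt0; have [h1 h2] := h n.
  - exact: h1.
  - exact: h2.
Unshelve. all: by end_near.
Qed.

End Morrey.

(** * Antiderivatives, monotonicity and trigonometric test functions *)

Section Calculus.
Context {R : realType}.
Local Notation mu := (@lebesgue_measure R).
Implicit Types (f g F G h : R -> R) (a b c x y : R).

Lemma is_derive_continuous F f : (forall x, is_derive x 1 F (f x)) -> continuous F.
Proof.
move=> dF x; apply: differentiable_continuous; apply/derivable1_diffP.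
by have [] := dF x.
Qed.

Lemma is_derive_shift F c x (d : R) :
  is_derive (x + c) 1 F d -> is_derive x 1 (fun y => F (y + c)) d.
Proof.
move=> dF.
have dx : is_derive x 1 (fun y : R => y + c) 1.
  have := is_deriveD (is_derive_id x (1 : R)) (is_derive_cst c x (1 : R)).
  by rewrite addr0.
by have := @is_derive1_comp R F (fun y => y + c) x d 1 dF dx; rewrite mulr1.
Qed.

Lemma continuous_within f (A : set R) : continuous f -> {within A, continuous f}.
Proof. exact: continuous_subspaceT. Qed.

Lemma continuous_integrable_itv f a b : continuous f ->
  mu.-integrable `[a, b] (EFin \o f).
Proof.
move=> cf; apply: continuous_compact_integrable; first exact: segment_compact.
exact: continuous_within.
Qed.

Lemma antiderivative_exists f : continuous f ->
  exists F, forall x, is_derive x 1 F (f x).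
Proof.
move=> cf.
pose I a b := \int[mu]_(t in `[a, b]) f t.
(* One of the two integrals is over an empty or one-point interval, so [F] is the oriented integral
   from [0]. The identity [FE] moves the base point to [- N], to the left of the point of interest,
   where the fundamental theorem applies. *)
pose F y := I 0 y - I y 0.
have FE (N y : R) : 0 < N -> - N < y -> F y = I (- N) y - I (- N) 0.
  move=> N0 Ny; have [y0|y0] := leP 0 y.
    rewrite /I Rintegral_itvB ?bnd_simp//; [|exact: continuous_integrable_itv|lra].
    rewrite Rintegral_itv_obnd_cbnd; last first.
      have ii := continuous_integrable_itv f 0 y cf.
      by apply: integrableS ii => //; exact: subset_itv_oc_cc.
    rewrite /F /I; move: y0; rewrite le_eqVlt => /predU1P[<-|y0].
      by rewrite set_itv1 Rintegral_set1 subr0.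
    by rewrite [in X in _ - X]set_itv_ge ?bnd_simp -?ltNge// Rintegral_set0 subr0.
  rewrite -[RHS]opprB /I Rintegral_itvB ?bnd_simp; [|exact: continuous_integrable_itv|lra|lra].
  rewrite Rintegral_itv_obnd_cbnd; last first.
    have ii := continuous_integrable_itv f y 0 cf.
    by apply: integrableS ii => //; exact: subset_itv_oc_cc.
  by rewrite /F /I [in X in X - _]set_itv_ge ?bnd_simp -?ltNge// Rintegral_set0 sub0r.
exists F => x.
pose N := `|x| + 1.
have N0 : 0 < N by rewrite /N; have := normr_ge0 x; lra.
have Nx : - N < x by rewrite /N; have := lerNnormlW (lexx `|x|); lra.
have xS : x < x + 1 by lra.
have [dG dGE] := @continuous_FTC1_closed R f (- N) x (x + 1) xS
  (continuous_integrable_itv _ _ _ cf) Nx (cf x).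
have H : is_derive x 1 (fun y => I (- N) y - I (- N) 0) (f x).
  rewrite -[f x]subr0; apply: is_deriveB.
  apply: DeriveDef; first exact: dG.
  by rewrite -derive1E; exact: dGE.
apply: near_eq_is_derive H.
near=> y; rewrite (FE N)//.
by near: y; exact: lt_nbhsr.
Unshelve. all: by end_near. Qed.

Lemma Rintegral_antiderivative f F a b : continuous f ->
  (forall x, is_derive x 1 F (f x)) -> a < b ->
  \int[mu]_(x in `[a, b]) f x = F b - F a.
Proof.
move=> cf dF ab; rewrite /Rintegral (@continuous_FTC2 _ _ F)//.
- exact: continuous_within.
- have cF := is_derive_continuous _ _ dF; split.
  + by move=> x _; have [] := dF x.
  + exact/cvg_at_right_filter/cF.
  + exact/cvg_at_left_filter/cF.
- by move=> x _; rewrite derive1E; have [] := dF x.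
Qed.

Lemma derive_lower_bound f F a b c : (forall x, is_derive x 1 F (f x)) ->
  a <= b -> (forall x, a <= x <= b -> c <= f x) -> c * (b - a) <= F b - F a.
Proof.
move=> dF ab cf.
have [|x xab ->] := @MVT_segment R F f a b ab (fun x _ => dF x).
  by apply: continuous_within; exact: is_derive_continuous dF.
by rewrite ler_wpM2r ?subr_ge0// cf//; move: xab; rewrite in_itv.
Qed.

Lemma is_derive_funB F G x (df dg : R) : is_derive x 1 F df -> is_derive x 1 G dg ->
  is_derive x 1 (fun y => F y - G y) (df - dg).
Proof. by move=> ? ?; apply: is_deriveB. Qed.

Lemma is_derive_funD F G x (df dg : R) : is_derive x 1 F df -> is_derive x 1 G dg ->
  is_derive x 1 (fun y => F y + G y) (df + dg).
Proof. by move=> ? ?; apply: is_deriveD. Qed.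

Lemma is_derive_funM F G x (df dg : R) : is_derive x 1 F df -> is_derive x 1 G dg ->
  is_derive x 1 (fun y => F y * G y) (F x * dg + G x * df).
Proof. by move=> ? ?; apply: is_deriveM. Qed.

Lemma derive_period_diff F f (T : R) : (forall x, is_derive x 1 F (f x)) ->
  (forall x, f (x + T) = f x) -> forall x y, F (x + T) - F x = F (y + T) - F y.
Proof.
move=> dF pf x y.
apply: (@is_derive_0_is_cst R (fun x => F (x + T) - F x)) => z.
rewrite -(subrr (f z)); apply: is_derive_funB => //.
by apply: is_derive_shift; rewrite -pf.
Qed.

(** Test functions must have derivatives of all orders. This class is closed under differentiation,
    so its members are smooth by induction; the translations [a] are built in because translated
    kernels serve as test functions. *)
Inductive trigpoly : (R -> R) -> Prop :=
| trigpoly_cst c : trigpoly (fun=> c)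
| trigpoly_sin a : trigpoly (fun x => sin (x + a))
| trigpoly_cos a : trigpoly (fun x => cos (x + a))
| trigpoly_add f g : trigpoly f -> trigpoly g -> trigpoly (fun x => f x + g x)
| trigpoly_mul f g : trigpoly f -> trigpoly g -> trigpoly (fun x => f x * g x).

Lemma trigpoly_derive f : trigpoly f ->
  exists2 f', trigpoly f' & forall x, is_derive x 1 f (f' x).
Proof.
elim=> [c|a|a|{}f g tf [f' tf' df] tg [g' tg' dg]|{}f g tf [f' tf' df] tg [g' tg' dg]].
- by exists (fun=> 0); [exact: trigpoly_cst|move=> x; exact: is_derive_cst].
- exists (fun x => cos (x + a)); first exact: trigpoly_cos.
  by move=> x; apply: is_derive_shift; exact: is_derive_sin.
- exists (fun x => -1 * sin (x + a)).
    by apply: trigpoly_mul; [exact: trigpoly_cst|exact: trigpoly_sin].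
  by move=> x; apply: is_derive_shift; rewrite mulN1r; exact: is_derive_cos.
- exists (fun x => f' x + g' x); first exact: trigpoly_add.
  by move=> x; exact: is_derive_funD.
- exists (fun x => f x * g' x + g x * f' x).
    by apply: trigpoly_add; exact: trigpoly_mul.
  by move=> x; exact: is_derive_funM.
Qed.

Lemma trigpoly_smooth f : trigpoly f -> smooth f.
Proof.
move=> + n; elim: n f => [|n IH] f tf x; have [f' tf' df] := trigpoly_derive _ tf.
  by rewrite derive1n0; have [] := df x.
rewrite derive1Sn (_ : f^`()%classic = f'); first exact: IH.
by apply/funext => y; rewrite derive1E; have [] := df y.
Qed.

(** An antiderivative can acquire a linear term and leave the class; it suffices that its first
    derivative lies in it. *)
Lemma antiderivative_smooth F f : trigpoly f -> (forall x, is_derive x 1 F (f x)) ->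
  smooth F.
Proof.
move=> tf dF [|n] x; first by rewrite derive1n0; have [] := dF x.
rewrite derive1Sn (_ : F^`()%classic = f); first exact: trigpoly_smooth.
by apply/funext => y; rewrite derive1E; have [] := dF y.
Qed.

Lemma trigpoly_exp f n : trigpoly f -> trigpoly (fun x => f x ^+ n).
Proof.
move=> tf; elim: n => [|n IH]; first exact: (trigpoly_cst 1).
by under eq_fun do rewrite exprS; exact: trigpoly_mul.
Qed.

Lemma trigpoly_continuous f : trigpoly f -> continuous f.
Proof. by move=> /trigpoly_derive[f' _ /is_derive_continuous]. Qed.

Lemma is_derive_derive1 F f : (forall x, is_derive x 1 F (f x)) -> derive1 F = f.
Proof. by move=> dF; apply/funext => y; rewrite derive1E; have [] := dF y. Qed.

End Calculus.

(** * The du Bois-Reymond lemma *)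

Section DuBoisReymond.
Context {R : realType}.
Local Notation mu := (@lebesgue_measure R).
Local Notation tpi := (pi *+ 2 : R).

Let tpi0 : 0 < tpi. Proof. by rewrite pmulrn_rgt0 ?pi_gt0. Qed.

(* The powers of 1 + cos u - cos de concentrate on |u| < de. *)
Let K (de : R) (n : nat) (u : R) : R := (1 + cos u - cos de) ^+ n.

Let K_trigpoly de n a : trigpoly (fun u => K de n (u + a)).
Proof.
rewrite /K; apply: trigpoly_exp.
rewrite (_ : (fun x => _) = (fun x => (1 - cos de) + cos (x + a))).
  by apply: trigpoly_add; [exact: trigpoly_cst|exact: trigpoly_cos].
by apply/funext => x; ring.
Qed.

Let K_continuous de n : continuous (K de n).
Proof.
have := trigpoly_continuous _ (K_trigpoly de n 0).
rewrite (_ : (fun u => K de n (u + 0)) = K de n); first exact.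
by apply/funext => v; rewrite addr0.
Qed.

(** The hypothesis says, through an antiderivative [W], that [k] times each kernel has integral zero
    over the centered period. If [k 0] were positive, the part with [|u| <= de / 2] would grow like
    [q ^+ n] with [q > 1]. For [|u|] between [de / 2] and [de] the integrand is nonnegative, and
    beyond [de] the kernel is at most [1] in absolute value. *)
Lemma concentration (k : R -> R) : continuous k -> 
  (forall (de : R) (n : nat) (W : R -> R),
     (forall u : R, is_derive u (1 : R) W (k u * K de n u)) ->
     W (pi : R) = W (- pi)) -> k 0 <= 0.
Proof.
move=> ck kK; rewrite leNgt; apply/negP => k0.
have pi0 := @pi_gt0 R.
have [M M0 kM] : exists2 M : R, 0 <= M & forall u : R, - pi <= u <= pi -> `|k u| <= M.
  have ab : - pi <= pi :> R by lra.
  have cn : {within `[(- pi : R), pi], continuous (fun u => `|k u|)}.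
    apply: continuous_within => u; exact: (cvg_comp _ _ (ck u) (@norm_continuous _ R _)).
  have [c _ cP] := EVT_max ab cn.
  exists `|k c| => // u uab; apply: cP; by rewrite in_itv.
have [de [de0 depi] dek] : exists2 de : R, 0 < de /\ de < pi / 2 & forall u : R, `|u| <= de -> k 0 / 2 <= k u.
  have k02 : 0 < k 0 / 2 by lra.
  have /cvgrPdist_lt/(_ _ k02)[e /= e0 eP] := ck 0.
  exists (Num.min (e / 2) (pi / 4)).
    by rewrite lt_min gt_min; split; [apply/andP; split; lra|apply/orP; right; lra].
  move=> u; rewrite le_min => /andP[ue _].
  have : ball 0 e u by rewrite /ball/= sub0r normrN; lra.
  by move/eP; rewrite ltr_norml; lra.
pose q := 1 + cos (de / 2) - cos de.
have q1 : 1 < q.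
  have : cos de < cos (de / 2) by rewrite ltr_cos ?in_itv/=; lra.
  by rewrite /q; lra.
have cosle (u : R) : 0 <= u -> u <= pi -> forall v : R, 0 <= v -> v <= pi -> u <= v -> cos v <= cos u.
  by move=> ? ? v ? ? uv; rewrite leNgt ltr_cos ?in_itv/= -?leNgt//; lra.
have cosabs (u : R) : cos u = cos `|u| by have [_|_] := ger0P u => //; rewrite cosN.
(* For this [n] the lower bound [k 0 / 2 * de * q ^+ n] of the central part exceeds [M * tpi], which
   bounds all negative contributions. *)
have [n nP] : exists n, (M * tpi) * q^-1 ^+ n < k 0 / 2 * de.
  apply: exprn_small; rewrite ?invr_gt0 ?invf_lt1//; try lra.
  - by rewrite mulr_ge0//; lra.
  - by rewrite mulr_gt0//; lra.
have qn : 0 < q ^+ n by rewrite exprn_gt0//; lra.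
rewrite exprVn ltr_pdivrMr// in nP.
have cK : continuous (fun u => k u * K de n u).
  move=> u; apply: cvgM; first exact: ck.
  exact: K_continuous.
have [W dW] := antiderivative_exists _ cK.
have W0 := kK _ _ _ dW.
have far (u : R) : de <= `|u| -> `|u| <= pi -> - M <= k u * K de n u.
  move=> ud upi.
  have : `|k u * K de n u| <= M.
    rewrite normrM -[leRHS]mulr1 ler_pM//.
      by apply: kM; rewrite -ler_norml.
    rewrite normrX exprn_ile1// ler_norml.
    have := cosle de (ltW de0) _ `|u| (normr_ge0 _) upi ud.
    rewrite -cosabs => /(_ ltac:(lra)) cu.
    have := cos_geN1 u; have := cos_le1 de; lra.
  by rewrite ler_norml => /andP[].
have mid (u : R) : `|u| <= de -> 0 <= k u * K de n u.
  move=> ud; rewrite mulr_ge0//; first by have := dek u ud; lra.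
  rewrite exprn_ge0//.
  have := cosle `|u| (normr_ge0 _) _ de (ltW de0) _ ud.
  by rewrite -cosabs => /(_ ltac:(lra) ltac:(lra)); lra.
have near0 (u : R) : `|u| <= de / 2 -> k 0 / 2 * q ^+ n <= k u * K de n u.
  move=> ud; have h1 := dek u ltac:(lra).
  rewrite ler_pM//; try lra.
  rewrite lerXn2r ?nnegrE//; try lra.
    have := cosle `|u| (normr_ge0 _) _ de (ltW de0) _ _.
    by rewrite -cosabs => /(_ ltac:(lra) ltac:(lra) ltac:(lra)); lra.
  have := cosle `|u| (normr_ge0 _) _ (de / 2) _ _ ud.
  by rewrite -cosabs /q => /(_ ltac:(lra) ltac:(lra) ltac:(lra)); lra.
have low (u : R) : `|u| <= pi -> - M <= k u * K de n u.
  move=> upi; have [ud|ud] := leP de `|u|; first exact: far.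
  by have := mid u (ltW ud); lra.
have h1 : - M * (- (de / 2) - - pi) <= W (- (de / 2)) - W (- pi).
  apply: derive_lower_bound dW _ _; first lra.
  by move=> u hu; apply: low; rewrite ler_norml; lra.
have h2 : - M * (pi - de / 2) <= W pi - W (de / 2).
  apply: derive_lower_bound dW _ _; first lra.
  by move=> u hu; apply: low; rewrite ler_norml; lra.
have h3 : k 0 / 2 * q ^+ n * (de / 2 - - (de / 2)) <= W (de / 2) - W (- (de / 2)).
  apply: derive_lower_bound dW _ _; first lra.
  by move=> u hu; apply: near0; rewrite ler_norml.
have Md : 0 <= M * de by rewrite mulr_ge0// ltW.
have e1 : k 0 / 2 * q ^+ n * (de / 2 - - (de / 2)) = k 0 / 2 * de * q ^+ n by field.
move: nP h1 h2 h3; rewrite e1 W0.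
have -> : - M * (- (de / 2) - - pi) = - (M * pi) + M * de / 2 by field.
have -> : - M * (pi - de / 2) = - (M * pi) + M * de / 2 by field.
have -> : M * tpi = M * pi + M * pi by ring.
lra.
Qed.

Lemma continuous_shift (h : R -> R) (a : R) : continuous h -> continuous (fun u => h (u + a)).
Proof.
move=> ch x; apply: (@continuous_comp _ _ _ (fun u : R => u + a) h); last exact: ch.
by apply: cvgD; [exact: cvg_id|exact: cvg_cst].
Qed.

(** With [G] an antiderivative of [gt], the function [h = f - G] is orthogonal to derivatives of
    smooth periodic functions, and it remains to see that it is constant. The difference of two
    translates of a concentrating kernel has mean zero, so it is such a derivative; testing with it
    compares [h a] with [h b]. *)
Lemma du_bois_reymond (f gt : R -> R) : continuous f -> continuous gt ->
  (forall x, f (x + tpi) = f x) -> (forall x, gt (x + tpi) = gt x) ->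
  (forall phi, smooth phi -> (forall x, phi (x + tpi) = phi x) ->
    \int[mu]_(x in `[0, tpi]) (f x * derive1 phi x) =
    - \int[mu]_(x in `[0, tpi]) (gt x * phi x)) ->
  forall x : R, is_derive x (1 : R) f (gt x).
Proof.
move=> cf cg pf pgt weak.
have [G dG] := antiderivative_exists _ cg.
have cG := is_derive_continuous _ _ dG.
(* The constant test function [1] shows that [gt] has mean zero over a period, which makes [G]
   periodic. *)
have pG x : G (x + tpi) = G x.
  have tp1 : trigpoly (fun=> (1 : R)) by exact: trigpoly_cst.
  have d1 : derive1 (fun=> (1 : R)) = (fun=> 0) :> (R -> R).
    by apply: is_derive_derive1 => y; exact: is_derive_cst.
  have := weak _ (trigpoly_smooth _ tp1) (fun=> erefl).
  rewrite d1; under eq_Rintegral do rewrite mulr0.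
  rewrite Rintegral_cst// mul0r; under eq_Rintegral do rewrite mulr1.
  rewrite (Rintegral_antiderivative _ _ _ _ cg dG tpi0) => /eqP.
  rewrite eq_sym oppr_eq0 => /eqP G0; apply/eqP; rewrite -subr_eq0.
  by rewrite (derive_period_diff _ _ _ dG pgt x 0) add0r G0.
pose h x := f x - G x.
have ch : continuous h by move=> x; apply: cvgB; [exact: cf|exact: cG].
have ph x : h (x + tpi) = h x by rewrite /h pf pG.
have hphi phi phi' : smooth phi -> continuous phi' -> (forall x : R, is_derive x (1 : R) phi (phi' x)) ->
    (forall x, phi (x + tpi) = phi x) -> \int[mu]_(x in `[0, tpi]) (h x * phi' x) = 0.
  move=> sphi cphi' dphi pphi.
  have cphi := is_derive_continuous _ _ dphi.
  have cfp : continuous (fun x => f x * phi' x) by move=> x; apply: cvgM; [exact: cf|exact: cphi'].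
  have cGp : continuous (fun x => G x * phi' x) by move=> x; apply: cvgM; [exact: cG|exact: cphi'].
  have cgp : continuous (fun x => phi x * gt x) by move=> x; apply: cvgM; [exact: cphi|exact: cg].
  have cs : continuous (fun x => G x * phi' x + phi x * gt x).
    by move=> x; apply: cvgD; [exact: cGp|exact: cgp].
  have := Rintegral_antiderivative _ (fun x => G x * phi x) 0 tpi cs
    (fun x => is_derive_funM _ _ _ _ _ (dG x) (dphi x)) tpi0.
  rewrite -[X in G X * phi X]add0r pG pphi subrr.
  rewrite RintegralD//; [|exact: continuous_integrable_itv..].
  have := weak _ sphi pphi; rewrite (is_derive_derive1 _ _ dphi) => h1 h2.
  rewrite /h; under eq_Rintegral do rewrite mulrBl.
  rewrite RintegralB//; [|exact: continuous_integrable_itv..].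
  rewrite h1; move: h2; under [X in _ + X]eq_Rintegral do rewrite mulrC.
  by move=> /eqP; rewrite addrC addr_eq0 => /eqP ->; rewrite opprK subrr.
(* One inequality for all [a] and [b] is enough, since their roles can be exchanged. *)
have hle a b : h a <= h b.
  rewrite -subr_le0.
  pose k u := h (u + a) - h (u + b).
  have -> : h a - h b = k 0 by rewrite /k !add0r.
  have ck : continuous k.
    by move=> u; apply: cvgB; apply: continuous_shift.
  apply: concentration => // de n W dW.
  pose T := K de n.
  have cT : continuous T by exact: K_continuous.
  have pT u : T (u + tpi) = T u by rewrite /T /K cosD2pi.
  have [Psi dPsi] := antiderivative_exists _ cT.
  pose phi y := Psi (y - a) - Psi (y - b).
  pose phi' y := T (y - a) - T (y - b).
  have dphi (y : R) : is_derive y (1 : R) phi (phi' y).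
    by apply: is_derive_funB; apply: is_derive_shift.
  have tphi' : trigpoly phi'.
    rewrite /phi' (_ : (fun y => _) = (fun y => T (y + - a) + -1 * T (y + - b))).
      apply: trigpoly_add; first exact: K_trigpoly.
      by apply: trigpoly_mul; [exact: trigpoly_cst|exact: K_trigpoly].
    by apply/funext => y; rewrite mulN1r.
  have pphi y : phi (y + tpi) = phi y.
    have := derive_period_diff _ _ _ dPsi pT (y - a) (y - b).
    have e1 c : y + tpi - c = y - c + tpi by ring.
    by rewrite /phi !e1; clear; lra.
  have H := hphi _ _ (antiderivative_smooth _ _ tphi' dphi) (trigpoly_continuous _ tphi') dphi pphi.
  have cc c : continuous (fun u => h (u + c) * T u).
    by move=> u; apply: cvgM; [exact: continuous_shift|exact: cT].
  (* Antiderivatives [Wa] and [Wb] of the two translated products replace a change of variables; by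
     periodicity their increments over a full period do not depend on where it starts. *)
  have [Wa dWa] := antiderivative_exists _ (cc a).
  have [Wb dWb] := antiderivative_exists _ (cc b).
  have pc c u : h (u + tpi + c) * T (u + tpi) = h (u + c) * T u.
    by rewrite addrAC ph pT.
  have dd (y : R) : is_derive y (1 : R) (fun y => Wa (y - a) - Wb (y - b)) (h y * phi' y).
    have -> : h y * phi' y = h (y - a + a) * T (y - a) - h (y - b + b) * T (y - b).
      by rewrite !subrK /phi'; ring.
    by apply: is_derive_funB; apply: is_derive_shift.
  have chp : continuous (fun y => h y * phi' y).
    by move=> u; apply: cvgM; [exact: ch|exact: trigpoly_continuous].
  rewrite (Rintegral_antiderivative _ _ _ _ chp dd tpi0) in H.
  have dW' (u : R) : is_derive u (1 : R) (fun u => Wa u - Wb u) (k u * K de n u).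
    have -> : k u * K de n u = h (u + a) * T u - h (u + b) * T u by rewrite /k mulrBl.
    exact: is_derive_funB.
  have WE : W pi - (Wa pi - Wb pi) = W (- pi) - (Wa (- pi) - Wb (- pi)).
    apply: (@is_derive_0_is_cst R (fun u => W u - (Wa u - Wb u))) => u.
    by rewrite -(subrr (k u * K de n u)); apply: is_derive_funB.
  have ea := derive_period_diff _ _ _ dWa (pc a) (- a) (- pi).
  have eb := derive_period_diff _ _ _ dWb (pc b) (- b) (- pi).
  have pipi : - pi + tpi = pi by ring.
  rewrite pipi !(addrC _ tpi) in ea eb.
  by move: H WE ea eb; rewrite !add0r; clear; lra.
have hc a b : h a = h b by apply/eqP; rewrite eq_le !hle.
move=> x; apply: (@near_eq_is_derive _ _ _ (fun y => G y + h x)).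
  by near=> y; rewrite (hc x y) /h addrC subrK.
by rewrite -[gt x]addr0; apply: is_derive_funD.
Unshelve. all: by end_near. Qed.

End DuBoisReymond.

(** * Taylor defects *)

Section Trigonometry.
Context {R : realType}.
Implicit Types (x y v w : R).

Lemma derive_le (F G f g : R -> R) (a b : R) :
  (forall x, is_derive x 1 F (f x)) -> (forall x, is_derive x 1 G (g x)) ->
  a <= b -> (forall x, a <= x <= b -> f x <= g x) -> F b - F a <= G b - G a.
Proof.
move=> dF dG ab fg.
have dH x : is_derive x 1 (fun x => G x - F x) (g x - f x) by exact: is_derive_funB.
have := derive_lower_bound _ _ _ _ 0 dH ab.
rewrite mul0r => /(_ _)/wrap[|]; last by lra.
by move=> x hx; have := fg x hx; lra.
Qed.

Lemma sin_le_id x : 0 <= x -> sin x <= x.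
Proof.
move=> x0.
have := derive_le sin id cos (fun=> 1) 0 x (@is_derive_sin R) (fun x => is_derive_id x (1 : R)) x0.
by rewrite sin0 !subr0; apply=> y _; exact: cos_le1.
Qed.

Lemma normr_sin_le x : `|sin x| <= `|x|.
Proof.
wlog x0 : x / 0 <= x => [H|].
  have [x0|x0] := leP 0 x; first exact: H.
  by rewrite -normrN -sinN -(normrN x); apply: H; lra.
rewrite (ger0_norm x0) ler_norml sin_le_id// andbT.
have := derive_le (fun x => - sin x) id (fun x => - cos x) (fun=> 1) 0 x
 _ (fun x => is_derive_id x (1 : R)) x0.
rewrite sin0 !(oppr0, subr0, addr0) => h; suff : - sin x <= x by lra.
by apply: h => y _; have := cos_geN1 y; lra.
Qed.

Lemma onem_cos_le x : 0 <= x -> 1 - cos x <= x.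
Proof.
move=> x0.
have dc y : is_derive y 1 (fun x => - cos x) (sin y).
  by rewrite -[sin y]opprK; exact: is_deriveN.
have := derive_le (fun x => - cos x) id sin (fun=> 1) 0 x dc (fun x => is_derive_id x (1 : R)) x0.
rewrite cos0 subr0 opprK addrC => h; apply: h => y _; exact: sin_le1.
Qed.

Lemma id_sub_sin_le v : `|v - sin v| <= v ^+ 2.
Proof.
wlog x0 : v / 0 <= v => [H|].
  have [v0|v0] := leP 0 v; first exact: H.
  have : `|- v - sin (- v)| <= (- v) ^+ 2 by apply: H; lra.
  by rewrite sinN sqrrN -normrN opprB opprK addrC.
rewrite ger0_norm; last by rewrite subr_ge0 sin_le_id.
have dF y : is_derive y 1 (fun x : R => x - sin x) (1 - cos y) by exact: is_derive_funB.
have dG y : is_derive y 1 (fun x : R => x * x) (y * 1 + y * 1) by exact: is_derive_funM.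
have := derive_le _ _ _ _ 0 v dF dG x0.
rewrite sin0 !subr0 mulr0 subr0 -expr2; apply=> y /andP[y0 _].
by have := onem_cos_le _ y0; lra.
Qed.

Lemma id_mul_cos_le_sin x : 0 <= x -> x <= pi -> x * cos x <= sin x.
Proof.
move=> x0 xpi.
have dF y : is_derive y 1 (fun x : R => x * cos x) (y * - sin y + cos y * 1).
  exact: is_derive_funM.
have := derive_le _ _ _ _ 0 x dF (@is_derive_sin R) x0.
rewrite sin0 mul0r !subr0; apply=> y /andP[y0 yx].
have : 0 <= y * sin y by rewrite mulr_ge0// sin_ge0_pi//; lra.
by lra.
Qed.

(** The double angle formula and [id_mul_cos_le_sin] give [sin x >= x * cos (x / 2) ^+ 2], and the
    right-hand side is [x / 2 * (1 + cos x)]. *)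
Lemma half_le_sin x : 0 <= x -> x <= pi / 2 -> x / 2 <= sin x.
Proof.
move=> x0 xpi; have pi0 := @pi_gt0 R.
have xE : x = x / 2 + x / 2 by lra.
have c0 : 0 <= cos (x / 2) by apply: cos_ge0_pihalf; lra.
have := @id_mul_cos_le_sin (x / 2) ltac:(lra) ltac:(lra) => h.
have e1 : sin x = 2 * (sin (x / 2) * cos (x / 2)).
  by rewrite {1}xE sinD; ring.
have e2 : cos x = 2 * (cos (x / 2)) ^+ 2 - 1.
  have := cos2Dsin2 (x / 2).
  have -> : cos x = cos (x / 2) * cos (x / 2) - sin (x / 2) * sin (x / 2) by rewrite {1}xE cosD.
  by rewrite !expr2; lra.
have cx : 0 <= cos x by apply: cos_ge0_pihalf; lra.
rewrite e1; have := ler_wpM2r c0 h.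
have -> : x / 2 * cos (x / 2) * cos (x / 2) = x / 4 * (1 + cos x) by rewrite e2; field.
have xc : 0 <= x * cos x by rewrite mulr_ge0.
by lra.
Qed.

(** On half a turn to either side the chord is at least a quarter of the arc length; this is the
    origin of the factors [4] further on. *)
Lemma sin_half_lower v : `|v| <= pi -> `|v| / 4 <= `|sin (v / 2)|.
Proof.
wlog x0 : v / 0 <= v => [H|].
  have [v0|v0] := leP 0 v; first exact: H.
  by rewrite -(normrN v) -(normrN (sin _)) -sinN -mulNr; apply: H; lra.
rewrite ger0_norm// => vpi; have := @half_le_sin (v / 2) ltac:(lra) ltac:(lra).
by move=> h; rewrite (le_trans _ (ler_norm _))//; lra.
Qed.

Lemma periodic_reduce (T x : R) : 0 < T -> exists (k : int) (y : R),
  [/\ 0 <= y, y <= T & x = y + k%:~R * T].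
Proof.
move=> T0; exists (Num.floor (x / T)), (x - (Num.floor (x / T))%:~R * T).
have /andP[k1 k2] := floor_itv (x / T).
move: k1 k2; rewrite ler_pdivlMr// ltr_pdivrMr// intrD mulrDl mul1r => k1 k2.
by split; lra.
Qed.

Lemma periodic_bounded (u : R -> R) : continuous u ->
  (forall x, u (x + pi *+ 2) = u x) -> exists2 M, 0 <= M & forall x, `|u x| <= M.
Proof.
move=> cu pu; have pi0 := @pi_gt0 R.
have ab : 0 <= pi *+ 2 :> R by lra.
have cn : {within `[(0 : R), pi *+ 2], continuous (fun x => `|u x|)}.
  apply: continuous_within => x; exact: (cvg_comp _ _ (cu x) (@norm_continuous _ R _)).
have [c _ cP] := EVT_max ab cn; exists `|u c| => // x.
have tp : 0 < pi *+ 2 :> R by lra.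
have [k [y [y0 y1 ->]]] := periodic_reduce _ x tp.
by rewrite (period_intmul _ _ _ pu); apply: cP; rewrite in_itv/= y0 y1.
Qed.

End Trigonometry.

Section PowerIneq.
Context {R : realType}.

Lemma powRD_le (p x y : R) : 0 <= p -> 0 <= x -> 0 <= y ->
  (x + y) `^ p <= 2 `^ p * (x `^ p + y `^ p).
Proof.
move=> p0 x0 y0; have [xy|yx] := leP x y.
  apply: (@le_trans _ _ ((2 * y) `^ p)).
    by apply: ge0_ler_powR; rewrite ?nnegrE; lra.
  by rewrite powRM// ler_wpM2l ?powR_ge0// lerDr powR_ge0.
apply: (@le_trans _ _ ((2 * x) `^ p)).
  by apply: ge0_ler_powR; rewrite ?nnegrE; lra.
by rewrite powRM// ler_wpM2l ?powR_ge0// lerDl powR_ge0.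
Qed.

Lemma ler_powR_npos (p x y : R) : p <= 0 -> 0 < x -> x <= y -> y `^ p <= x `^ p.
Proof.
move=> p0 x0 xy; have y0 : 0 < y by apply: lt_le_trans xy.
rewrite -[p]opprK powRN [leRHS]powRN lef_pV2 ?posrE ?powR_gt0//.
by apply: ge0_ler_powR; rewrite ?nnegrE; lra.
Qed.

Local Notation mu := (@lebesgue_measure R).

(** Only two of the [p] powers are integrated and the others are estimated at [a], which uses
    [2 <= p]. The square of the maximum is at least half of [a ^+ 2 + v ^+ 2], and
    [a / (a ^+ 2 + v ^+ 2)] is the derivative of [atan (v / a)], whose increment over any interval
    is at most [pi]. *)
Lemma tail_integral (p a : R) : 2 <= p -> 0 < a ->
  (\int[mu]_(v in `[(- pi)%R, pi]) ((Num.max a `|v|) `^ (- p))%:E <=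
   (pi *+ 2 * a `^ (1 - p))%:E)%E.
Proof.
move=> p2 a0; have pi0 := @pi_gt0 R.
pose f (v : R) := a^-1 / (1 + (v / a) ^+ 2).
pose F (v : R) := atan (v / a).
have dF (v : R) : is_derive v (1 : R) F (f v).
  have dv : is_derive v (1 : R) (fun v : R => v / a) (a^-1).
    have := is_derive_funM _ _ _ _ _ (is_derive_id v (1 : R)) (is_derive_cst a^-1 v (1 : R)).
    by rewrite mulr0 add0r mulr1.
  rewrite /f mulrC; exact: (@is_derive1_comp R atan (fun v => v / a)).
have den (v : R) : 0 < 1 + (v / a) ^+ 2 by have := sqr_ge0 (v / a); lra.
have cf : continuous f.
  move=> v; apply: cvgM; first exact: cvg_cst.
  apply: cvgV; first by rewrite gt_eqF.
  apply: cvgD; first exact: cvg_cst.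
  apply: (@continuous_comp _ _ _ (fun v : R => v / a) (fun x : R => x ^+ 2)); last exact: exprn_continuous.
  by apply: cvgM; [exact: cvg_id|exact: cvg_cst].
have f0 v : 0 <= f v by rewrite divr_ge0 ?invr_ge0 ?ltW.
have mf : measurable_fun setT (fun v => (f v)%:E).
  by apply/measurable_EFinP; exact: continuous_measurable_fun.
have mmax : measurable_fun setT (fun v : R => ((Num.max a `|v|) `^ (- p))%:E).
  apply/measurable_EFinP; apply: (measurableT_comp (measurable_powR (- p))).
  by apply: measurable_maxr.
have pt (v : R) : (Num.max a `|v|) `^ (- p) <= 2 * a `^ (1 - p) * f v.
  set m := Num.max a `|v|.
  have am : a <= m by rewrite /m le_max lexx.
  have vm : `|v| <= m by rewrite /m le_max lexx orbT.
  have m0 : 0 < m by apply: lt_le_trans am.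
  rewrite (_ : m `^ (- p) = m `^ (- 2) * m `^ (2 - p)); last first.
    by rewrite -gt0_powRD//; congr (_ `^ _); ring.
  have h1 : m `^ (2 - p) <= a `^ (2 - p) by apply: ler_powR_npos => //; lra.
  have h2 : m `^ (- 2) <= 2 / (a ^+ 2 + v ^+ 2).
    rewrite powRN powR_mulrn; last exact: ltW.
    have hm : a ^+ 2 + v ^+ 2 <= 2 * m ^+ 2.
      have ha : a ^+ 2 <= m ^+ 2 by rewrite lerXn2r// nnegrE ltW.
      have hv : v ^+ 2 <= m ^+ 2.
        by rewrite -real_normK ?num_real// lerXn2r ?nnegrE ?normr_ge0// ltW.
      by move: ha hv; clear; lra.
    have av : 0 < a ^+ 2 + v ^+ 2 by have := sqr_ge0 v; have := exprn_gt0 2 a0; lra.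
    rewrite ler_pdivlMr// mulrC ler_pdivrMr ?exprn_gt0//.
  have -> : 2 * a `^ (1 - p) * f v = 2 / (a ^+ 2 + v ^+ 2) * a `^ (2 - p).
    have e2 : a `^ (2 - p) = a * a `^ (1 - p).
      by rewrite -{2}(powRr1 (ltW a0)) -gt0_powRD//; congr (_ `^ _); ring.
    rewrite e2 /f; have av : 0 < a ^+ 2 + v ^+ 2 by have := sqr_ge0 v; have := exprn_gt0 2 a0; lra.
    by set A := a `^ (1 - p); field; rewrite !gt_eqF.
  by apply: ler_pM => //; exact: powR_ge0.
apply: (@le_trans _ _ (\int[mu]_(v in `[(- pi)%R, pi]) ((2 * a `^ (1 - p))%:E * (f v)%:E))%E).
  apply: ge0_le_integral; [by []|by move=> v _; rewrite lee_fin powR_ge0|exact: measurable_funTS| |].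
    by apply: measurable_funeM; exact: measurable_funTS.
  by move=> v _; rewrite -EFinM lee_fin; exact: pt.
rewrite ge0_integralZl; [|by []|exact: (measurable_funTS mf)|by move=> *; rewrite lee_fin|by rewrite lee_fin mulr_ge0 ?powR_ge0].
have ab : - pi < pi :> R by lra.
have fI : (\int[mu]_(v in `[(- pi)%R, pi]) (f v)%:E = (F pi - F (- pi))%:E)%E.
  rewrite -(Rintegral_antiderivative _ _ _ _ cf dF ab) /Rintegral fineK//.
  exact: integrable_fin_num (continuous_integrable_itv _ _ _ cf).
rewrite fI -EFinM lee_fin.
have h1 := @atan_ltpi2 R (pi / a); have h2 := @atan_gtNpi2 R (- pi / a).
have h : F pi - F (- pi) <= pi by rewrite /F; lra.
have c0 : 0 <= 2 * a `^ (1 - p) by rewrite mulr_ge0 ?powR_ge0.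
have := ler_wpM2l c0 h.
by have -> : 2 * a `^ (1 - p) * pi = pi *+ 2 * a `^ (1 - p) by ring.
Qed.

End PowerIneq.

(** * Chords, Taylor defects and a Hardy inequality *)

Section Hardy.
Context {R : realType}.
Local Notation mu := (@lebesgue_measure R).

(* Half the distance between [exp (i s)] and [exp (i t)]. *)
Definition chord (s t : R) : R := `|sin ((t - s) / 2)|.

(* The increment [t - s] of the Taylor polynomial is replaced by [sin (t - s)] to make the
   defect periodic. *)
Definition taylor_defect (U u : R -> R) (s t : R) : R :=
  `|U t - U s - sin (t - s) * u s| / chord s t.

(** If [chord s t = 0], the division by zero makes the defect [0], so for [p != 0] the kernel
    vanishes on the diagonal without a case distinction. *)
Definition defect_kernel (p : R) (U u : R -> R) (s t sg : R) : R :=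
  taylor_defect U u s t `^ p * (Num.max (chord s t) (chord s sg)) `^ (- p).

Lemma chord_ge0 s t : 0 <= chord s t. Proof. exact: normr_ge0. Qed.

Lemma chord_sym s t : chord s t = chord t s.
Proof. by rewrite /chord -normrN -sinN -mulNr opprB. Qed.

Lemma sin_half_period (v : R) : `|sin ((v + pi *+ 2) / 2)| = `|sin (v / 2)|.
Proof.
have -> : (v + pi *+ 2) / 2 = v / 2 + pi by field.
by rewrite sinDpi normrN.
Qed.

Lemma chord_periodr s t : chord s (t + pi *+ 2) = chord s t.
Proof. by rewrite /chord addrAC sin_half_period. Qed.

Lemma chord_shift s v : chord s (s + v) = `|sin (v / 2)|.
Proof. by rewrite /chord addrAC subrr add0r. Qed.

Lemma measurable_sin : measurable_fun setT (@sin R).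
Proof. by apply: continuous_measurable_fun; exact: continuous_sin. Qed.

Lemma measurable_chord d (T : measurableType d) (f g : T -> R) :
  measurable_fun setT f -> measurable_fun setT g ->
  measurable_fun setT (fun z => chord (f z) (g z)).
Proof.
move=> mf mg; apply: measurableT_comp => //.
apply: (measurableT_comp measurable_sin).
by apply: measurable_funM => //; exact: measurable_funB.
Qed.

Variables (p : R) (U u : R -> R).
Hypothesis hp : 3%:R < p.
Hypothesis dU : forall x, is_derive x (1 : R) U (u x).
Hypothesis cu : continuous u.
Hypothesis pU : forall x, U (x + pi *+ 2) = U x.
Hypothesis pu : forall x, u (x + pi *+ 2) = u x.

Let cU : continuous U. Proof. exact: is_derive_continuous dU. Qed.
Let mU : measurable_fun setT U. Proof. exact: continuous_measurable_fun. Qed.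
Let mu' : measurable_fun setT u. Proof. exact: continuous_measurable_fun. Qed.

Lemma measurable_taylor_defect d (T : measurableType d) (f g : T -> R) :
  measurable_fun setT f -> measurable_fun setT g ->
  measurable_fun setT (fun z => taylor_defect U u (f z) (g z)).
Proof.
move=> mf mg; apply: measurable_funM.
  apply: measurableT_comp => //; apply: measurable_funB.
    by apply: measurable_funB; exact: measurableT_comp.
  apply: measurable_funM; last exact: measurableT_comp.
  by apply: (measurableT_comp measurable_sin); exact: measurable_funB.
by apply: (measurableT_comp measurable_invr); exact: measurable_chord.
Qed.

Lemma measurable_defect_kernel d (T : measurableType d) (f g h : T -> R) :
  measurable_fun setT f -> measurable_fun setT g -> measurable_fun setT h ->
  measurable_fun setT (fun z => defect_kernel p U u (f z) (g z) (h z)).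
Proof.
move=> mf mg mh; apply: measurable_funM.
  by apply: (measurableT_comp (measurable_powR p)); exact: measurable_taylor_defect.
apply: (measurableT_comp (measurable_powR (- p))).
by apply: measurable_maxr; exact: measurable_chord.
Qed.

Lemma defect_kernel_ge0 s t sg : 0 <= defect_kernel p U u s t sg.
Proof. by rewrite mulr_ge0 ?powR_ge0. Qed.

Let p1 : 1 < p. Proof. by move: hp; lra. Qed.
Let p0 : 0 <= p. Proof. by move: hp; lra. Qed.

(** As a function of the increment, the remainder has derivative [u (s + y) - u s], which
    [le_split_powR] bounds by the derivative of [B]. The symmetric interval on the right-hand side
    makes the estimate independent of the sign of [v]. *)
Lemma taylor_remainder_le (s v l : R) (W : R -> R) : 0 < l ->
  (forall y, is_derive y (1 : R) W (`|u (s + y) - u s| `^ p)) ->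
  `|U (s + v) - U s - v * u s| <= l * `|v| + l `^ (1 - p) * (W `|v| - W (- `|v|)).
Proof.
move=> l0 dW.
pose D y := U (s + y) - y * u s.
have dD (y : R) : is_derive y (1 : R) D (u (s + y) - u s).
  apply: is_derive_funB.
    have -> : (fun y => U (s + y)) = (fun y => U (y + s)) by apply/funext => z; rewrite addrC.
    by apply: is_derive_shift; rewrite addrC.
  have := is_derive_funM _ _ _ _ _ (is_derive_id y (1 : R)) (is_derive_cst (u s) y (1 : R)).
  by rewrite mulr0 add0r mulr1.
pose c := l `^ (1 - p).
have c0 : 0 <= c by exact: powR_ge0.
pose B y := l * y + c * W y.
have dB (y : R) : is_derive y (1 : R) B (l + c * `|u (s + y) - u s| `^ p).
  apply: is_derive_funD.
    have := is_derive_funM _ _ _ _ _ (is_derive_cst l y (1 : R)) (is_derive_id y (1 : R)).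
    by rewrite mulr0 addr0 mulr1.
have dND (y : R) : is_derive y (1 : R) (fun y => - D y) (- (u (s + y) - u s)).
  exact: is_deriveN.
have key y : `|u (s + y) - u s| <= l + c * `|u (s + y) - u s| `^ p.
  exact: le_split_powR.
have hD (a b : R) : a <= b -> `|D b - D a| <= B b - B a.
  move=> ab; rewrite ler_norml.
  have h1 := derive_le _ _ _ _ a b dD dB ab.
  have h2 := derive_le _ _ _ _ a b dND dB ab.
  have {}h1 : D b - D a <= B b - B a.
    by apply: h1 => x _; exact: le_trans (ler_norm _) (key x).
  have {}h2 : - D b - - D a <= B b - B a.
    by apply: h2 => x _; apply: le_trans (key x); rewrite -normrN ler_norm.
  by lra.
have Wmono (a b : R) : a <= b -> W a <= W b.
  move=> ab; have := derive_lower_bound _ _ _ _ 0 dW ab.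
  rewrite mul0r => h; have : 0 <= W b - W a by apply: h => x _; exact: powR_ge0.
  by lra.
have -> : U (s + v) - U s - v * u s = D v - D 0 by rewrite /D addr0 mul0r; ring.
have [v0|v0] := leP 0 v.
  apply: le_trans (hD 0 v v0) _; rewrite /B ger0_norm//.
  have := Wmono (- v) 0 ltac:(lra) => h.
  rewrite -/c; have := ler_wpM2l c0 h; lra.
rewrite distrC; apply: le_trans (hD v 0 (ltW v0)) _; rewrite /B ltr0_norm// opprK.
have := Wmono 0 (- v) ltac:(lra) => h.
rewrite -/c; have := ler_wpM2l c0 h; lra.
Qed.

(** For [|y| <= |v|] the weight is [|v| ^ (- p)]. Thanks to the maximum the function makes sense on
    the whole square, so the integrals in [y] and [v] can be exchanged without one range depending
    on the other variable. *)
Let q2 (s y v : R) : R := `|u (s + y) - u s| `^ p * (Num.max `|y| `|v|) `^ (- p).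

Let q2_ge0 s y v : 0 <= q2 s y v. Proof. by rewrite mulr_ge0 ?powR_ge0. Qed.

Let mq2 s : measurable_fun setT ((fun z => (q2 s z.1 z.2)%:E) : R * R -> \bar R).
Proof.
apply/measurable_EFinP; apply: measurable_funM.
  apply: (measurableT_comp (measurable_powR p)).
  apply: measurableT_comp => //; apply: measurable_funB => //.
  by apply: measurableT_comp => //; exact: measurable_funD.
apply: (measurableT_comp (measurable_powR (- p))).
by apply: measurable_maxr; exact: measurableT_comp.
Qed.

Lemma continuous_powR_norm (r : R) : 0 < r -> continuous (fun x : R => `|x| `^ r).
Proof.
move=> r0 x; have [->|x0] := eqVneq x 0.
  rewrite /continuous_at normr0 powR0 ?gt_eqF//; apply/cvgrPdist_lt => e e0.
  exists (e `^ r^-1) => [|y]/=; first exact: powR_gt0.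
  rewrite !sub0r !normrN => ye; rewrite ger0_norm ?powR_ge0//.
  have -> : e = (e `^ r^-1) `^ r by rewrite -powRrM mulVf ?gt_eqF// powRr1// ltW.
  by apply: gt0_ltr_powR; rewrite ?nnegrE ?powR_ge0.
apply: (@continuous_comp _ _ _ (fun x : R => `|x|) (fun x : R => x `^ r)).
  exact: norm_continuous.
apply: differentiable_continuous; apply/derivable1_diffP.
by apply: derivable_powR; rewrite in_itv/= normr_gt0 x0.
Qed.

Let X (s v : R) : R := `|U (s + v) - U s - v * u s| / `|v|.

Let cdu (s : R) : continuous (fun y => `|u (s + y) - u s| `^ p).
Proof.
move=> y; apply: (@continuous_comp _ _ _ (fun y => u (s + y) - u s) (fun x => `|x| `^ p)).
  apply: cvgB; last exact: cvg_cst.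
  apply: (@continuous_comp _ _ _ (fun y => s + y) u); last exact: cu.
  by apply: cvgD; [exact: cvg_cst|exact: cvg_id].
by apply: continuous_powR_norm; move: p1; lra.
Qed.

(** In effect Jensen's inequality for the average of [u (s + y) - u s]. The choice
    [l ^ p = M' / |v|] makes both terms of [taylor_remainder_le] equal to [l * |v|]. For [M' = 0]
    there is no positive [l] of this kind, and letting [l] tend to [0] gives [X s v = 0]. *)
Let hardy_pointwise (s v : R) : v != 0 -> `|v| <= pi ->
  ((X s v `^ p * `|v| `^ (1 - p))%:E <=
  (2 `^ p)%:E * \int[mu]_(y in `[(- pi)%R, pi]) (q2 s y v)%:E)%E.
Proof.
move=> v0 vpi; have nv0 : 0 < `|v| by rewrite normr_gt0.
have [W dW] := antiderivative_exists _ (cdu s).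
pose M' := W `|v| - W (- `|v|).
have vv : - `|v| < `|v| by lra.
have M'E : M' = \int[mu]_(y in `[(- `|v|)%R, `|v|%R]) (`|u (s + y) - u s| `^ p).
  by rewrite (Rintegral_antiderivative _ _ _ _ (cdu s) dW vv).
have M'0 : 0 <= M' by rewrite M'E; apply: Rintegral_ge0 => y _; exact: powR_ge0.
have X0 : 0 <= X s v by rewrite divr_ge0.
have XM : X s v `^ p <= 2 `^ p * (M' / `|v|).
  move: M'0; rewrite le_eqVlt => /predU1P[M'0|M'0].
    have X00 : X s v = 0.
      apply/eqP; rewrite eq_le X0 andbT; apply/ler_addgt0Pl => l l0; rewrite addr0.
      have := taylor_remainder_le s v l W l0 dW.
      by rewrite -/M' -M'0 mulr0 addr0 /X ler_pdivrMr.
    rewrite X00 powR0; last by move: p1; lra.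
    by rewrite -M'0 mul0r mulr0.
  pose l := (M' / `|v|) `^ p^-1.
  have l0 : 0 < l by rewrite powR_gt0// divr_gt0.
  have lp : l `^ p = M' / `|v|.
    by rewrite /l -powRrM mulVf ?powRr1 ?divr_ge0 ?ltW//; move: p1; lra.
  have h := taylor_remainder_le s v l W l0 dW.
  have e1 : l `^ (1 - p) * M' = l * `|v|.
    rewrite gt0_powRD// powRr1; last exact: ltW.
    rewrite powRN lp invf_div -mulrA divfK//.
    by rewrite gt_eqF.
  have {}h : X s v <= 2 * l.
    by rewrite /X ler_pdivrMr//; move: h; rewrite -/M' e1; lra.
  rewrite -lp -powRM//; last exact: ltW.
  by apply: ge0_ler_powR; rewrite ?nnegrE// mulr_ge0// ltW.
have fI : (\int[mu]_(y in `[(- `|v|)%R, `|v|%R]) (`|u (s + y) - u s| `^ p)%:E)%E = M'%:E.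
  rewrite M'E /Rintegral fineK//.
  exact: integrable_fin_num (continuous_integrable_itv _ _ _ (cdu s)).
apply: (@le_trans _ _ ((2 `^ p)%:E * (`|v| `^ (- p) * M')%:E)%E).
  rewrite -EFinM lee_fin.
  apply: (@le_trans _ _ (2 `^ p * (M' / `|v|) * `|v| `^ (1 - p))).
    by rewrite ler_wpM2r ?powR_ge0.
  rewrite (gt0_powRD _ 1)// powRr1; last exact: ltW.
  rewrite -mulrA [X in _ * X](_ : _ = `|v| `^ (- p) * M')//.
  by field; rewrite gt_eqF.
apply: lee_pmul; [by rewrite lee_fin powR_ge0|by rewrite lee_fin mulr_ge0 ?powR_ge0|exact: lexx|].
have mdu : measurable_fun setT (fun y : R => (`|u (s + y) - u s| `^ p)%:E).
  by apply/measurable_EFinP; exact: continuous_measurable_fun (cdu s).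
have mqv : measurable_fun setT (fun y : R => (q2 s y v)%:E).
  exact: (measurableT_comp (mq2 s) (measurable_pair2 v)).
rewrite EFinM -fI -ge0_integralZl; [|by []|exact: (measurable_funTS mdu)|by move=> *; rewrite lee_fin powR_ge0|by rewrite lee_fin powR_ge0].
apply: (@le_trans _ _ (\int[mu]_(y in `[(- `|v|)%R, `|v|%R]) (q2 s y v)%:E)%E).
  apply: ge0_le_integral; [by []| | | |].
  - by move=> y _; rewrite -EFinM lee_fin mulr_ge0 ?powR_ge0.
  - by apply: measurable_funeM; exact: (measurable_funTS mdu).
  - exact: (measurable_funTS mqv).
  - move=> y /=; rewrite in_itv/= => yv; rewrite -EFinM lee_fin /q2 mulrC.
    by rewrite (@max_r _ _ `|y|)// ler_norml.
apply: ge0_subset_integral; [by []|by []|exact: (measurable_funTS mqv)|by move=> *; rewrite lee_fin|].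
by apply: subset_itv; rewrite bnd_simp; lra.
Qed.

Let e (s : R) : \bar R := (\int[mu]_(w in `[(- pi)%R, pi])
  (`|u (s + w) - u s| `^ p / `|w| `^ (p - 1))%:E)%E.

Let mX (s : R) : measurable_fun setT (fun v : R => X s v).
Proof.
apply: measurable_funM.
  apply: measurableT_comp => //; apply: measurable_funB; last exact: measurable_funM.
  by apply: measurable_funB => //; apply: measurableT_comp => //; exact: measurable_funD.
by apply: (measurableT_comp measurable_invr); exact: normr_measurable.
Qed.

Let me_int (s : R) : measurable_fun setT (fun w : R => (`|u (s + w) - u s| `^ p / `|w| `^ (p - 1))%:E).
Proof.
apply/measurable_EFinP; apply: measurable_funM.
  exact: continuous_measurable_fun (cdu s).
apply: (measurableT_comp measurable_invr).
apply: (measurableT_comp (measurable_powR (p - 1))).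
exact: normr_measurable.
Qed.

Let mXp (s : R) : measurable_fun setT (fun v : R => (X s v `^ p * `|v| `^ (1 - p))%:E).
Proof.
apply/measurable_EFinP; apply: measurable_funM.
  by apply: (measurableT_comp (measurable_powR p)); exact: mX.
by apply: (measurableT_comp (measurable_powR (1 - p))); exact: normr_measurable.
Qed.

(** After [hardy_pointwise] and an exchange of integrals, the integral in [v] is a tail integral
    with [a = |y|]. It produces the weight [|y| ^ (1 - p)] of the Slobodeckij energy. *)
Let hardy_total s :
  (\int[mu]_(v in `[(- pi)%R, pi]) (X s v `^ p * `|v| `^ (1 - p))%:E <=
  (2 `^ p * pi *+ 2)%:E * e s)%E.
Proof.
have pi0 := @pi_gt0 R.
have mswap : measurable_fun setT ((fun z => (q2 s z.2 z.1)%:E) : R * R -> \bar R).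
  apply/measurable_EFinP; apply: measurable_funM.
    apply: (measurableT_comp (measurable_powR p)).
    apply: measurableT_comp => //; apply: measurable_funB => //.
    by apply: measurableT_comp => //; exact: measurable_funD.
  apply: (measurableT_comp (measurable_powR (- p))).
  by apply: measurable_maxr; exact: measurableT_comp.
have q20 (x y : R) : (0 <= (q2 s y x)%:E)%E by rewrite lee_fin.
apply: (@le_trans _ _ (\int[mu]_(v in `[(- pi)%R, pi])
   ((2 `^ p)%:E * \int[mu]_(y in `[(- pi)%R, pi]) (q2 s y v)%:E))%E).
  apply: ge0_le_integral; [by []| | | |].
  - by move=> v _; rewrite lee_fin mulr_ge0 ?powR_ge0.
  - exact: (measurable_funTS (mXp s)).
  - apply: measurable_funeM; apply: measurable_funTS.
    exact: (measurable_tonelli _ _ _ _ _ mu _ (fun v y => (q2 s y v)%:E)).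
  - move=> v /=; rewrite in_itv/= -ler_norml => vpi.
    have [->|v0] := eqVneq v 0; last exact: hardy_pointwise.
    rewrite /X normr0 invr0 mulr0 powR0; last by move: p1; lra.
    by rewrite mul0r mule_ge0 ?lee_fin ?powR_ge0// integral_ge0// => *; rewrite lee_fin.
rewrite ge0_integralZl; [|by []| | |by rewrite lee_fin powR_ge0]; last 2 first.
- apply: measurable_funTS.
  exact: (measurable_tonelli _ _ _ _ _ mu _ (fun v y => (q2 s y v)%:E)).
- by move=> v _; apply: integral_ge0 => *; rewrite lee_fin.
rewrite (_ : (2 `^ p * pi *+ 2)%:E = (2 `^ p)%:E * (pi *+ 2)%:E)%E; last first.
  by rewrite -EFinM; congr EFin; ring.
rewrite -muleA; apply: lee_pmul; [by rewrite lee_fin powR_ge0| |exact: lexx|].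
  by apply: integral_ge0 => *; apply: integral_ge0 => *; rewrite lee_fin.
rewrite (tonelli_swap _ _ _ _ _ mu mu _ _ (fun v y => (q2 s y v)%:E)) //.
rewrite /e -ge0_integralZl; [|by []|exact: (measurable_funTS (me_int s))|by move=> *; rewrite lee_fin divr_ge0 ?powR_ge0|by rewrite lee_fin; lra].
apply: ge0_le_integral; [by []| | | |].
- by move=> y _; apply: integral_ge0 => *; rewrite lee_fin.
- apply: measurable_funTS.
  apply: (measurable_tonelli _ _ _ _ _ mu _ (fun y v => (q2 s y v)%:E)); [by []|exact: (mq2 s)|].
  by move=> *; rewrite lee_fin.
- by apply: measurable_funeM; exact: (measurable_funTS (me_int s)).
- move=> y _; have [->|y0] := eqVneq y (0 : R).
    rewrite integral0_eq; last first.
      by move=> v _; rewrite /q2 addr0 subrr normr0 powR0 ?mul0r//; move: p1; lra.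
    by rewrite mule_ge0// lee_fin ?divr_ge0 ?powR_ge0//; lra.
  have ny0 : 0 < `|y| by rewrite normr_gt0.
  have mmax : measurable_fun setT (fun v : R => ((Num.max `|y| `|v|) `^ (- p))%:E).
    apply/measurable_EFinP; apply: (measurableT_comp (measurable_powR (- p))).
    by apply: measurable_maxr.
  have -> : (\int[mu]_(v in `[(- pi)%R, pi]) (q2 s y v)%:E =
      (`|u (s + y) - u s| `^ p)%:E *
      \int[mu]_(v in `[(- pi)%R, pi]) ((Num.max `|y| `|v|) `^ (- p))%:E)%E.
    rewrite -ge0_integralZl; [|by []|exact: (measurable_funTS mmax)|by move=> *; rewrite lee_fin powR_ge0|by rewrite lee_fin powR_ge0].
    by apply: eq_integral => v _; rewrite -EFinM.
  have p2 : 2 <= p by move: hp; lra.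
  apply: le_trans.
    apply: lee_pmul; last exact: (tail_integral _ _ p2 ny0).
    - by rewrite lee_fin powR_ge0.
    - by apply: integral_ge0 => *; rewrite lee_fin powR_ge0.
    - exact: lexx.
  rewrite -!EFinM lee_fin (_ : 1 - p = - (p - 1)); last ring.
  by rewrite powRN [leRHS]mulrCA.
Qed.

(** The integral in [sg] is a tail integral because chords dominate arc length. What remains in [t]
    is the Hardy quantity, except that the defect has [sin (t - s)] in place of [t - s]; that error
    is of second order and accounts for the summand [1]. *)
Lemma defect_kernel_inner :
  exists2 C : R, 0 <= C & forall s,
    (\int[mu]_(t in `[0%R, (pi *+ 2)%R]) \int[mu]_(sg in `[0%R, (pi *+ 2)%R])
      (defect_kernel p U u s t sg)%:E <= C%:E * (e s + 1))%E.
Proof.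
have pi0 := @pi_gt0 R; have p2 : 2 <= p by move: hp; lra.
have pn0 : p != 0 by rewrite gt_eqF//; lra.
have [Cu Cu0 uC] := periodic_bounded _ cu pu.
pose c1 := 4 `^ p * (pi *+ 2).
have c10 : 0 <= c1 by rewrite mulr_ge0 ?powR_ge0//; lra.
pose rp s t := taylor_defect U u s t `^ p * (4 * chord s t) `^ (1 - p).
have rp0 (s t : R) : 0 <= rp s t by rewrite mulr_ge0 ?powR_ge0.
have inner (s t : R) : (\int[mu]_(sg in `[0%R, (pi *+ 2)%R]) (defect_kernel p U u s t sg)%:E
    <= (c1 * rp s t)%:E)%E.
  have [ch0|ch0] := eqVneq (chord s t) 0.
    rewrite integral0_eq; first by rewrite lee_fin; exact: mulr_ge0.
    move=> sg _; by rewrite /defect_kernel /taylor_defect ch0 invr0 mulr0 powR0 ?mul0r.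
  have chp : 0 < chord s t by rewrite lt_def ch0 chord_ge0.
  pose h sg := (Num.max (chord s t) (chord s sg)) `^ (- p).
  have mh : measurable_fun setT (fun sg : R => (h sg)%:E).
    apply/measurable_EFinP; apply: (measurableT_comp (measurable_powR (- p))).
    by apply: measurable_maxr => //; exact: measurable_chord.
  have h0 sg : (0 <= (h sg)%:E)%E by rewrite lee_fin powR_ge0.
  rewrite [leLHS](_ : _ = (taylor_defect U u s t `^ p)%:E *
    \int[mu]_(sg in `[0%R, (pi *+ 2)%R]) (h sg)%:E)%E; last first.
    rewrite -ge0_integralZl; [|by []|exact: (measurable_funTS mh)|by move=> *; exact: h0|by rewrite lee_fin powR_ge0].
    by apply: eq_integral => sg _; rewrite -EFinM.
  rewrite -(ge0_integral_centered _ s mh h0); last by move=> x; rewrite /h chord_periodr.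
  have mmax : measurable_fun setT (fun v : R => ((Num.max (4 * chord s t) `|v|) `^ (- p))%:E).
    apply/measurable_EFinP; apply: (measurableT_comp (measurable_powR (- p))).
    by apply: measurable_maxr.
  (* Both chords are multiplied by [4], after which [4 * chord s (s + x)] dominates [|x|]; this
     costs the factor [4 ^ p]. *)
  have h4 : (\int[mu]_(x in `[(- pi)%R, pi]) (h (s + x))%:E <=
      (4 `^ p)%:E * (pi *+ 2 * (4 * chord s t) `^ (1 - p))%:E)%E.
    have c4 : 0 < 4 * chord s t by lra.
    apply: (@le_trans _ _ ((4 `^ p)%:E * \int[mu]_(v in `[(- pi)%R, pi])
        ((Num.max (4 * chord s t) `|v|) `^ (- p))%:E)%E); last first.
      apply: lee_pmul; last exact: (tail_integral _ _ p2 c4).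
      - by rewrite lee_fin powR_ge0.
      - by apply: integral_ge0 => *; rewrite lee_fin powR_ge0.
      - exact: lexx.
    rewrite -ge0_integralZl; [|by []|exact: (measurable_funTS mmax)|by move=> *; rewrite lee_fin powR_ge0|by rewrite lee_fin powR_ge0].
    apply: ge0_le_integral; [by []|by move=> *; exact: h0| | |].
    - apply: measurable_funTS; apply: (measurableT_comp mh); exact: measurable_funD.
    - by apply: measurable_funeM; exact: (measurable_funTS mmax).
    - move=> w /=; rewrite in_itv/= -ler_norml => wpi.
      rewrite -EFinM lee_fin /h chord_shift.
      have sw := sin_half_lower _ wpi.
      have e4 : 4 `^ p = 4^-1 `^ (- p) by rewrite -powR_inv1// -powRrM mulN1r opprK.
      rewrite e4 -powRM ?invr_ge0//; last by rewrite le_max normr_ge0 orbT.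
      apply: ler_powR_npos; first by lra.
        by rewrite mulr_gt0// ?invr_gt0// lt_max c4.
      rewrite maxr_pMr ?invr_ge0// mulKf ?pnatr_eq0//.
      rewrite ge_max; apply/andP; split; first by rewrite le_max lexx.
      by rewrite le_max; apply/orP; right; rewrite mulrC.
  apply: le_trans.
    apply: lee_pmul; last exact: h4.
    - by rewrite lee_fin powR_ge0.
    - by apply: integral_ge0 => *; exact: h0.
    - exact: lexx.
  by rewrite -!EFinM lee_fin /rp /c1 le_eqVlt; apply/orP; left; apply/eqP; ring.
have mrp s : measurable_fun setT (fun t : R => (c1 * rp s t)%:E).
  apply/measurable_EFinP; apply: measurable_funM => //; apply: measurable_funM.
    by apply: (measurableT_comp (measurable_powR p)); exact: measurable_taylor_defect.
  apply: (measurableT_comp (measurable_powR (1 - p))); apply: measurable_funM => //.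
  exact: measurable_chord.
(* The factor [8 ^ p] combines [4 ^ p] from the chord with [2 ^ p] from [powRD_le]. The constant
   [c3] bounds [(Cu * |v|) ^ p * |v| ^ (1 - p)], which is [Cu ^ p * |v|]. *)
pose c2 := c1 * 8 `^ p; pose c3 := Cu `^ p * pi.
have c20 : 0 <= c2 by rewrite mulr_ge0 ?powR_ge0.
have c30 : 0 <= c3 by rewrite mulr_ge0 ?powR_ge0//; lra.
pose CC := 2 `^ p * pi *+ 2.
have CC0 : 0 <= CC by rewrite /CC; have := mulr_ge0 (powR_ge0 2 p) (ltW pi0); lra.
have e0 s : (0 <= e s)%E by apply: integral_ge0 => *; rewrite lee_fin divr_ge0 ?powR_ge0.
exists (c2 * (CC + c3 * (pi *+ 2))); first by rewrite mulr_ge0// addr_ge0// mulr_ge0//; lra.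
move=> s.
apply: (@le_trans _ _ (\int[mu]_(t in `[0%R, (pi *+ 2)%R]) (c1 * rp s t)%:E)%E).
  apply: ge0_le_integral; [by []| | | |].
  - by move=> t _; apply: integral_ge0 => *; rewrite lee_fin defect_kernel_ge0.
  - apply: measurable_funTS.
    apply: (measurable_tonelli _ _ _ _ _ mu _ (fun t sg => (defect_kernel p U u s t sg)%:E)) => //.
      by apply/measurable_EFinP; exact: measurable_defect_kernel.
    by move=> *; rewrite lee_fin defect_kernel_ge0.
  - exact: (measurable_funTS (mrp s)).
  - by move=> t _; exact: inner.
have crp0 t : (0 <= (c1 * rp s t)%:E)%E by rewrite lee_fin mulr_ge0.
rewrite -(ge0_integral_centered _ s (mrp s) crp0); last first.
  move=> x; rewrite /rp /taylor_defect !chord_periodr pU.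
  by rewrite (addrAC x) (_ : sin (x - s + pi *+ 2) = sin (x - s))// sinD2pi.
have pt (v : R) : `|v| <= pi -> rp s (s + v) <= 8 `^ p * (X s v `^ p * `|v| `^ (1 - p) + c3).
  move=> vpi.
  have [->|v0] := eqVneq v 0.
    rewrite /rp /taylor_defect chord_shift mul0r sin0 normr0 invr0 mulr0 powR0// mul0r.
    apply: mulr_ge0; first exact: powR_ge0.
    by apply: addr_ge0 => //; rewrite mulr_ge0 ?powR_ge0.
  have nv0 : 0 < `|v| by rewrite normr_gt0.
  have sv := sin_half_lower _ vpi.
  rewrite /rp chord_shift.
  have hden : (4 * `|sin (v / 2)|) `^ (1 - p) <= `|v| `^ (1 - p).
    by apply: ler_powR_npos => //; [move: p1|]; lra.
  have hX : taylor_defect U u s (s + v) <= 4 * (X s v + Cu * `|v|).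
    rewrite /taylor_defect chord_shift.
    have sp : 0 < `|sin (v / 2)| by apply: lt_le_trans sv; rewrite divr_gt0.
    rewrite ler_pdivrMr//.
    have -> : s + v - s = v by ring.
    have -> : U (s + v) - U s - sin v * u s = (U (s + v) - U s - v * u s) + (v - sin v) * u s by ring.
    apply: (le_trans (ler_normD _ _)).
    have XE : `|U (s + v) - U s - v * u s| = X s v * `|v| by rewrite /X divfK// gt_eqF.
    have h2 : `|(v - sin v) * u s| <= Cu * `|v| * `|v|.
      rewrite normrM mulrC -mulrA ler_pM//.
      by have := id_sub_sin_le v; rewrite -real_normK ?num_real// expr2.
    have X0 : 0 <= X s v by rewrite divr_ge0.
    rewrite XE.
    apply: (@le_trans _ _ ((X s v + Cu * `|v|) * `|v|)); first by rewrite [leRHS]mulrDl lerD2l.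
    have -> : 4 * (X s v + Cu * `|v|) * `|sin (v / 2)| = (X s v + Cu * `|v|) * (4 * `|sin (v / 2)|) by ring.
    by rewrite ler_wpM2l//; [rewrite addr_ge0// mulr_ge0|lra].
  have X0 : 0 <= X s v by rewrite divr_ge0.
  have t0 : 0 <= taylor_defect U u s (s + v) by rewrite divr_ge0// chord_ge0.
  have hXp : taylor_defect U u s (s + v) `^ p <= 8 `^ p * (X s v `^ p + (Cu * `|v|) `^ p).
    have s0 : 0 <= X s v + Cu * `|v| by rewrite addr_ge0// mulr_ge0.
    apply: (@le_trans _ _ ((4 * (X s v + Cu * `|v|)) `^ p)).
      by apply: ge0_ler_powR => //; rewrite ?nnegrE// mulr_ge0.
    rewrite powRM// (_ : 8 = 4 * 2); last ring.
    rewrite (@powRM _ 4 2)// -mulrA ler_wpM2l ?powR_ge0//.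
    by apply: powRD_le => //; rewrite mulr_ge0.
  apply: (le_trans (ler_pM _ _ hXp hden)); rewrite ?powR_ge0//.
  rewrite -mulrA ler_wpM2l ?powR_ge0// mulrDl lerD2l.
  rewrite powRM// -mulrA -gt0_powRD//.
  rewrite (_ : p + (1 - p) = 1); last ring.
  by rewrite powRr1 /c3 ?ler_wpM2l ?powR_ge0.
apply: (@le_trans _ _ (\int[mu]_(v in `[(- pi)%R, pi])
    (c2%:E * ((X s v `^ p * `|v| `^ (1 - p))%:E + c3%:E)))%E).
  apply: ge0_le_integral; [by []|by move=> *; exact: crp0| | |].
  - apply: measurable_funTS; apply: (measurableT_comp (mrp s)); exact: measurable_funD.
  - apply: measurable_funeM; apply: emeasurable_funD => //; exact: (measurable_funTS (mXp s)).
  - move=> v /=; rewrite in_itv/= -ler_norml => vpi.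
    rewrite -EFinD -EFinM lee_fin /c2 -(mulrA c1); apply: ler_wpM2l => //.
    exact: pt.
rewrite ge0_integralZl; [|by []| | |by rewrite lee_fin]; last 2 first.
- by apply: emeasurable_funD => //; exact: (measurable_funTS (mXp s)).
- by move=> v _; rewrite -EFinD lee_fin addr_ge0// mulr_ge0 ?powR_ge0.
rewrite ge0_integralD; [|by []|by move=> *; rewrite lee_fin mulr_ge0 ?powR_ge0|exact: (measurable_funTS (mXp s))|by move=> *; rewrite lee_fin|by []].
rewrite integral_cst; last by [].
rewrite (EFinM c2) -muleA; apply: lee_pmul; [by rewrite lee_fin| |exact: lexx|].
  apply: adde_ge0; first by apply: integral_ge0 => *; rewrite lee_fin mulr_ge0 ?powR_ge0.
  by rewrite mule_ge0 ?lee_fin.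
apply: (@le_trans _ _ (CC%:E * e s + (c3 * (pi *+ 2))%:E)%E).
  apply: leeD; first exact: hardy_total.
  rewrite [X in (_ * X)%E](_ : _ = (pi *+ 2)%:E)//.
  rewrite /= lebesgue_measure_itv/= lte_fin ifT; last lra.
  by rewrite -EFinB; congr EFin; ring.
have k0 : 0 <= c3 * (pi *+ 2) by apply: mulr_ge0 => //; lra.
rewrite (EFinD CC) ge0_muleDl ?lee_fin//; apply: leeD.
  by apply: lee_pmul; rewrite ?lee_fin// leeDl.
rewrite -[leLHS]mule1; apply: lee_pmul; rewrite ?lee_fin//.
by rewrite leeDr.
Qed.

End Hardy.

(** * Sobolev-Slobodeckij functions *)

Section EuclideanNorm.
Context {R : realType}.
Local Notation V := 'rV[R]_3.
Implicit Types (u v : V).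

Lemma sum3 (F : 'I_3 -> R) : \sum_(i < 3) F i = F 0 + F 1 + F 2%:R.
Proof.
rewrite !big_ord_recl big_ord0 addr0 addrA; congr (_ + F _ + F _); exact/val_inj.
Qed.

Lemma enorm_sqr u : enorm u ^+ 2 = u 0 0 ^+ 2 + u 0 1 ^+ 2 + u 0 2%:R ^+ 2.
Proof. by rewrite /enorm sqr_sqrtr sum3// !addr_ge0 ?sqr_ge0. Qed.

Lemma enorm_ge0 u : 0 <= enorm u. Proof. exact: sqrtr_ge0. Qed.

(** In this form the norm is accessible to the rules for real powers, both for measurability and for
    differentiation in [tau]. *)
Lemma enorm_powR u : enorm u = (u 0 0 ^+ 2 + u 0 1 ^+ 2 + u 0 2%:R ^+ 2) `^ 2^-1.
Proof. by rewrite powR12_sqrt ?sum3 /enorm ?sum3// !addr_ge0 ?sqr_ge0. Qed.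

Lemma normr_le_enorm u i : `|u 0 i| <= enorm u.
Proof.
rewrite -(sqrtr_sqr (u 0 i)) ler_wsqrtr// (bigD1 i)//= lerDl.
by apply: sumr_ge0 => j _; exact: sqr_ge0.
Qed.

Lemma enorm_le_sum u : enorm u <= `|u 0 0| + `|u 0 1| + `|u 0 2%:R|.
Proof.
rewrite -(@ler_pXn2r _ 2) ?nnegrE ?enorm_ge0 ?addr_ge0// enorm_sqr.
rewrite -(real_normK (num_real (u 0 0))) -(real_normK (num_real (u 0 1))) -(real_normK (num_real (u 0 2%:R))).
move: (normr_ge0 (u 0 0)) (normr_ge0 (u 0 1)) (normr_ge0 (u 0 2%:R)).
move: `|u 0 0| `|u 0 1| `|u 0 2%:R| => a b c a0 b0 c0.
have := mulr_ge0 a0 b0; have := mulr_ge0 a0 c0; have := mulr_ge0 b0 c0.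
by move=> *; rewrite !expr2; lra.
Qed.

Lemma measurable_enorm d (T : measurableType d) (f : T -> V) :
  (forall i, measurable_fun setT (fun z => f z 0 i)) ->
  measurable_fun setT (fun z => enorm (f z)).
Proof.
move=> mf; rewrite [X in measurable_fun _ X](_ : _ =
  fun z => (f z 0 0 ^+ 2 + f z 0 1 ^+ 2 + f z 0 2%:R ^+ 2) `^ 2^-1).
  apply: (measurableT_comp (measurable_powR 2^-1)).
  by apply: measurable_funD; [apply: measurable_funD|]; apply: measurable_funX.
by apply/funext => z; rewrite enorm_powR.
Qed.

End EuclideanNorm.

Section Sobolev.
Context {R : realType}.
Local Notation mu := (@lebesgue_measure R).
Local Notation V := 'rV[R]_3.
Local Notation tpi := (pi *+ 2 : R).

Definition slobodeckij_quotient (p : R) (u : R -> R) (x w : R) : \bar R :=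
  (`|u (x + w) - u x| `^ p / `|w| `^ (p - 1))%:E.

Definition slobodeckij_energy (p : R) (u : R -> R) : \bar R :=
  (\int[mu]_(x in `[0%R, (pi *+ 2)%R]) \int[mu]_(w in `[(- pi)%R, pi])
    slobodeckij_quotient p u x w)%E.

Lemma slobodeckij_quotient_ge0 p u x w : (0 <= slobodeckij_quotient p u x w)%E.
Proof. by rewrite lee_fin divr_ge0 ?powR_ge0. Qed.

Lemma negligible_shift (c : R) (N : set R) : mu.-negligible N ->
  mu.-negligible ((fun t => c + t) @^-1` N).
Proof.
move=> [A [mA A0 NA]]; exists ((fun t => c + t) @^-1` A); split.
- by rewrite -[X in measurable X]setTI; apply: measurable_shift.
- have := lebesgue_measure_shift c A mA; rewrite /pushforward => H.
  exact: (etrans H A0).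
- by move=> x Nx; exact: NA.
Qed.

Lemma measurable_slobodeckij (p : R) (u : R -> R) : measurable_fun setT u ->
  measurable_fun setT ((fun z => slobodeckij_quotient p u z.1 z.2) : R * R -> \bar R).
Proof.
move=> mg; apply/measurable_EFinP; apply: measurable_funM.
  apply: (measurableT_comp (measurable_powR p)).
  apply: measurableT_comp => //; apply: measurable_funB.
    apply: measurableT_comp => //; exact: measurable_funD.
  exact: measurableT_comp.
apply: (measurableT_comp measurable_invr).
apply: (measurableT_comp (measurable_powR (p - 1))).
exact: measurableT_comp.
Qed.

Lemma measurable_slobodeckij1 (p : R) (u : R -> R) (x : R) : measurable_fun setT u ->
  measurable_fun setT (slobodeckij_quotient p u x).
Proof.
move=> mg.
exact: (measurableT_comp (measurable_slobodeckij p u mg) (measurable_pair1 x)).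
Qed.

Lemma measurable_slobodeckij_inner (p : R) (u : R -> R) : measurable_fun setT u ->
  measurable_fun setT (fun x => \int[mu]_(w in `[(- pi)%R, pi]) slobodeckij_quotient p u x w)%E.
Proof.
move=> mg; apply: measurable_tonelli; [by []|exact: measurable_slobodeckij|].
exact: slobodeckij_quotient_ge0.
Qed.

(** For almost every [x] the values at [x] agree; for each such [x] the values at [x + w] agree for
    almost every [w], because translates of null sets are null. *)
Lemma slobodeckij_ae_eq (p : R) (g h : R -> R) : measurable_fun setT g ->
  measurable_fun setT h -> {ae mu, forall x, g x = h x} ->
  slobodeckij_energy p g = slobodeckij_energy p h.
Proof.
move=> mg mh gh.
apply: ge0_ae_eq_integral.
- by [].
- exact: (measurable_funTS (measurable_slobodeckij_inner p g mg)).
- exact: (measurable_funTS (measurable_slobodeckij_inner p h mh)).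
- by move=> x _; apply: integral_ge0 => *; exact: slobodeckij_quotient_ge0.
- by move=> x _; apply: integral_ge0 => *; exact: slobodeckij_quotient_ge0.
apply: (ae_imp _ _ _ gh) => x ghx _.
apply: ge0_ae_eq_integral.
- by [].
- exact: (measurable_funTS (measurable_slobodeckij1 p g x mg)).
- exact: (measurable_funTS (measurable_slobodeckij1 p h x mh)).
- by move=> w _; exact: slobodeckij_quotient_ge0.
- by move=> w _; exact: slobodeckij_quotient_ge0.
have ghs : {ae mu, forall w, g (x + w) = h (x + w)}.
  by have := negligible_shift x _ gh.
by apply: (ae_imp _ _ _ ghs) => w e _; rewrite /slobodeckij_quotient e ghx.
Qed.

Lemma smooth_continuous (phi : R -> R) : smooth phi -> continuous phi.
Proof.
move=> sphi x; apply: differentiable_continuous; apply/derivable1_diffP.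
by have := sphi 0%N x; rewrite derive1n0.
Qed.

(** The continuous representative of [g] is still a weak derivative of [f], as integrals do not see
    null sets; [du_bois_reymond] then makes it a classical derivative. *)
Lemma sobolev_component (p : R) (f g : R -> R) : 3%:R < p -> continuous f ->
  (forall x, f (x + tpi) = f x) -> measurable_fun setT g ->
  (forall x, g (x + tpi) = g x) ->
  (\int[mu]_(x in `[0%R, (pi *+ 2)%R]) (`|g x| `^ p)%:E)%E \is a fin_num ->
  slobodeckij_energy p g \is a fin_num ->
  (forall phi, smooth phi -> (forall x, phi (x + tpi) = phi x) ->
    \int[mu]_(x in `[0, tpi]) (f x * derive1 phi x) =
    - \int[mu]_(x in `[0, tpi]) (g x * phi x)) ->
  exists u : R -> R, [/\ continuous u, forall x, u (x + tpi) = u x,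
    forall x : R, is_derive x (1 : R) f (u x) & slobodeckij_energy p u \is a fin_num].
Proof.
move=> hp cf pf mg pg Lp Eg weak.
have [u [cu pu gu]] := morrey_continuous_representative _ _ hp mg pg Lp Eg.
have mu' : measurable_fun setT u by exact: continuous_measurable_fun.
exists u; split; [exact: cu|exact: pu| |by rewrite -(slobodeckij_ae_eq p _ _ mg mu' gu); exact: Eg].
apply: du_bois_reymond; [exact: cf|exact: cu|exact: pf|exact: pu|move=> phi sphi pphi].
rewrite (weak _ sphi pphi); congr (- fine _).
have mphi : measurable_fun setT phi by apply: continuous_measurable_fun; exact: smooth_continuous.
apply: ae_eq_integral.
- by [].
- by apply/measurable_EFinP/measurable_funTS; exact: measurable_funM.
- by apply/measurable_EFinP/measurable_funTS; exact: measurable_funM.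
by apply: (ae_imp _ _ _ gu) => x e _; rewrite /= e.
Qed.

(** Each coordinate of the weak derivative and of its increments is dominated by the Euclidean norm,
    so the finiteness of both integrals passes to coordinates. *)
Lemma sobolev_C1 (p : R) (f : R -> V) : 3%:R < p -> sobolev_slobodeckij p f ->
  (forall x, f (x + tpi) = f x) /\
  exists df : R -> V, [/\ forall i, continuous (fun x => df x 0 i),
    forall x, df (x + tpi) = df x,
    forall i (x : R), is_derive x (1 : R) (fun y => f y 0 i) (df x 0 i),
    derive1 f = df &
    forall i, slobodeckij_energy p (fun x => df x 0 i) \is a fin_num].
Proof.
move=> hp [cf [pf mf _] [g [[pg mg Lpg] weak Eg]]]; split; first exact: pf.
have p0 : 0 <= p by lra.
have cfi i : continuous (fun x => f x 0 i).
  move=> x; apply: (@continuous_comp _ _ _ f (fun v : V => v 0 i)); first exact: cf.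
  exact: coord_continuous.
have comp i : exists u : R -> R, [/\ continuous u, forall x, u (x + tpi) = u x,
    forall x : R, is_derive x (1 : R) (fun y => f y 0 i) (u x) & slobodeckij_energy p u \is a fin_num].
  apply: (sobolev_component p _ (fun x => g x 0 i) hp (cfi i)).
  - by move=> x; rewrite pf.
  - exact: mg.
  - by move=> x; rewrite pg.
  - rewrite ge0_fin_numE; last by apply: integral_ge0 => *; rewrite lee_fin powR_ge0.
    apply: le_lt_trans Lpg; apply: ge0_le_integral; [by []|by move=> *; rewrite lee_fin powR_ge0| | |].
    + apply/measurable_EFinP/measurable_funTS.
      apply: (measurableT_comp (measurable_powR p)).
      by apply: measurableT_comp; [exact: normr_measurable|exact: (mg i)].
    + apply/measurable_EFinP/measurable_funTS.
      by apply: (measurableT_comp (measurable_powR p)); exact: measurable_enorm.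
    + move=> x _; rewrite lee_fin; apply: ge0_ler_powR; rewrite ?nnegrE ?enorm_ge0//.
      exact: normr_le_enorm.
  - pose H (x w : R) : \bar R := (enorm (g (x + w) - g x) `^ p / `|w| `^ (p - 1))%:E.
    have H0 x w : (0 <= H x w)%E by rewrite lee_fin divr_ge0 ?powR_ge0.
    have mH : measurable_fun setT ((fun z => H z.1 z.2) : R * R -> \bar R).
      apply/measurable_EFinP; apply: measurable_funM.
        apply: (measurableT_comp (measurable_powR p)); apply: measurable_enorm => j.
        rewrite (_ : (fun z => _) = (fun z : R * R => g (z.1 + z.2) 0 j - g z.1 0 j)).
          apply: measurable_funB; last exact: (measurableT_comp (mg j)).
          apply: (measurableT_comp (mg j)); exact: measurable_funD.
        by apply/funext => z; rewrite !mxE.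
      apply: (measurableT_comp measurable_invr).
      apply: (measurableT_comp (measurable_powR (p - 1))).
      exact: measurableT_comp.
    rewrite ge0_fin_numE; last first.
      by apply: integral_ge0 => *; apply: integral_ge0 => *; exact: slobodeckij_quotient_ge0.
    apply: le_lt_trans Eg; apply: ge0_le_integral; [by []| | | |].
    + by move=> *; apply: integral_ge0 => *; exact: slobodeckij_quotient_ge0.
    + exact: (measurable_funTS (measurable_slobodeckij_inner p _ (mg i))).
    + apply: measurable_funTS.
      by apply: (measurable_tonelli _ _ _ _ _ mu _ H); [by []|exact: mH|move=> *; exact: H0].
    + move=> x _; apply: ge0_le_integral; [by []|by move=> *; exact: slobodeckij_quotient_ge0| | |].
      * exact: (measurable_funTS (measurable_slobodeckij1 p _ x (mg i))).
      * apply: measurable_funTS; exact: (measurableT_comp mH (measurable_pair1 x)).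
      * move=> w _; rewrite lee_fin ler_wpM2r ?invr_ge0 ?powR_ge0//.
        apply: ge0_ler_powR; rewrite ?nnegrE ?enorm_ge0//.
        by have := normr_le_enorm (g (x + w) - g x) i; rewrite !mxE.
  - by move=> phi sphi pphi; exact: weak.
have /choice[u uP] := comp.
pose df x : V := \row_i u i x.
have dfE i : (fun x => df x 0 i) = u i by apply/funext => x; rewrite mxE.
have dfi i (x : R) : is_derive x (1 : R) (fun y => f y 0 i) (df x 0 i).
  by rewrite mxE; have [_ _ + _] := uP i; apply.
exists df; split; [| |exact: dfi| |].
- by move=> i; rewrite dfE; have [] := uP i.
- by move=> x; apply/rowP => i; rewrite !mxE; have [_ + _ _] := uP i.
- apply/funext => x; rewrite derive1E derive_mx; last first.
    apply/derivable_mxP => i j; rewrite (ord1 i).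
    by have [] := dfi j x.
  apply/rowP => j; rewrite mxE; have [_ ->//] := dfi j x.
- by move=> i; rewrite dfE; have [] := uP i.
Qed.

End Sobolev.

(** * Functions of the parameter with a common bound on value and derivative *)

Section BoundedC1.
Context {R : realType}.
Implicit Types (u v : R -> R) (A B : R).

(** One constant bounds the function and its derivative, so a single dominating function yields
    integrability, differentiability and continuity of the derivative of an integral. The derivative
    is an existential witness, assembled by the rules of calculus. *)
Definition C1_bounded (de : R) (u : R -> R) (A : R) : Prop :=
  exists u' : R -> R, forall tau : R, `|tau| < de ->
    [/\ is_derive tau (1 : R) u (u' tau), {for tau, continuous u'},
        `|u tau| <= A & `|u' tau| <= A].

Lemma C1_bounded_le de u A B : C1_bounded de u A -> A <= B -> C1_bounded de u B.
Proof.
move=> [u' uP] AB; exists u' => tau td; have [h1 h2 h3 h4] := uP tau td.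
by split => //; [exact: le_trans h3 AB|exact: le_trans h4 AB].
Qed.

Lemma C1_bounded_cst de (c : R) : C1_bounded de (fun=> c) `|c|.
Proof.
exists (fun=> 0) => tau td; split => //; last by rewrite normr0.
- exact: is_derive_cst.
- exact: cvg_cst.
Qed.

Lemma is_derive_cvg (u : R -> R) (x d : R) : is_derive x (1 : R) u d ->
  {for x, continuous u}.
Proof.
by move=> [du _]; apply: differentiable_continuous; apply/derivable1_diffP.
Qed.

(** The factor [2] counts the two terms of the product rule. *)
Lemma C1_boundedM de u v A B : 0 <= A -> 0 <= B -> C1_bounded de u A -> C1_bounded de v B ->
  C1_bounded de (fun tau => u tau * v tau) (2 * (A * B)).
Proof.
move=> A0 B0 [u' uP] [v' vP]; exists (fun tau => u tau * v' tau + v tau * u' tau) => tau td.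
have [h1 h2 h3 h4] := uP tau td; have [k1 k2 k3 k4] := vP tau td; split.
- exact: is_derive_funM.
- apply: cvgD; apply: cvgM => //; exact: is_derive_cvg.
- rewrite normrM; have := ler_pM (normr_ge0 _) (normr_ge0 _) h3 k3.
  by have := mulr_ge0 A0 B0; lra.
- apply: (le_trans (ler_normD _ _)); rewrite !normrM.
  have := ler_pM (normr_ge0 _) (normr_ge0 _) h3 k4.
  by have := ler_pM (normr_ge0 _) (normr_ge0 _) k3 h4; rewrite (mulrC B); lra.
Qed.

Lemma C1_boundedD de u v A B : C1_bounded de u A -> C1_bounded de v B ->
  C1_bounded de (fun tau => u tau + v tau) (A + B).
Proof.
move=> [u' uP] [v' vP]; exists (fun tau => u' tau + v' tau) => tau td.
have [h1 h2 h3 h4] := uP tau td; have [k1 k2 k3 k4] := vP tau td; split.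
- exact: is_derive_funD.
- by apply: cvgD.
- by apply: (le_trans (ler_normD _ _)); exact: lerD.
- by apply: (le_trans (ler_normD _ _)); exact: lerD.
Qed.

Lemma C1_bounded_ext de u v A : u =1 v -> C1_bounded de u A -> C1_bounded de v A.
Proof. by move=> uv; have -> : v = u by apply/funext => x; rewrite uv. Qed.

Lemma C1_bounded_id de : de <= 1 -> C1_bounded de id 1.
Proof.
move=> d1; exists (fun=> 1) => tau td; split => //; last by rewrite normr1.
- exact: is_derive_id.
- exact: cvg_cst.
- by rewrite ltW// (lt_le_trans td).
Qed.

(** The absolute value gives the derivative a shape that remains correct at [0] when [a > 1], so one
    formula covers vanishing cross products as well. *)
Lemma is_derive_powR_gt0 (a x : R) : 0 < x ->
  is_derive x (1 : R) (fun y => `|y| `^ a) (a * `|x| `^ (a - 1)).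
Proof.
move=> x0.
have xI : x \in `]0, +oo[ by rewrite in_itv/= x0.
have H : is_derive x (1 : R) (fun y => y `^ a) (a * `|x| `^ (a - 1)).
  apply: DeriveDef; first exact: derivable_powR.
  by rewrite -derive1E (gtr0_norm x0); exact: powR_derive1.
apply: near_eq_is_derive H.
near=> y; rewrite gtr0_norm//.
by near: y; exact: lt_nbhsr.
Unshelve. all: by end_near. Qed.

Lemma is_derive_powR_0 (a : R) : 1 < a ->
  is_derive (0 : R) (1 : R) (fun y => `|y| `^ a) 0.
Proof.
move=> a1.
have a10 : 0 < a - 1 by lra.
have H : h^-1 *: (`|h *: (1 : R) + 0| `^ a - `|(0 : R)| `^ a) @[h --> (0 : R)^'] --> (0 : R).
  apply/cvgrPdist_lt => e e0.
  exists (e `^ (a - 1)^-1) => [|h]/=; first exact: powR_gt0.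
  rewrite !sub0r !normrN => he h0.
  rewrite normr0 powR0; last by lra.
  rewrite subr0 addr0 [h *: 1]mulr1.
  rewrite [_ *: _]/( _ * _) normrM normfV (ger0_norm (powR_ge0 _ _)).
  have h0' : 0 < `|h| by rewrite normr_gt0.
  have -> : `|h| `^ a = `|h| * `|h| `^ (a - 1).
    by rewrite mulr_powRB1//; lra.
  rewrite mulKf ?gt_eqF//.
  have -> : e = (e `^ (a - 1)^-1) `^ (a - 1) by rewrite -powRrM mulVf ?gt_eqF// powRr1// ltW.
  by apply: gt0_ltr_powR; rewrite ?nnegrE ?powR_ge0.
apply: DeriveDef; first by apply/cvg_ex; exists 0; exact: H.
exact/cvg_lim.
Qed.

Section NormPower.
Variables (de : R) (w : 'I_3 -> R -> R) (A : R).
Hypothesis A0 : 0 <= A.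
Hypothesis wA : forall i, C1_bounded de (w i) A.

Let q (tau : R) : R := w 0 tau ^+ 2 + w 1 tau ^+ 2 + w 2%:R tau ^+ 2.

Let q_ge0 tau : 0 <= q tau. Proof. by rewrite /q !addr_ge0 ?sqr_ge0. Qed.

Let q_C1 : C1_bounded de q (6 * A ^+ 2).
Proof.
have h i : C1_bounded de (fun tau => w i tau * w i tau) (2 * (A * A)) by exact: C1_boundedM.
have -> : 6 * A ^+ 2 = 2 * (A * A) + 2 * (A * A) + 2 * (A * A) by ring.
exact: C1_boundedD (C1_boundedD _ _ _ _ _ (h 0) (h 1)) (h 2%:R).
Qed.

(** As [q] stays between [c] and [6 * A ^+ 2], its power with exponent [s] is at most the sum of the
    powers of both ends, whatever the sign of [s]. The constant collects this for [s = r] and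
    [s = r - 1]. *)
Lemma norm_power_C1_pos (c r : R) : 0 < c -> (forall tau, `|tau| < de -> c <= q tau) ->
  C1_bounded de (fun tau => q tau `^ r)
    ((1 + `|r| * (6 * A ^+ 2)) *
     (c `^ r + (6 * A ^+ 2) `^ r + c `^ (r - 1) + (6 * A ^+ 2) `^ (r - 1))).
Proof.
move=> c0 cq; have [q' qP] := q_C1; set M := 6 * A ^+ 2.
exists (fun tau => r * `|q tau| `^ (r - 1) * q' tau) => tau td.
have [h1 h2 h3 h4] := qP tau td.
have qc := cq tau td; have q0 : 0 < q tau by exact: lt_le_trans qc.
have qM : q tau <= M by rewrite (le_trans (ler_norm _)).
have M0 : 0 < M by exact: lt_le_trans qM.
have bnd s : q tau `^ s <= c `^ s + M `^ s.
  have [s0|s0] := leP 0 s.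
    by rewrite (@le_trans _ _ (M `^ s)) ?lerDr ?powR_ge0//; apply: ge0_ler_powR => //; rewrite nnegrE ltW.
  rewrite (@le_trans _ _ (c `^ s)) ?lerDl ?powR_ge0//.
  by apply: ler_powR_npos => //; exact: ltW.
have qE : (fun tau => q tau `^ r) = (fun x => `|x| `^ r) \o q.
  by apply/funext => t /=; rewrite ger0_norm.
set S := c `^ r + M `^ r + c `^ (r - 1) + M `^ (r - 1).
have S0 : 0 <= S by rewrite /S !addr_ge0 ?powR_ge0.
have rM : 0 <= `|r| * M by rewrite mulr_ge0// ltW.
split.
- rewrite qE; apply: is_derive1_comp => //; exact: is_derive_powR_gt0.
- apply: cvgM; last exact: h2.
  apply: cvgM; first exact: cvg_cst.
  apply: (@continuous_comp _ _ _ q (fun x => `|x| `^ (r - 1))); first exact: is_derive_cvg h1.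
  exact: is_derive_cvg (is_derive_powR_gt0 _ _ q0).
- rewrite ger0_norm ?powR_ge0// (le_trans (bnd r))// mulrDl mul1r.
  have := mulr_ge0 rM S0; have := powR_ge0 c (r - 1); have := powR_ge0 M (r - 1).
  by rewrite /S; lra.
- rewrite !normrM (ger0_norm (powR_ge0 _ _)) (gtr0_norm q0).
  have -> : `|r| * q tau `^ (r - 1) * `|q' tau| = `|r| * `|q' tau| * q tau `^ (r - 1) by ring.
  rewrite (@le_trans _ _ (`|r| * M * S))//.
    apply: ler_pM; rewrite ?mulr_ge0 ?powR_ge0//; first by rewrite ler_wpM2l.
    rewrite (le_trans (bnd _))// /S.
    by have := powR_ge0 c r; have := powR_ge0 M r; lra.
  by rewrite mulrDl mul1r lerDr.
Qed.

(** Exponents above [1] need no lower bound on [q]. The bound is homogeneous of degree [2 * a] in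
    [A], so for [a = p / 2] a vector controlled by Taylor defects yields exactly their [p]-th
    power. *)
Lemma norm_power_C1 (a : R) : 1 < a ->
  C1_bounded de (fun tau => q tau `^ a) ((1 + a) * (6 * A ^+ 2) `^ a).
Proof.
move=> a1; have [q' qP] := q_C1; set M := 6 * A ^+ 2.
exists (fun tau => a * `|q tau| `^ (a - 1) * q' tau) => tau td.
have [h1 h2 h3 h4] := qP tau td.
have qM : q tau <= M by rewrite (le_trans (ler_norm _)).
have M0 : 0 <= M by exact: le_trans qM.
have qE : (fun tau => q tau `^ a) = (fun x => `|x| `^ a) \o q.
  by apply/funext => t /=; rewrite ger0_norm.
have Ma : 0 <= M `^ a by exact: powR_ge0.
split.
- rewrite qE; apply: is_derive1_comp => //.
  have := q_ge0 tau; rewrite le_eqVlt => /predU1P[q0|q0]; last exact: is_derive_powR_gt0.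
  rewrite -q0 normr0 powR0 ?mulr0; last by lra.
  exact: is_derive_powR_0.
- apply: cvgM; last exact: h2.
  apply: cvgM; first exact: cvg_cst.
  apply: (@continuous_comp _ _ _ q (fun x => `|x| `^ (a - 1))); first exact: is_derive_cvg h1.
  by apply: continuous_powR_norm; lra.
- rewrite ger0_norm ?powR_ge0// (@le_trans _ _ (M `^ a))//.
    by apply: ge0_ler_powR; rewrite ?nnegrE//; lra.
  by rewrite mulrDl mul1r; have : 0 <= a * M `^ a; [rewrite mulr_ge0//|]; lra.
- rewrite !normrM (ger0_norm (powR_ge0 _ _)) (ger0_norm (q_ge0 tau)) (@ger0_norm _ a); last lra.
  rewrite (@le_trans _ _ (a * M `^ (a - 1) * M))//.
    apply: ler_pM => //; first by rewrite mulr_ge0 ?powR_ge0//; lra.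
    rewrite ler_wpM2l//; first lra.
    by apply: ge0_ler_powR; rewrite ?nnegrE//; lra.
  rewrite -mulrA (mulrC _ M) mulr_powRB1//; last lra.
  by rewrite mulrDl mul1r lerDr.
Qed.

End NormPower.

End BoundedC1.

(** * Closed C^1 curves *)

Section Geometry.
Context {R : realType}.
Local Notation mu := (@lebesgue_measure R).
Local Notation V := 'rV[R]_3.
Local Notation tpi := (pi *+ 2 : R).
Implicit Types (s t x : R).

(** Lower bounds are proved in this norm because it is linear in the absolute values of the
    coordinates; [sum_sqr_ge] converts them to sums of squares. *)
Definition l1norm (u : V) : R := `|u 0 0| + `|u 0 1| + `|u 0 2%:R|.

Definition C1_closed (f df : R -> V) : Prop :=
  [/\ forall x, f (x + tpi) = f x, forall x, df (x + tpi) = df x,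
      forall i, continuous (fun x => df x 0 i) &
      forall i (x : R), is_derive x (1 : R) (fun y => f y 0 i) (df x 0 i)].

Let tpi0 : 0 < tpi. Proof. by rewrite pmulrn_rgt0 ?pi_gt0. Qed.

Lemma ord3_ind (P : 'I_3 -> Prop) : P 0 -> P 1 -> P 2%:R -> forall i, P i.
Proof.
move=> P0 P1 P2 [[|[|[|//]]] h].
- by have -> : Ordinal h = 0 by exact/val_inj.
- by have -> : Ordinal h = 1 by exact/val_inj.
- by have -> : Ordinal h = 2%:R by exact/val_inj.
Qed.

Lemma l1norm_ge (u : V) i : `|u 0 i| <= l1norm u.
Proof.
have h0 := normr_ge0 (u 0 0); have h1 := normr_ge0 (u 0 1).
have h2 := normr_ge0 (u 0 2%:R); rewrite /l1norm.
by elim/ord3_ind: i; lra.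
Qed.

Lemma pair_reduce s t : exists (v : R) (k : int), `|v| <= pi /\ t = s + v + k%:~R * tpi.
Proof.
have [k [y [y0 y1 e]]] := periodic_reduce tpi (t - s + pi) tpi0.
exists (y - pi), k; split; first by rewrite ler_norml; lra.
have -> : s + (y - pi) + k%:~R * tpi = s - pi + (y + k%:~R * tpi) by ring.
by rewrite -e; ring.
Qed.

Lemma chord_intmul s t (k : int) : chord s (t + k%:~R * tpi) = chord s t.
Proof. exact: (period_intmul _ _ _ (chord_periodr s)). Qed.

Lemma chord_le s t : chord s t <= `|t - s| / 2.
Proof.
rewrite /chord (le_trans (normr_sin_le _))// normrM normfV.
by rewrite (@ger0_norm _ 2).
Qed.

Lemma chord_le1 s t : chord s t <= 1.
Proof. by rewrite /chord ler_norml sin_geN1 sin_le1. Qed.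

Lemma sin_le_chord s t : `|sin (t - s)| <= 2 * chord s t.
Proof.
have {1}-> : t - s = (t - s) / 2 + (t - s) / 2 by field.
rewrite sinD; set a := (t - s) / 2.
have -> : sin a * cos a + cos a * sin a = 2 * sin a * cos a by ring.
rewrite normrM /chord -/a normrM (@ger0_norm _ 2)//.
rewrite -[leRHS]mulr1 ler_wpM2l ?mulr_ge0//.
by rewrite ler_norml cos_geN1 cos_le1.
Qed.

Lemma linear_approx (F f : R -> R) (a e s t : R) : (forall x : R, is_derive x (1 : R) F (f x)) ->
  (forall x, Num.min s t <= x <= Num.max s t -> `|f x - a| <= e) ->
  `|F t - F s - (t - s) * a| <= e * `|t - s|.
Proof.
move=> dF; wlog st : s t / s <= t => [H|].
  have [st|/ltW ts] := leP s t => fa.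
    by apply: H => // x; rewrite min_l// max_r//; exact: fa.
  have := H t s ts; rewrite min_l// max_r// => /(_ fa).
  have -> : F s - F t - (s - t) * a = - (F t - F s - (t - s) * a) by ring.
  by rewrite normrN (distrC s).
rewrite min_l// max_r// => fa.
have [|x xab ->] := @MVT_segment R F f s t st (fun x _ => dF x).
  by apply: continuous_within; exact: is_derive_continuous dF.
rewrite (mulrC (t - s)) -mulrBl normrM ler_wpM2r// fa//.
Qed.

Lemma C1_closed_lipschitz (f df : R -> V) : C1_closed f df ->
  exists2 L : R, 0 <= L & (forall x i, `|df x 0 i| <= L) /\
    (forall s t i, `|f t 0 i - f s 0 i| <= L * chord s t).
Proof.
move=> [pf pdf cdf ddf].
have bi i : exists M : R, 0 <= M /\ forall x, `|df x 0 i| <= M.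
  have [M M0 MP] := periodic_bounded _ (cdf i) (fun x => congr1 (fun v : V => v 0 i) (pdf x)).
  by exists M.
have /choice[M MP] := bi.
(* The factor [4] passes from arc length to chords, and the sum makes the constant common to all
   coordinates. *)
pose L := 4 * (M 0 + M 1 + M 2%:R).
have M0 i := (MP i).1.
have ML i : 4 * M i <= L.
  by have := M0 0; have := M0 1; have := M0 2%:R; rewrite /L; elim/ord3_ind: i; lra.
exists L; first by have := M0 0; have := ML 0; lra.
split=> [x i|s t i]; first by have := (MP i).2 x; have := M0 i; have := ML i; lra.
have [v [k [vpi ->]]] := pair_reduce s t.
rewrite chord_intmul (period_intmul _ _ _ pf) chord_shift.
have := linear_approx _ _ 0 (M i) s (s + v) (ddf i) (fun x _ => _).
rewrite mulr0 subr0 (addrC s v) addrK => h.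
have {}h : `|f (v + s) 0 i - f s 0 i| <= M i * `|v|.
  by apply: h => y; rewrite subr0; exact: (MP i).2.
have sv := sin_half_lower _ vpi.
apply: (le_trans h); apply: (@le_trans _ _ (4 * M i * `|sin (v / 2)|)).
  rewrite -mulrA mulrCA ler_wpM2l//; lra.
by rewrite ler_wpM2r.
Qed.

(** If the bound failed at [x0], continuity would make it fail for the [l1norm] on a whole ball,
    hence also for the smaller Euclidean norm; but a ball is not a null set. *)
Lemma regular_everywhere (f df : R -> V) : C1_closed f df -> derive1 f = df ->
  regular_curve f -> exists2 C : R, 0 < C & forall x, C <= l1norm (df x).
Proof.
move=> [pf pdf cdf ddf] dfE [C C0 reg]; exists C => // x0; rewrite leNgt; apply/negP => lt.
have cN : continuous (fun x => l1norm (df x)).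
  have cni i : continuous (fun x => `|df x 0 i|).
    by move=> x; exact: (cvg_comp _ _ (cdf i x) (@norm_continuous _ R _)).
  by move=> x; apply: cvgD; [apply: cvgD|]; exact: cni.
have e0 : 0 < C - l1norm (df x0) by rewrite subr_gt0.
have /cvgrPdist_lt/(_ _ e0)[r /= r0 rP] := cN x0.
have reg' : mu.-negligible (~` [set x | C <= enorm (derive1 f x)]) := reg.
have [N [mN N0 sN]] := reg'.
have bN : ball x0 r `<=` N.
  move=> y yb; apply: sN => /=; rewrite dfE => Cy.
  have := rP y yb; rewrite ltr_norml => /andP[h _].
  have := enorm_le_sum (df y); rewrite -/(l1norm (df y)); lra.
have : (mu (ball x0 r) <= mu N)%E.
  by apply: le_measure; rewrite ?inE//; exact: measurable_ball.
rewrite [X in (_ <= X)%E]N0 lebesgue_measure_ball; last exact: ltW.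
by rewrite lee_fin; lra.
Qed.

Lemma l1norm_perturb_ge (u v w : V) (a b : R) : a <= l1norm u ->
  (forall i, `|v 0 i| <= b) -> (forall i, w 0 i = u 0 i + v 0 i) -> a - 3 * b <= l1norm w.
Proof.
move=> au vb wE.
have h i : `|u 0 i| - b <= `|w 0 i|.
  have := lerB_normD (u 0 i) (v 0 i); rewrite -wE; have := vb i; lra.
by move: au; have := h 0; have := h 1; have := h 2%:R; rewrite /l1norm; lra.
Qed.

(** Near a pair that represents the same point of the circle the bound comes from the nonvanishing
    derivative, near any other pair from simplicity. Each local bound holds for all small [c], so
    compactness of the square of a period gives one [c] for all pairs. *)
Lemma bilipschitz (f df : R -> V) (C : R) : C1_closed f df -> simple_closed f ->
  0 < C -> (forall x, C <= l1norm (df x)) ->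
  exists2 c : R, 0 < c & forall s t, c * chord s t <= l1norm (f t - f s).
Proof.
move=> cl simple C0 CN; have [L L0 [dfL fL]] := C1_closed_lipschitz _ _ cl.
have [pf pdf cdf ddf] := cl.
pose K := `[(0 : R), tpi]%classic `*` `[(0 : R), tpi]%classic.
have cK : compact K by apply: compact_setX; exact: segment_compact.
pose P (c : R) (z : R * R) := c * chord z.1 z.2 <= l1norm (f z.2 - f z.1).
have nbhs_box (z0 : R * R) (eta : R) : 0 < eta ->
    nbhs z0 [set z : R * R | `|z.1 - z0.1| < eta /\ `|z.2 - z0.2| < eta].
  move=> eta0; exists (ball z0.1 eta, ball z0.2 eta) => /=.
    by split; exact: nbhsx_ballx.
  by move=> z [z1 z2] /=; split; rewrite distrC.
have local (z0 : R * R) : exists2 c0 : R, 0 < c0 & nbhs z0 [set z | forall c, 0 < c -> c <= c0 -> P c z].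
  case: z0 => s0 t0.
  have [ch0|ch0] := eqVneq (chord s0 t0) 0.
    have [v [k [vpi t0E]]] := pair_reduce s0 t0.
    have v0 : v = 0.
      move: ch0; rewrite t0E chord_intmul chord_shift => sv.
      have := sin_half_lower _ vpi; rewrite sv => vle.
      by apply/normr0_eq0/eqP; rewrite eq_le normr_ge0 andbT; lra.
    have t0E' : t0 = s0 + k%:~R * tpi by rewrite t0E v0 addr0.
    (* Errors of [C / 6] in each of the three coordinates use up half of the lower bound [C]. *)
    have C6 : 0 < C / 6 by lra.
    have del i : exists d : R, 0 < d /\ forall x, `|x - s0| < d -> `|df x 0 i - df s0 0 i| <= C / 6.
      have /cvgrPdist_lt/(_ _ C6)[d /= d0 dP] := cdf i s0.
      exists d; split => // x xd; have := dP x; rewrite /= distrC => /(_ xd).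
      by rewrite distrC => /ltW.
    have /choice[d dP] := del.
    pose eta := Num.min (d 0) (Num.min (d 1) (d 2%:R)).
    have eta0 : 0 < eta by rewrite !lt_min !(dP _).1.
    have etad i : eta <= d i by elim/ord3_ind: i; rewrite /eta !ge_min lexx ?orbT.
    exists C => //; apply: filterS (nbhs_box (s0, t0) eta eta0) => -[s t] /= [se te] c c0 cC.
    rewrite /P /=; pose t' := t - k%:~R * tpi.
    have tE : t = t' + k%:~R * tpi by rewrite /t' subrK.
    have t'e : `|t' - s0| < eta.
      by have -> : t' - s0 = t - t0 by rewrite t0E' /t'; ring.
    rewrite tE chord_intmul (period_intmul _ _ _ pf).
    have comp i : `|f t' 0 i - f s 0 i - (t' - s) * df s0 0 i| <= C / 6 * `|t' - s|.
      apply: linear_approx (ddf i) _ => x /andP[x1 x2].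
      apply: (dP i).2; apply: lt_le_trans (etad i).
      move: se t'e; rewrite !ltr_norml => /andP[a1 a2] /andP[b1 b2].
      move: x1 x2; rewrite ge_min le_max => /orP[x1|x1] /orP[x2|x2]; apply/andP; split; lra.
    have low i : `|t' - s| * `|df s0 0 i| - C / 6 * `|t' - s| <= `|(f t' - f s) 0 i|.
      have := comp i; rewrite !mxE -normrM; set A := f t' 0 i - f s 0 i; set B := (t' - s) * _.
      have := ler_normB A (A - B); have -> : A - (A - B) = B by ring.
      by lra.
    have h := CN s0.
    have h1 : C / 2 * `|t' - s| <= l1norm (f t' - f s).
      have := low 0; have := low 1; have := low 2%:R.
      have := ler_wpM2l (normr_ge0 (t' - s)) h; rewrite /l1norm !mulrDr; lra.
    apply: le_trans h1; have := chord_le s t'.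
    have := ler_wpM2r (chord_ge0 s t') cC; have := chord_ge0 s t'.
    move=> h2 h3 h4; have : C * chord s t' <= C * (`|t' - s| / 2) by apply: ler_wpM2l => //; exact: ltW.
    by lra.
  have ne : f t0 <> f s0.
    apply: simple => -[k e]; move/eqP: ch0; apply.
    have -> : t0 = s0 + k%:~R * tpi by rewrite -e; ring.
    by rewrite chord_intmul /chord subrr mul0r sin0 normr0.
  pose m := l1norm (f t0 - f s0).
  have m0 : 0 < m.
    rewrite lt_def /l1norm !addr_ge0// andbT; apply/eqP => e; apply: ne.
    apply/rowP => i; apply/eqP; rewrite -subr_eq0 -normr_eq0 eq_le normr_ge0 andbT.
    have := l1norm_ge (f t0 - f s0) i; rewrite -/m e !mxE; exact.
  (* Moving both parameters by less than [eta] changes each coordinate of the difference by at most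
     [L * eta], hence the [l1norm] by at most [m / 2]; the summand [1] covers [L = 0]. *)
  pose eta := m / (6 * L + 1).
  have eta0 : 0 < eta by rewrite divr_gt0//; lra.
  exists (m / 4); first lra.
  apply: filterS (nbhs_box (s0, t0) eta eta0) => -[s t] /= [se te] c c0 cm; rewrite /P /=.
  have Le : 3 * (L * eta) <= m / 2.
    have -> : 3 * (L * eta) = m / 2 * ((6 * L) / (6 * L + 1)) by rewrite /eta; field; lra.
    by rewrite ger_pMr; [rewrite ler_pdivrMr; lra|lra].
  have h : m - 3 * (L * eta) <= l1norm (f t - f s).
    apply: (l1norm_perturb_ge (f t0 - f s0) ((f t - f t0) - (f s - f s0))) => //; last first.
      by move=> i; rewrite !mxE; ring.
    move=> i; rewrite !mxE; apply: (le_trans (ler_normB _ _)).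
    have h1 := fL t0 t i; have h2 := fL s0 s i.
    have h3 := ler_wpM2l L0 (chord_le t0 t); have h4 := ler_wpM2l L0 (chord_le s0 s).
    have h5 := ler_wpM2l L0 (ltW te); have h6 := ler_wpM2l L0 (ltW se).
    lra.
  have := chord_le1 s t; have := chord_ge0 s t => ch1 ch2.
  have : c * chord s t <= m / 4 * 1 by apply: ler_pM => //; exact: ltW.
  lra.
have /compact_near_coveringP cov := cK.
have : \forall c \near (0 : R)^'+, K `<=` P c.
  apply: cov => z0 Kz0; have [c0 c00 H] := local z0.
  exists ([set z | forall c, 0 < c -> c <= c0 -> P c z], [set c | 0 < c /\ c <= c0]) => /=.
    split; first exact: H.
    near=> c; split; near: c; [exact: nbhs_right_gt|exact: nbhs_right_le].
  by move=> [z c] /= [zP [c1 c2]]; exact: zP.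
move=> nc; have [c [c0 cP]] : exists c : R, 0 < c /\ K `<=` P c.
  near (0 : R)^'+ => c; exists c; split; first by near: c; exact: nbhs_right_gt.
  by near: c.
exists c => // s t.
have [k [y [y0 y1 ->]]] := periodic_reduce _ s tpi0.
have [l [z [z0 z1 ->]]] := periodic_reduce _ t tpi0.
rewrite chord_intmul chord_sym chord_intmul chord_sym !(period_intmul _ _ _ pf).
by apply: (cP (y, z)); split; rewrite /= in_itv/= ?y0 ?y1 ?z0 ?z1.
Unshelve. all: by end_near. Qed.

Lemma perturbE (f g : R -> V) (tau x : R) i : perturb f g tau x 0 i = f x 0 i + tau * g x 0 i.
Proof. by rewrite /perturb !mxE. Qed.

Lemma C1_closed_perturb (f df g dg : R -> V) (tau : R) : C1_closed f df -> C1_closed g dg ->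
  C1_closed (perturb f g tau) (perturb df dg tau).
Proof.
move=> [pf pdf cdf ddf] [pg pdg cdg ddg]; split.
- by move=> x; rewrite /perturb pf pg.
- by move=> x; rewrite /perturb pdf pdg.
- move=> i; rewrite (_ : (fun x => _) = (fun x => df x 0 i + tau * dg x 0 i)).
    by move=> x; apply: cvgD; [exact: cdf|apply: cvgM; [exact: cvg_cst|exact: cdg]].
  by apply/funext => x; rewrite perturbE.
- move=> i x; rewrite perturbE (_ : (fun y => _) = (fun x => f x 0 i + tau * g x 0 i)).
    by apply: is_derive_funD.
  by apply/funext => y; rewrite perturbE.
Qed.

Lemma C1_closed_derive1 (f df : R -> V) : C1_closed f df -> derive1 f = df.
Proof.
move=> [_ _ _ ddf]; apply/funext => x; rewrite derive1E derive_mx; last first.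
  apply/derivable_mxP => i j; rewrite (ord1 i).
  by have [] := ddf j x.
by apply/rowP => j; rewrite mxE; have [_ ->] := ddf j x.
Qed.

End Geometry.

(** * Menger curvature under perturbation *)

Section Menger.
Context {R : realType}.
Local Notation V := 'rV[R]_3.
Implicit Types (s t sg : R) (a b c u v : V).

Lemma cross_cyclic a b c : cross (b - a) (c - a) = cross (c - b) (a - b).
Proof. by apply/rowP => i; rewrite !mxE; ring. Qed.

Lemma enormN u : enorm (- u) = enorm u.
Proof. by rewrite /enorm; congr Num.sqrt; apply: eq_bigr => i _; rewrite mxE sqrrN. Qed.

Lemma enorm_distC u v : enorm (u - v) = enorm (v - u).
Proof. by rewrite -enormN opprB. Qed.

Lemma menger_integrand_cyclic (p : R) (f : R -> V) s t sg :
  menger_integrand p f s t sg = menger_integrand p f t sg s.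
Proof.
rewrite /menger_integrand /menger_curvature (cross_cyclic (f s) (f t)).
rewrite (enorm_distC (f t) (f s)) (enorm_distC (f s) (f sg)) (enorm_distC (f sg) (f t)).
rewrite (enorm_distC (f t) (f sg)) (enorm_distC (f sg) (f s)).
set A := enorm (cross _ _); set B := enorm (f s - f t); set C := enorm (f s - f sg).
set D := enorm (f sg - f t).
have -> : B * C * D = D * B * C by ring.
move: (_ `^ p) (enorm (derive1 f s)) (enorm (derive1 f t)) (enorm (derive1 f sg)) => P x y z.
by ring.
Qed.

Lemma enorm0 : enorm (0 : V) = 0.
Proof. by rewrite /enorm big1 ?sqrtr0// => i _; rewrite mxE expr0n. Qed.

Lemma menger_integrand_degenerate (p : R) (f : R -> V) s t sg : 0 < p -> f s = f t ->
  menger_integrand p f s t sg = 0.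
Proof.
move=> p0 st; rewrite /menger_integrand /menger_curvature st subrr enorm0 !mul0r invr0 mulr0.
by rewrite powR0 ?gt_eqF// !mul0r.
Qed.

Lemma menger_integrand_ge0 (p : R) (f : R -> V) s t sg : 0 <= menger_integrand p f s t sg.
Proof. by rewrite /menger_integrand !mulr_ge0 ?powR_ge0 ?enorm_ge0. Qed.

Lemma enorm_scale (d : R) (w : 'I_3 -> R) v : 0 <= d -> (forall i, v 0 i = d * w i) ->
  enorm v = d * (w 0 ^+ 2 + w 1 ^+ 2 + w 2%:R ^+ 2) `^ 2^-1.
Proof.
move=> d0 vE; rewrite enorm_powR !vE !exprMn -!mulrDr powRM ?sqr_ge0 ?addr_ge0 ?sqr_ge0//.
by congr (_ * _); rewrite powR12_sqrt ?sqr_ge0// sqrtr_sqr ger0_norm.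
Qed.

Lemma cross_bound (f df : R -> V) (L : R) (D : 'I_3 -> R -> R -> R) s t sg i :
  (forall x i, `|df x 0 i| <= L) ->
  (forall s t i, `|f t 0 i - f s 0 i| <= L * chord s t) -> 0 <= L ->
  (forall i s t, taylor_defect (fun x => f x 0 i) (fun x => df x 0 i) s t <= D i s t) ->
  0 < chord s t -> 0 < chord s sg ->
  `|cross (f t - f s) (f sg - f s) 0 i / (chord s t * chord s sg)| <=
  2 * L * (D 0 s t + D 1 s t + D 2%:R s t + (D 0 s sg + D 1 s sg + D 2%:R s sg)).
Proof.
move=> dfL fL L0 DP d1 d2.
have rem t' j : 0 < chord s t' ->
    `|f t' 0 j - f s 0 j - sin (t' - s) * df s 0 j| <= chord s t' * D j s t'.
  move=> c0; have := DP j s t'; rewrite /taylor_defect ler_pdivrMr//.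
  by rewrite (mulrC (chord s t')).
rewrite normf_div (gtr0_norm (mulr_gt0 d1 d2)) ler_pdivrMr ?mulr_gt0//.
have D0 j t' : 0 <= D j s t'.
  by apply: le_trans (DP j s t'); rewrite divr_ge0// chord_ge0.
have term j k : j != k -> `|(f t - f s) 0 j * (f sg - f s) 0 k - (f t - f s) 0 k * (f sg - f s) 0 j| <=
    2 * L * (D j s t + D k s t + (D j s sg + D k s sg)) * (chord s t * chord s sg).
  move=> _; rewrite !mxE.
  have r1 := rem t j d1; have r2 := rem t k d1; have r3 := rem sg j d2; have r4 := rem sg k d2.
  have sn := sin_le_chord s t.
  have a1 := fL s sg k; have a2 := fL s sg j.
  have b1 := dfL s j; have b2 := dfL s k.
  set U := f t 0 j - f s 0 j; set U' := f t 0 k - f s 0 k.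
  set W := f sg 0 k - f s 0 k; set W' := f sg 0 j - f s 0 j.
  set r := sin (t - s); set y := sin (sg - s).
  have -> : U * W - U' * W' = r * df s 0 j * (W - y * df s 0 k) + (U - r * df s 0 j) * W -
     (r * df s 0 k * (W' - y * df s 0 j) + (U' - r * df s 0 k) * W') by ring.
  have c1 := ltW d1; have c2 := ltW d2.
  have m1 : `|r * df s 0 j * (W - y * df s 0 k)| <= 2 * chord s t * L * (chord s sg * D k s sg).
    by rewrite !normrM; apply: ler_pM; [rewrite mulr_ge0|by []|apply: ler_pM|by []].
  have m2 : `|(U - r * df s 0 j) * W| <= chord s t * D j s t * (L * chord s sg).
    by rewrite normrM; apply: ler_pM.
  have m3 : `|r * df s 0 k * (W' - y * df s 0 j)| <= 2 * chord s t * L * (chord s sg * D j s sg).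
    by rewrite !normrM; apply: ler_pM; [rewrite mulr_ge0|by []|apply: ler_pM|by []].
  have m4 : `|(U' - r * df s 0 k) * W'| <= chord s t * D k s t * (L * chord s sg).
    by rewrite normrM; apply: ler_pM.
  apply: (le_trans (ler_normB _ _)).
  have t1 := ler_normD (r * df s 0 j * (W - y * df s 0 k)) ((U - r * df s 0 j) * W).
  have t2 := ler_normD (r * df s 0 k * (W' - y * df s 0 j)) ((U' - r * df s 0 k) * W').
  have e1 : 0 <= chord s t * chord s sg * L * (D j s t + D k s t).
    by rewrite !mulr_ge0// addr_ge0.
  move: t1 t2 m1 m2 m3 m4 e1; clear; lra.
have cc : 0 <= L * (chord s t * chord s sg) by rewrite !mulr_ge0// chord_ge0.
have fin j k : `|(f t - f s) 0 j * (f sg - f s) 0 k - (f t - f s) 0 k * (f sg - f s) 0 j| <=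
    2 * L * (D j s t + D k s t + (D j s sg + D k s sg)) * (chord s t * chord s sg) ->
  2 * L * (D j s t + D k s t + (D j s sg + D k s sg)) * (chord s t * chord s sg) <=
  2 * L * (D 0 s t + D 1 s t + D 2%:R s t + (D 0 s sg + D 1 s sg + D 2%:R s sg)) * (chord s t * chord s sg) ->
  `|(f t - f s) 0 j * (f sg - f s) 0 k - (f t - f s) 0 k * (f sg - f s) 0 j| <=
  2 * L * (D 0 s t + D 1 s t + D 2%:R s t + (D 0 s sg + D 1 s sg + D 2%:R s sg)) * (chord s t * chord s sg).
  exact: le_trans.
have z t' := (D0 0 t', D0 1 t', D0 2%:R t').
have c12 : 0 <= chord s t * chord s sg by rewrite mulr_ge0// chord_ge0.
have i1 : (0 : 'I_3) + 1 = 1 by exact/val_inj.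
have i2 : (0 : 'I_3) + 2%:R = 2%:R by exact/val_inj.
have i3 : (1 : 'I_3) + 1 = 2%:R by exact/val_inj.
have i4 : (1 : 'I_3) + 2%:R = 0 by exact/val_inj.
have i5 : (2%:R : 'I_3) + 1 = 0 by exact/val_inj.
have i6 : (2%:R : 'I_3) + 2%:R = 1 by exact/val_inj.
rewrite [cross _ _ 0 i]mxE.
have mono (x y : R) : x <= y -> 2 * L * x * (chord s t * chord s sg) <= 2 * L * y * (chord s t * chord s sg).
  by move=> xy; rewrite ler_wpM2r// ler_wpM2l// mulr_ge0.
have [[zt0 zt1] zt2] := z t; have [[zs0 zs1] zs2] := z sg.
elim/ord3_ind: i.
- by rewrite i1 i2; apply: fin; [exact: term|apply: mono; lra].
- by rewrite i3 i4; apply: fin; [exact: term|apply: mono; lra].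
- by rewrite i5 i6; apply: fin; [exact: term|apply: mono; lra].
Qed.

Lemma C1_bounded_affine (de x y : R) : de <= 1 ->
  C1_bounded de (fun tau => x + tau * y) (`|x| + 2 * `|y|).
Proof.
move=> d1; apply: C1_boundedD; first exact: C1_bounded_cst.
rewrite -[`|y|]mul1r; apply: C1_boundedM => //; first exact: C1_bounded_id.
exact: C1_bounded_cst.
Qed.

Lemma C1_bounded_quadratic (de x y z : R) : de <= 1 ->
  C1_bounded de (fun tau => x + tau * (y + tau * z)) (`|x| + 2 * `|y| + 4 * `|z|).
Proof.
move=> d1.
have -> : `|x| + 2 * `|y| + 4 * `|z| = `|x| + 2 * (1 * (`|y| + 2 * `|z|)) by ring.
apply: C1_boundedD; first exact: C1_bounded_cst.
apply: C1_boundedM => //; first exact: C1_bounded_id.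
exact: C1_bounded_affine.
Qed.

(** Interpolation at [0], [1] and [-1] bounds [|x|] and [|y|] by [B] and [|z|] by [2 * B]; then
    [1 + 2 + 4 * 2 = 11]. *)
Lemma quadratic_coef_bound (Q : R -> R) (x y z B de : R) : de <= 1 ->
  (forall tau, Q tau = x + tau * (y + tau * z)) ->
  `|Q 0| <= B -> `|Q 1| <= B -> `|Q (-1)| <= B -> C1_bounded de Q (11 * B).
Proof.
move=> d1 QE; rewrite !QE => h0 h1 h2.
have e0 : `|x| <= B by move: h0; rewrite mul0r addr0.
have e1 : `|y| <= B.
  by move: h1 h2; rewrite mul1r mulN1r !mul1r !mulN1r !ler_norml; lra.
have e2 : `|z| <= 2 * B.
  by move: h0 h1 h2; rewrite mul0r addr0 mul1r mulN1r !mul1r !mulN1r !ler_norml; lra.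
apply: (@C1_bounded_ext _ de (fun tau => x + tau * (y + tau * z))) => [tau|]; first by rewrite QE.
apply: C1_bounded_le (C1_bounded_quadratic _ _ _ _ d1) _; lra.
Qed.

Lemma sum_sqr_ge (x y z c : R) : 0 <= c -> c <= `|x| + `|y| + `|z| ->
  c ^+ 2 / 3 <= x ^+ 2 + y ^+ 2 + z ^+ 2.
Proof.
move=> c0 h; rewrite -(real_normK (num_real x)) -(real_normK (num_real y)) -(real_normK (num_real z)).
move: h; move: `|x| `|y| `|z| => a b d h.
have : c ^+ 2 <= (a + b + d) ^+ 2 by rewrite lerXn2r ?nnegrE//; lra.
have := sqr_ge0 (a - b); have := sqr_ge0 (a - d); have := sqr_ge0 (b - d).
by rewrite !expr2; lra.
Qed.

Variables (p : R) (g dg f df : R -> V) (L c de : R).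
Hypothesis hp : 3%:R < p.
Hypotheses (gc : C1_closed g dg) (fc : C1_closed f df).
Hypothesis L0 : 0 <= L.
Hypothesis dgL : forall x i, `|dg x 0 i| <= L.
Hypothesis dfL : forall x i, `|df x 0 i| <= L.
Hypothesis gL : forall s t i, `|g t 0 i - g s 0 i| <= L * chord s t.
Hypothesis fL : forall s t i, `|f t 0 i - f s 0 i| <= L * chord s t.
Hypothesis c0 : 0 < c.
Hypothesis de1 : de <= 1.
Hypothesis lower : forall tau, `|tau| < de -> forall s t,
  c * chord s t <= l1norm (perturb g f tau t - perturb g f tau s).
Hypothesis dlower : forall tau, `|tau| < de -> forall x, c <= l1norm (perturb dg df tau x).

Definition defect_pair (i : 'I_3) (s t : R) : R :=
  taylor_defect (fun x => g x 0 i) (fun x => dg x 0 i) s t +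
  taylor_defect (fun x => f x 0 i) (fun x => df x 0 i) s t.

Definition defect_sum (s t : R) : R := defect_pair 0 s t + defect_pair 1 s t + defect_pair 2%:R s t.

Let taylor_defect_ge0 (U u : R -> R) s t : 0 <= taylor_defect U u s t.
Proof. by rewrite divr_ge0// chord_ge0. Qed.

Lemma defect_pair_ge0 i s t : 0 <= defect_pair i s t.
Proof. by rewrite addr_ge0. Qed.

Lemma defect_sum_ge0 s t : 0 <= defect_sum s t.
Proof. by rewrite !addr_ge0// defect_pair_ge0. Qed.

Let kvec s t sg (i : 'I_3) (tau : R) : R :=
  cross (perturb g f tau t - perturb g f tau s) (perturb g f tau sg - perturb g f tau s) 0 i /
  (chord s t * chord s sg).

(** Only upper bounds enter [cross_bound], so it may be used at [tau = 1] and [tau = -1], possibly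
    outside the range where [lower] holds. The perturbed curve has constant [2 * L], which gives [B]
    its factor [4], and [11 * 4 = 44]. *)
Let kvec_C1 s t sg i : 0 < chord s t -> 0 < chord s sg ->
  C1_bounded de (kvec s t sg i) (44 * L * (defect_sum s t + defect_sum s sg)).
Proof.
move=> d1 d2; pose B := 4 * L * (defect_sum s t + defect_sum s sg).
have -> : 44 * L * (defect_sum s t + defect_sum s sg) = 11 * B by rewrite /B; ring.
have bnd tau : `|tau| <= 1 -> `|kvec s t sg i tau| <= B.
  move=> t1; rewrite /kvec.
  have -> : B = 2 * (2 * L) * (defect_sum s t + defect_sum s sg) by rewrite /B; ring.
  apply: (cross_bound _ (perturb dg df tau) _ defect_pair) => //.
  - move=> x j; rewrite perturbE (le_trans (ler_normD _ _))// normrM.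
    have := dgL x j; have := dfL x j.
    by have := ler_pM (normr_ge0 _) (normr_ge0 _) t1 (dfL x j); lra.
  - move=> s' t' j; rewrite !perturbE.
    have -> : g t' 0 j + tau * f t' 0 j - (g s' 0 j + tau * f s' 0 j) =
      (g t' 0 j - g s' 0 j) + tau * (f t' 0 j - f s' 0 j) by ring.
    rewrite (le_trans (ler_normD _ _))// normrM.
    have := gL s' t' j.
    by have := ler_pM (normr_ge0 _) (normr_ge0 _) t1 (fL s' t' j); lra.
  - by rewrite mulr_ge0.
  - move=> j s' t'; rewrite /defect_pair /taylor_defect -mulrDl ler_wpM2r ?invr_ge0 ?chord_ge0//.
    rewrite !perturbE.
    have -> : g t' 0 j + tau * f t' 0 j - (g s' 0 j + tau * f s' 0 j) -
        sin (t' - s') * (dg s' 0 j + tau * df s' 0 j) =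
      (g t' 0 j - g s' 0 j - sin (t' - s') * dg s' 0 j) +
      tau * (f t' 0 j - f s' 0 j - sin (t' - s') * df s' 0 j) by ring.
    rewrite (le_trans (ler_normD _ _))// lerD2l normrM.
    by rewrite -[leRHS]mul1r ler_wpM2r.
pose u := g t - g s; pose u' := f t - f s; pose v := g sg - g s; pose v' := f sg - f s.
pose dd := (chord s t * chord s sg)^-1.
pose x := cross u v 0 i * dd; pose z := cross u' v' 0 i * dd.
pose y := (cross u v' 0 i + cross u' v 0 i) * dd.
apply: (@quadratic_coef_bound _ x y z) => //.
- by move=> tau; rewrite /kvec /x /y /z /u /u' /v /v' /perturb -/dd !mxE; ring.
- by apply: bnd; rewrite normr0.
- by apply: bnd; rewrite normr1.
- by apply: bnd; rewrite normrN normr1.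
Qed.

Let wvec s t (i : 'I_3) (tau : R) : R :=
  (perturb g f tau t - perturb g f tau s) 0 i / chord s t.

Let wvec_C1 s t i : 0 < chord s t -> C1_bounded de (wvec s t i) (3 * L).
Proof.
move=> d1.
apply: (@C1_bounded_ext _ de (fun tau => (g t 0 i - g s 0 i) / chord s t +
  tau * ((f t 0 i - f s 0 i) / chord s t))).
  by move=> tau; rewrite /wvec /perturb !mxE; ring.
apply: C1_bounded_le (C1_bounded_affine _ _ _ de1) _.
have h1 : `|(g t 0 i - g s 0 i) / chord s t| <= L.
  by rewrite normf_div (gtr0_norm d1) ler_pdivrMr.
have h2 : `|(f t 0 i - f s 0 i) / chord s t| <= L.
  by rewrite normf_div (gtr0_norm d1) ler_pdivrMr.
by lra.
Qed.

Let wvec_lower s t tau : 0 < chord s t -> `|tau| < de ->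
  c ^+ 2 / 3 <= wvec s t 0 tau ^+ 2 + wvec s t 1 tau ^+ 2 + wvec s t 2%:R tau ^+ 2.
Proof.
move=> d1 td; apply: sum_sqr_ge; first exact: ltW c0.
rewrite /wvec !normf_div (gtr0_norm d1) -!mulrDl ler_pdivlMr//.
exact: (lower _ td).
Qed.

Let nvec x (i : 'I_3) (tau : R) : R := perturb dg df tau x 0 i.

Let nvec_C1 x i : C1_bounded de (nvec x i) (3 * L).
Proof.
apply: (@C1_bounded_ext _ de (fun tau => dg x 0 i + tau * df x 0 i)).
  by move=> tau; rewrite /nvec perturbE.
apply: C1_bounded_le (C1_bounded_affine _ _ _ de1) _.
by have := dgL x i; have := dfL x i; lra.
Qed.

Let nvec_lower x tau : `|tau| < de ->
  c ^+ 2 / 3 <= nvec x 0 tau ^+ 2 + nvec x 1 tau ^+ 2 + nvec x 2%:R tau ^+ 2.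
Proof.
by move=> td; apply: sum_sqr_ge; [exact: ltW c0|exact: (dlower _ td)].
Qed.

Let q3 (w : 'I_3 -> R -> R) tau := w 0 tau ^+ 2 + w 1 tau ^+ 2 + w 2%:R tau ^+ 2.

(** The chords extracted from the cross product cancel against those of the two sides at [s], and
    only [chord t sg] is left as a singular factor. *)
Let integrand_factor s t sg tau : 0 < chord s t -> 0 < chord s sg -> 0 < chord t sg ->
  `|tau| < de ->
  menger_integrand p (perturb g f tau) s t sg =
  (2 / chord t sg) `^ p * (q3 (kvec s t sg) tau `^ (p / 2) *
  (q3 (wvec s t) tau `^ (- (p / 2)) * (q3 (wvec s sg) tau `^ (- (p / 2)) *
  (q3 (wvec t sg) tau `^ (- (p / 2)) * (q3 (nvec s) tau `^ 2^-1 *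
  (q3 (nvec t) tau `^ 2^-1 * q3 (nvec sg) tau `^ 2^-1)))))).
Proof.
move=> d1 d2 d3 td.
have dE : derive1 (perturb g f tau) = perturb dg df tau.
  exact: C1_closed_derive1 (C1_closed_perturb _ _ _ _ _ gc fc).
have nE x : enorm (derive1 (perturb g f tau) x) = q3 (nvec x) tau `^ 2^-1.
  by rewrite dE enorm_powR.
have wE s' t' : 0 < chord s' t' -> enorm (perturb g f tau t' - perturb g f tau s') =
    chord s' t' * q3 (wvec s' t') tau `^ 2^-1.
  move=> c1; apply: (enorm_scale _ (fun i => wvec s' t' i tau)); first exact: ltW.
  by move=> i; rewrite /wvec mulrC divfK ?gt_eqF.
have kE : enorm (cross (perturb g f tau t - perturb g f tau s) (perturb g f tau sg - perturb g f tau s)) =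
    chord s t * chord s sg * q3 (kvec s t sg) tau `^ 2^-1.
  apply: (enorm_scale _ (fun i => kvec s t sg i tau)); first by rewrite mulr_ge0// ltW.
  by move=> i; rewrite /kvec mulrC divfK// gt_eqF// mulr_gt0.
have wp s' t' : 0 < chord s' t' -> 0 < q3 (wvec s' t') tau.
  move=> c1; apply: lt_le_trans (wvec_lower _ _ _ c1 td).
  by rewrite divr_gt0// exprn_gt0.
rewrite /menger_integrand /menger_curvature !nE (enorm_distC (perturb g f tau s)) kE !wE//.
have h w (r : R) : (q3 w tau `^ 2^-1) `^ r = q3 w tau `^ (r / 2) by rewrite -powRrM mulrC.
have hN w : 0 < q3 w tau -> (q3 w tau `^ 2^-1)^-1 `^ p = q3 w tau `^ (- (p / 2)).
  by move=> qw; rewrite -powR_inv1 ?powR_ge0// -powRrM h; congr (_ `^ _); field.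
set K := q3 (kvec s t sg) tau `^ 2^-1.
set e1 := q3 (wvec s t) tau `^ 2^-1; set e2 := q3 (wvec s sg) tau `^ 2^-1.
set e3 := q3 (wvec t sg) tau `^ 2^-1.
have e1p : 0 < e1 by rewrite powR_gt0// wp.
have e2p : 0 < e2 by rewrite powR_gt0// wp.
have e3p : 0 < e3 by rewrite powR_gt0// wp.
have -> : 2 * (chord s t * chord s sg * K) / (chord s t * e1 * (chord s sg * e2) * (chord t sg * e3)) =
   2 / chord t sg * (K * (e1^-1 * (e2^-1 * e3^-1))).
  by field; rewrite !gt_eqF.
have K0 : 0 <= K by exact: powR_ge0.
rewrite powRM; [|by rewrite divr_ge0// ltW|by rewrite !mulr_ge0// invr_ge0 ltW].
have i1 : 0 <= e1^-1 by rewrite invr_ge0 ltW.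
have i2 : 0 <= e2^-1 by rewrite invr_ge0 ltW.
have i3 : 0 <= e3^-1 by rewrite invr_ge0 ltW.
have i23 := mulr_ge0 i2 i3; have i123 := mulr_ge0 i1 i23.
rewrite (@powRM _ _ _ p K0 i123) (@powRM _ _ _ p i1 i23) (@powRM _ _ _ p i2 i3).
rewrite !hN ?wp// h -!mulrA.
by [].
Qed.

(** The factor with [kvec] is handled by [norm_power_C1], the sides and the speeds by
    [norm_power_C1_pos]. Since the chord opposite [s] is the longest, its negative power is at most
    that of the maximum of the other two. *)
Lemma menger_base_C1 : exists2 C : R, 0 <= C & forall s t sg,
  0 < chord s t -> 0 < chord s sg -> chord s t <= chord t sg -> chord s sg <= chord t sg ->
  C1_bounded de (fun tau => menger_integrand p (perturb g f tau) s t sg)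
    (C * ((defect_sum s t + defect_sum s sg) `^ p *
          (Num.max (chord s t) (chord s sg)) `^ (- p))).
Proof.
have p0 : 0 < p by move: hp; lra.
have a1 : 1 < p / 2 by move: hp; lra.
have c3 : 0 < c ^+ 2 / 3 by rewrite divr_gt0// exprn_gt0.
have L3 : 0 <= 3 * L by rewrite mulr_ge0.
pose Kr (r : R) := (1 + `|r| * (6 * (3 * L) ^+ 2)) *
     ((c ^+ 2 / 3) `^ r + (6 * (3 * L) ^+ 2) `^ r + (c ^+ 2 / 3) `^ (r - 1) + (6 * (3 * L) ^+ 2) `^ (r - 1)).
have Kr0 r : 0 <= Kr r.
  by rewrite mulr_ge0 ?addr_ge0 ?powR_ge0// !mulr_ge0// exprn_ge0.
have wK s t r : 0 < chord s t -> C1_bounded de (fun tau => q3 (wvec s t) tau `^ r) (Kr r).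
  move=> c1; apply: (norm_power_C1_pos _ _ _ L3 (fun i => wvec_C1 s t i c1) _ _ c3).
  by move=> tau td; exact: wvec_lower.
have nK x r : C1_bounded de (fun tau => q3 (nvec x) tau `^ r) (Kr r).
  apply: (norm_power_C1_pos _ _ _ L3 (nvec_C1 x) _ _ c3).
  by move=> tau td; exact: nvec_lower.
have [A [A0 wA]] : exists A : R, 0 <= A /\ forall s t, 0 < chord s t ->
    C1_bounded de (fun tau => q3 (wvec s t) tau `^ (- (p / 2))) A.
  by exists (Kr (- (p / 2))); split => // s t; exact: wK.
have [B [B0 nB]] : exists B : R, 0 <= B /\ forall x,
    C1_bounded de (fun tau => q3 (nvec x) tau `^ 2^-1) B.
  by exists (Kr 2^-1); split => // x; exact: nK.
have [Ck [Ck0 CkE]] : exists Ck : R, 0 <= Ck /\ Ck = (1 + p / 2) * 6 `^ (p / 2) * (44 * L) `^ p.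
  by eexists; split; last reflexivity; rewrite !mulr_ge0 ?powR_ge0//; lra.
clear Kr Kr0 wK nK.
pose M := A * (2 * (A * (2 * (A * (2 * (B * (2 * (B * B)))))))).
pose C := 2 * (2 `^ p * (2 * (Ck * (2 * M)))).
have M0 : 0 <= M by rewrite /M !mulr_ge0.
exists C; first by rewrite /C !mulr_ge0 ?powR_ge0.
move=> s t sg d1 d2 d13 d23.
have d3 : 0 < chord t sg by exact: lt_le_trans d13.
pose D := defect_sum s t + defect_sum s sg.
have D0 : 0 <= D by rewrite addr_ge0 ?defect_sum_ge0.
have kK : C1_bounded de (fun tau => q3 (kvec s t sg) tau `^ (p / 2)) (Ck * D `^ p).
  have LD : 0 <= 44 * L * D by rewrite !mulr_ge0.
  have := norm_power_C1 _ _ _ LD (fun i => kvec_C1 s t sg i d1 d2) _ a1.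
  rewrite (_ : (1 + p / 2) * _ = Ck * D `^ p)//.
  rewrite CkE powRM ?sqr_ge0//.
  have -> : ((44 * L * D) ^+ 2) `^ (p / 2) = (44 * L) `^ p * D `^ p.
    by rewrite -powR_mulrn// -powRrM -powRM ?mulr_ge0//; congr (_ `^ _); field.
  by rewrite !mulrA.
pose mx := Num.max (chord s t) (chord s sg).
have mx0 : 0 < mx by rewrite lt_max d1.
have mx3 : mx <= chord t sg by rewrite ge_max d13 d23.
have d3p : (2 / chord t sg) `^ p <= 2 `^ p * mx `^ (- p).
  have i3 : 0 <= (chord t sg)^-1 by rewrite invr_ge0 ltW.
  rewrite powRM// ler_wpM2l ?powR_ge0//.
  have -> : (chord t sg)^-1 `^ p = chord t sg `^ (- p).
    by rewrite -powR_inv1 ?chord_ge0// -powRrM mulN1r.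
  by apply: ler_powR_npos => //; lra.
have d3a : `|(2 / chord t sg) `^ p| <= 2 `^ p * mx `^ (- p) by rewrite ger0_norm ?powR_ge0.
have c3b := C1_bounded_le _ _ _ _ (C1_bounded_cst de ((2 / chord t sg) `^ p)) d3a.
have dts : 0 < chord t sg by [].
have prod : C1_bounded de (fun tau =>
  (2 / chord t sg) `^ p * (q3 (kvec s t sg) tau `^ (p / 2) *
  (q3 (wvec s t) tau `^ (- (p / 2)) * (q3 (wvec s sg) tau `^ (- (p / 2)) *
  (q3 (wvec t sg) tau `^ (- (p / 2)) * (q3 (nvec s) tau `^ 2^-1 *
  (q3 (nvec t) tau `^ 2^-1 * q3 (nvec sg) tau `^ 2^-1))))))) (C * (D `^ p * mx `^ (- p))).
  have -> : C * (D `^ p * mx `^ (- p)) =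
    2 * ((2 `^ p * mx `^ (- p)) * (2 * ((Ck * D `^ p) * (2 * M)))) by rewrite /C; ring.
  have BB : 0 <= 2 * (B * B) by rewrite !mulr_ge0.
  have BBB : 0 <= 2 * (B * (2 * (B * B))) by rewrite !mulr_ge0.
  have A1 : 0 <= 2 * (A * (2 * (B * (2 * (B * B))))) by rewrite !mulr_ge0.
  have A2 : 0 <= 2 * (A * (2 * (A * (2 * (B * (2 * (B * B))))))) by rewrite !mulr_ge0.
  have CD : 0 <= Ck * D `^ p by apply: mulr_ge0 => //; exact: powR_ge0.
  have M2 : 0 <= 2 * M by rewrite mulr_ge0.
  apply: C1_boundedM => //; [by rewrite mulr_ge0 ?powR_ge0|by apply: mulr_ge0 => //; exact: mulr_ge0|].
  apply: C1_boundedM => //.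
  apply: C1_boundedM => //; first exact: wA.
  apply: C1_boundedM => //; first exact: wA.
  apply: C1_boundedM => //; first exact: wA.
  apply: C1_boundedM => //.
  exact: C1_boundedM.
have [u' uP] := prod; exists u' => tau td; have [h1 h2 h3 h4] := uP tau td.
split => //; last by rewrite integrand_factor.
(* The factorization is available for [|tau| < de] only, an open condition, so it holds near each
   such [tau] and carries the derivative over. *)
apply: near_eq_is_derive h1.
near=> tau'; rewrite integrand_factor//.
near: tau'; rewrite near_simpl.
have e0 : 0 < de - `|tau| by rewrite subr_gt0.
apply: filterS (nbhsx_ballx tau _ e0) => x /=; rewrite /ball/= => xt.
have := ler_normB tau (tau - x); have -> : tau - (tau - x) = x by ring.
by move=> h; apply: le_lt_trans h _; rewrite -ltrBrDl.
Unshelve. all: by end_near. Qed.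

End Menger.

(** * Triple integrals *)

Lemma sigma_finite_lebesgue2 (R : realType) :
  sigma_finite setT (@lebesgue_measure R \x @lebesgue_measure R)%E.
Proof.
have /sigma_finiteP[F [TF ndF Foo]] := sigma_finiteT (@lebesgue_measure R).
exists (fun n => F n `*` F n).
  rewrite -setXTT {1 2}TF predeqE => -[x y]; split.
    move=> [/= [n _ Fnx] [k _ Gky]]; exists (maxn n k) => //; split.
    - by move: x Fnx; exact/subsetPset/ndF/leq_maxl.
    - by move: y Gky; exact/subsetPset/ndF/leq_maxr.
  by move=> [n _ []/= ? ?]; split; exists n.
move=> k; have [? ?] := Foo k.
split; first exact: measurableX.
by rewrite product_measure1E// lte_mul_pinfty// ge0_fin_numE.
Qed.

(** Lebesgue measure of the plane under its own name, so that it can carry a sigma-finite structure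
    and be a factor of the threefold product. *)
Definition lebesgue2 (R : realType) :
    set (measurableTypeR R * measurableTypeR R)%type -> \bar R :=
  (@lebesgue_measure R \x @lebesgue_measure R)%E.

HB.instance Definition _ (R : realType) := Measure.on (@lebesgue2 R).
HB.instance Definition _ (R : realType) :=
  Measure_isSigmaFinite.Build _ _ _ (@lebesgue2 R) (@sigma_finite_lebesgue2 R).

Section TripleIntegral.
Context {R : realType}.
Local Notation mu := (@lebesgue_measure R).
Local Notation I := (`[0%R, (pi *+ 2)%R]%classic : set R).

(* Quantifying over all parametrisations gives measurability of sections and permutations
   without composing with projections. *)
Definition jointly_measurable (h : R -> R -> R -> \bar R) : Prop :=
  forall d (T : measurableType d) (a b c : T -> R), measurable_fun setT a ->
    measurable_fun setT b -> measurable_fun setT c ->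
    measurable_fun setT (fun z => h (a z) (b z) (c z)).

Definition triple_integral (h : R -> R -> R -> \bar R) : \bar R :=
  (\int[mu]_(s in I) \int[mu]_(t in I) \int[mu]_(sg in I) h s t sg)%E.

Variable h : R -> R -> R -> \bar R.
Hypothesis mh : jointly_measurable h.
Hypothesis h0 : forall s t sg, (0 <= h s t sg)%E.

Lemma triple_integral_swap23 :
  triple_integral h = triple_integral (fun s t sg => h s sg t).
Proof.
apply: eq_integral => s _.
apply: (tonelli_swap _ _ _ _ _ mu mu _ _ (fun t sg => h s t sg)); [by []|by []| |by move=> *; exact: h0].
exact: mh.
Qed.

Lemma triple_integral_swap12 :
  triple_integral h = triple_integral (fun s t sg => h t s sg).
Proof.
apply: (tonelli_swap _ _ _ _ _ mu mu _ _ (fun s t => \int[mu]_(sg in I) h s t sg)%E); [by []|by []| |].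
  apply: (measurable_tonelli _ _ _ _ _ mu _ (fun (z : R * R) sg => h z.1 z.2 sg)); [by []| |by move=> *; exact: h0].
  by apply: mh; [exact: measurableT_comp|exact: measurableT_comp|exact: measurable_snd].
by move=> *; apply: integral_ge0 => *; exact: h0.
Qed.

Definition cube : set (R * (R * R)) := I `*` (I `*` I).
Local Notation mu3 := ((mu \x @lebesgue2 R)%E).

Lemma measurable_cube : measurable cube.
Proof. by apply: measurableX => //; exact: measurableX. Qed.

Lemma triple_integral_prod :
  (\int[mu3]_(z in cube) h z.1 z.2.1 z.2.2)%E = triple_integral h.
Proof.
transitivity (\int[mu]_(s in I) \int[@lebesgue2 R]_(z in I `*` I) h s z.1 z.2)%E.
  apply: (tonelli_prod _ _ _ _ _ mu (@lebesgue2 R) _ _ (fun s z => h s z.1 z.2)).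
  - by [].
  - exact: measurableX.
  - by apply: mh; [exact: measurable_fst|exact: measurableT_comp|exact: measurableT_comp].
  - by move=> *; exact: h0.
apply: eq_integral => s _.
apply: (tonelli_prod _ _ _ _ _ mu mu _ _ (fun t sg => h s t sg)); [by []|by []| |by move=> *; exact: h0].
exact: mh.
Qed.

End TripleIntegral.

Lemma integrable_EFinD (R : realType) d (T : measurableType d)
    (m : {measure set T -> \bar R}) (D : set T) (f g : T -> R) : measurable D ->
  m.-integrable D (EFin \o f) -> m.-integrable D (EFin \o g) ->
  m.-integrable D (EFin \o (fun z => f z + g z)).
Proof. by move=> mD If Ig; have := integrableD mD If Ig. Qed.

Lemma integrable_EFinZ (R : realType) d (T : measurableType d)
    (m : {measure set T -> \bar R}) (D : set T) (C : R) (f : T -> R) : measurable D ->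
  m.-integrable D (EFin \o f) -> m.-integrable D (EFin \o (fun z => C * f z)).
Proof. by move=> mD If; have := integrableZl mD C If. Qed.

Section TripleIntegrable.
Context {R : realType}.
Local Notation mu := (@lebesgue_measure R).
Local Notation mu3 := ((mu \x @lebesgue2 R)%E).

Definition triple_integrable (k : R -> R -> R -> R) : Prop :=
  [/\ jointly_measurable (fun s t sg => (k s t sg)%:E),
      (forall s t sg, 0 <= k s t sg) &
      mu3.-integrable cube (EFin \o (fun z => k z.1 z.2.1 z.2.2))].

(** A bridge between the product measure, on which domination is stated, and iterated integrals, in
    which variables are exchanged. *)
Lemma triple_integrableP (k : R -> R -> R -> R) :
  jointly_measurable (fun s t sg => (k s t sg)%:E) -> (forall s t sg, 0 <= k s t sg) ->
  triple_integrable k <-> (triple_integral (fun s t sg => (k s t sg)%:E) < +oo)%E.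
Proof.
move=> mk k0.
have k0' s t sg : (0 <= (k s t sg)%:E)%E by rewrite lee_fin.
have e : (\int[mu3]_(z in cube) `|(EFin \o (fun z : R * (R * R) => k z.1 z.2.1 z.2.2)) z|)%E =
    triple_integral (fun s t sg => (k s t sg)%:E).
  rewrite -(triple_integral_prod (fun s t sg => (k s t sg)%:E) mk k0').
  by apply: eq_integral => z _ /=; rewrite ger0_norm.
split.
  by move=> [_ _ /integrableP[_]]; rewrite e.
move=> fin; split=> //; apply/integrableP; split.
  apply: measurable_funTS.
  by apply: mk; [exact: measurable_fst|exact: measurableT_comp|exact: measurableT_comp].
by rewrite e.
Qed.

Lemma triple_integrable_swap23 (k : R -> R -> R -> R) :
  triple_integrable k -> triple_integrable (fun s t sg => k s sg t).
Proof.
move=> ik; have [mk k0 _] := ik; apply/triple_integrableP.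
- by move=> d T a b c ma mb mc; exact: mk.
- by move=> *; exact: k0.
- have e : triple_integral (fun s t sg => (k s t sg)%:E) =
      triple_integral (fun s t sg => (k s sg t)%:E).
    by apply: triple_integral_swap23 => // *; rewrite lee_fin.
  by rewrite -e; apply/triple_integrableP.
Qed.

Lemma triple_integrable_swap12 (k : R -> R -> R -> R) :
  triple_integrable k -> triple_integrable (fun s t sg => k t s sg).
Proof.
move=> ik; have [mk k0 _] := ik; apply/triple_integrableP.
- by move=> d T a b c ma mb mc; exact: mk.
- by move=> *; exact: k0.
- have e : triple_integral (fun s t sg => (k s t sg)%:E) =
      triple_integral (fun s t sg => (k t s sg)%:E).
    by apply: triple_integral_swap12 => // *; rewrite lee_fin.
  by rewrite -e; apply/triple_integrableP.
Qed.

Lemma triple_integrableD (k l : R -> R -> R -> R) : triple_integrable k ->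
  triple_integrable l -> triple_integrable (fun s t sg => k s t sg + l s t sg).
Proof.
move=> [mk k0 ik] [ml l0 il]; split.
- move=> d T a b c ma mb mc; apply/measurable_EFinP.
  by apply: measurable_funD; apply/measurable_EFinP; [exact: mk|exact: ml].
- by move=> *; apply: addr_ge0.
- apply: (integrable_EFinD _ _ _ _ _ _ _ _ ik il).
  exact: measurable_cube.
Qed.

Lemma triple_integrableZ (C : R) (k : R -> R -> R -> R) : 0 <= C ->
  triple_integrable k -> triple_integrable (fun s t sg => C * k s t sg).
Proof.
move=> C0 [mk k0 ik]; split.
- move=> d T a b c ma mb mc; apply/measurable_EFinP.
  by apply: measurable_funM => //; apply/measurable_EFinP; exact: mk.
- by move=> *; apply: mulr_ge0.
- apply: (integrable_EFinZ _ _ _ _ _ C _ _ ik).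
  exact: measurable_cube.
Qed.

End TripleIntegrable.

(** * Integrability of the defect kernel *)

Section DefectKernelIntegrable.
Context {R : realType}.
Local Notation mu := (@lebesgue_measure R).
Variables (p : R) (U u : R -> R).
Hypothesis hp : 3%:R < p.
Hypothesis dU : forall x : R, is_derive x (1 : R) U (u x).
Hypothesis cu : continuous u.
Hypothesis pU : forall x, U (x + pi *+ 2) = U x.
Hypothesis pu : forall x, u (x + pi *+ 2) = u x.
Hypothesis Eu : slobodeckij_energy p u \is a fin_num.

Let K s t sg : \bar R := (defect_kernel p U u s t sg)%:E.

Let mK : jointly_measurable K.
Proof.
move=> d T a b c ma mb mc; apply/measurable_EFinP.
exact: (measurable_defect_kernel p U u dU cu).
Qed.

Let K0 s t sg : (0 <= K s t sg)%E.
Proof. by rewrite lee_fin defect_kernel_ge0. Qed.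

Let K_fin : (triple_integral K < +oo)%E.
Proof.
have [C C0 CP] := defect_kernel_inner p U u hp dU cu pU pu.
have mu' : measurable_fun setT u by exact: continuous_measurable_fun.
have mi := measurable_slobodeckij_inner p u mu'.
have i0 s : (0 <= \int[mu]_(w in `[(- pi)%R, pi]) slobodeckij_quotient p u s w)%E.
  by apply: integral_ge0 => *; exact: slobodeckij_quotient_ge0.
apply: (@le_lt_trans _ _ (\int[mu]_(s in `[0%R, (pi *+ 2)%R])
  (C%:E * (\int[mu]_(w in `[(- pi)%R, pi]) slobodeckij_quotient p u s w + 1)))%E).
  apply: ge0_le_integral; [by []| | | |].
  - by move=> *; apply: integral_ge0 => *; apply: integral_ge0 => *; exact: K0.
  - apply: measurable_funTS.
    apply: (measurable_tonelli _ _ _ _ _ mu _ (fun s t => \int[mu]_(sg in `[0%R, (pi *+ 2)%R]) K s t sg)%E); [by []| |].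
      apply: (measurable_tonelli _ _ _ _ _ mu _ (fun (z : R * R) sg => K z.1 z.2 sg)); [by []| |by move=> *; exact: K0].
      by apply: mK; [exact: measurableT_comp|exact: measurableT_comp|exact: measurable_snd].
    by move=> *; apply: integral_ge0 => *; exact: K0.
  - apply: measurable_funeM; apply: emeasurable_funD => //; exact: (measurable_funTS mi).
  - by move=> s _; exact: CP.
rewrite ge0_integralZl; [|by []| | |by rewrite lee_fin]; last 2 first.
- by apply: emeasurable_funD => //; exact: (measurable_funTS mi).
- by move=> s _; apply: adde_ge0; [exact: i0|by []].
rewrite ge0_integralD; [|by []|by move=> *; exact: i0|exact: (measurable_funTS mi)|by []|by []].
rewrite integral_cst; last by [].
rewrite mul1e.
apply: lte_mul_pinfty; [by rewrite lee_fin|by []|].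
apply: lte_add_pinfty; first by rewrite ltey_eq Eu.
rewrite /= lebesgue_measure_itv/=; case: ifP => _; last by rewrite ltry.
by rewrite -EFinB ltry.
Qed.

Lemma defect_kernel_integrable : triple_integrable (defect_kernel p U u).
Proof. by apply/triple_integrableP; [exact: mK|exact: defect_kernel_ge0|exact: K_fin]. Qed.

End DefectKernelIntegrable.

(** * Differentiation under the integral sign *)

Section DifferentiateIntegral.
Context {R : realType} d (Y : measurableType d) (m : {measure set Y -> \bar R}).
Variables (B : set Y) (f : R -> Y -> R) (G : Y -> R) (de : R).
Hypothesis mB : measurable B.
Hypothesis de0 : 0 < de.
Hypothesis mf : forall tau, measurable_fun B (f tau).
Hypothesis iG : m.-integrable B (EFin \o G).
Hypothesis fG : forall y, C1_bounded de (f ^~ y) (G y).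

Let G0 y : 0 <= G y.
Proof.
have [u' uP] := fG y; have [|_ _ h _] := uP 0; first by rewrite normr0.
exact: le_trans h.
Qed.

Let itvP (tau : R) : `](- de), de[%classic tau <-> `|tau| < de.
Proof. by rewrite /= in_itv/= -ltr_norml. Qed.

Lemma C1_bounded_integrable tau : `|tau| < de -> m.-integrable B (EFin \o f tau).
Proof.
move=> td; apply: le_integrable iG => //; first exact/measurable_EFinP.
move=> y _ /=; rewrite lee_fin (ger0_norm (G0 y)).
by have [u' uP] := fG y; have [] := uP tau td.
Qed.

Let d1E tau y : `|tau| < de -> forall u', (forall tau : R, `|tau| < de ->
    [/\ is_derive tau (1 : R) (f ^~ y) (u' tau), {for tau, continuous u'},
        `|f tau y| <= G y & `|u' tau| <= G y]) -> partial1of2 f tau y = u' tau.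
Proof. by move=> td u' uP; rewrite partial1of2E; have [[_ ->]] := uP tau td. Qed.

Let derf tau y : `|tau| < de -> derivable (f ^~ y) tau 1.
Proof. by move=> td; have [u' uP] := fG y; have [[]] := uP tau td. Qed.

Let d1G tau y : `|tau| < de -> `|partial1of2 f tau y| <= G y.
Proof.
by move=> td; have [u' uP] := fG y; rewrite (d1E _ _ td _ uP); have [] := uP tau td.
Qed.

Let md1 tau : `|tau| < de -> measurable_fun B (partial1of2 f tau).
Proof.
move=> td.
(* The partial derivative is the pointwise limit of difference quotients along this null sequence,
   hence measurable. *)
pose x_ (n : nat) : R := n.+1%:R^-1.
apply: (@measurable_fun_cvg _ _ _ B (fun n y => (x_ n)^-1 * (f (x_ n + tau) y - f tau y))).
  by move=> n; apply: measurable_funM => //; exact: measurable_funB.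
move=> y By; have /cvg_ex[/= l fl] := derf tau y td.
have -> : partial1of2 f tau y = l.
  rewrite partial1of2E; exact/cvg_lim.
have x0 : (forall n, x_ n != 0) /\ x_ n @[n --> \oo] --> (0 : R).
  by split=> [n|]; [rewrite invr_eq0 pnatr_eq0|exact: cvg_harmonic].
move: fl => /cvgr_dnbhsP/(_ _ x0).
by under [in X in X -> _]eq_fun do rewrite scaler1.
Qed.

Let id1 tau : `|tau| < de -> m.-integrable B (EFin \o partial1of2 f tau).
Proof.
move=> td; apply: le_integrable iG => //; first by apply/measurable_EFinP; exact: md1.
by move=> y _ /=; rewrite lee_fin (ger0_norm (G0 y)); exact: d1G.
Qed.

Let F (tau : R) : R := \int[m]_(y in B) f tau y.

Lemma C1_bounded_derivable tau : `|tau| < de -> derivable F tau 1.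
Proof.
move=> td; apply: (@derivable_under_integral R d Y m f B mB tau (- de) de _ _ _ G).
- exact/itvP.
- by move=> x /itvP; exact: C1_bounded_integrable.
- by move=> x y /itvP xd _; exact: derf.
- exact: G0.
- exact: iG.
- by move=> x y /itvP xd _; exact: d1G.
Qed.

Lemma C1_bounded_continuous_derive tau : `|tau| < de -> {for tau, continuous (derive1 F)}.
Proof.
move=> td.
have dE x : `|x| < de -> derive1 F x = \int[m]_(y in B) partial1of2 f x y.
  move=> xd; apply: (@differentiation_under_integral R d Y m f B mB x (- de) de _ _ _ G).
  - exact/itvP.
  - by move=> x' /itvP; exact: C1_bounded_integrable.
  - by move=> x' y /itvP xd' _; exact: derf.
  - exact: G0.
  - exact: iG.
  - by move=> x' y /itvP xd' _; exact: d1G.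
have H : {for tau, continuous (fun x => \int[m]_(y in B) partial1of2 f x y)}.
  apply: (@continuity_under_integral R d Y m (partial1of2 f) B mB (- de) de _ _ G iG).
  - by move=> x /itvP; exact: id1.
  - apply: aeW => y By x /set_mem/itvP xd.
    have [u' uP] := fG y.
    have [_ cu' _ _] := uP x xd.
    rewrite /continuous_at (d1E _ _ xd _ uP).
    apply: cvg_trans cu'; apply: near_eq_cvg.
    have e0 : 0 < de - `|x| by rewrite subr_gt0.
    apply: filterS (nbhsx_ballx x _ e0) => x'; rewrite /ball/= => xx'.
    rewrite (d1E x' y _ _ uP)//.
    have := ler_normB x (x - x'); have -> : x - (x - x') = x' by ring.
    by move=> h; apply: le_lt_trans h _; rewrite -ltrBrDl.
  - by move=> x /itvP xd; apply: aeW => y _; exact: d1G.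
  - by apply/mem_set/itvP.
change (derive1 F x @[x --> tau] --> derive1 F tau); rewrite dE//; apply: cvg_trans H; apply: near_eq_cvg.
have e0 : 0 < de - `|tau| by rewrite subr_gt0.
apply: filterS (nbhsx_ballx tau _ e0) => x'; rewrite /ball/= => xx'.
rewrite dE//.
have := ler_normB tau (tau - x'); have -> : tau - (tau - x') = x' by ring.
by move=> h; apply: le_lt_trans h _; rewrite -ltrBrDl.
Qed.

End DifferentiateIntegral.

(** * Measurability and periodicity of the Menger integrand *)

Section MengerShift.
Context {R : realType}.
Local Notation mu := (@lebesgue_measure R).
Variables (p : R) (f df : R -> 'rV[R]_3).
Hypothesis fc : C1_closed f df.

Lemma jointly_measurable_menger_integrand :
  jointly_measurable (fun s t sg => (menger_integrand p f s t sg)%:E).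
Proof.
move=> d T a b c ma mb mc; apply/measurable_EFinP.
have [_ _ cdf dcf] := fc.
have mf i : measurable_fun setT (fun x : R => f x 0 i).
  by apply: continuous_measurable_fun; exact: (is_derive_continuous _ _ (dcf i)).
have mdf i : measurable_fun setT (fun x : R => df x 0 i).
  exact: continuous_measurable_fun (cdf i).
have mcomp (F : R -> 'rV[R]_3) (e : T -> R) :
    (forall i, measurable_fun setT (fun x : R => F x 0 i)) ->
    measurable_fun setT e -> forall i, measurable_fun setT (fun z => F (e z) 0 i).
  by move=> mF me i; exact: (measurableT_comp (mF i) me).
have mB (e1 e2 : T -> R) : measurable_fun setT e1 -> measurable_fun setT e2 ->
    forall i, measurable_fun setT (fun z => (f (e1 z) - f (e2 z)) 0 i).
  move=> m1 m2 i.
  rewrite (_ : (fun z => _) = (fun z => f (e1 z) 0 i - f (e2 z) 0 i)); last first.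
    by apply/funext => z; rewrite !mxE.
  by apply: measurable_funB; exact: mcomp.
have mcross i : measurable_fun setT
    (fun z => cross (f (b z) - f (a z)) (f (c z) - f (a z)) 0 i).
  rewrite (_ : (fun z => _) = (fun z =>
    (f (b z) - f (a z)) 0 (i + 1) * (f (c z) - f (a z)) 0 (i + 2%:R) -
    (f (b z) - f (a z)) 0 (i + 2%:R) * (f (c z) - f (a z)) 0 (i + 1))); last first.
    by apply/funext => z; rewrite mxE.
  by apply: measurable_funB; apply: measurable_funM; exact: mB.
rewrite /menger_integrand (C1_closed_derive1 _ _ fc).
have me (e : T -> R) : measurable_fun setT e -> measurable_fun setT (fun z => enorm (df (e z))).
  by move=> me; apply: measurable_enorm; exact: mcomp.
have mE (e1 e2 : T -> R) : measurable_fun setT e1 -> measurable_fun setT e2 ->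
    measurable_fun setT (fun z => enorm (f (e1 z) - f (e2 z))).
  by move=> m1 m2; apply: measurable_enorm; exact: mB.
apply: measurable_funM; last exact: me.
apply: measurable_funM; last exact: me.
apply: measurable_funM; last exact: me.
apply: (measurableT_comp (measurable_powR p)).
rewrite /menger_curvature; apply: measurable_funM.
  by apply: measurable_funM => //; exact: measurable_enorm.
apply: (measurableT_comp measurable_invr).
by apply: measurable_funM; [apply: measurable_funM|]; exact: mE.
Qed.

Let mi_periodr s t sg :
  menger_integrand p f s t (sg + pi *+ 2) = menger_integrand p f s t sg.
Proof.
have [pf pdf _ _] := fc.
by rewrite /menger_integrand /menger_curvature (C1_closed_derive1 _ _ fc) pf pdf.
Qed.

Let mi_periodm s t sg :
  menger_integrand p f s (t + pi *+ 2) sg = menger_integrand p f s t sg.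
Proof.
have [pf pdf _ _] := fc.
by rewrite /menger_integrand /menger_curvature (C1_closed_derive1 _ _ fc) pf pdf.
Qed.

(** For fixed [s] the integrand is periodic in each of the other variables, so both inner integrals
    can be translated by [s]. *)
Lemma shifted_menger_integralE :
  shifted_menger_integral p f = integral_menger_curvature p f.
Proof.
have mm := jointly_measurable_menger_integrand.
have m0 s t sg : (0 <= (menger_integrand p f s t sg)%:E)%E.
  by rewrite lee_fin menger_integrand_ge0.
apply: eq_integral => s _.
transitivity (\int[mu]_(v in `[(- pi)%R, pi]) \int[mu]_(sg in `[0%R, (pi *+ 2)%R])
    (menger_integrand p f s (s + v) sg)%:E)%E.
  apply: eq_integral => v _.
  apply: (ge0_integral_centered (fun sg => (menger_integrand p f s (s + v) sg)%:E) s).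
  - by apply: mm.
  - by move=> *; exact: m0.
  - by move=> x; rewrite mi_periodr.
apply: (ge0_integral_centered
  (fun t => \int[mu]_(sg in `[0%R, (pi *+ 2)%R]) (menger_integrand p f s t sg)%:E)%E s).
- apply: (measurable_tonelli _ _ _ _ _ mu _ (fun t sg => (menger_integrand p f s t sg)%:E)).
  + by [].
  + by apply: mm.
  + by move=> *; exact: m0.
- by move=> *; apply: integral_ge0 => *; exact: m0.
- by move=> t; apply: eq_integral => sg _; rewrite mi_periodm.
Qed.

End MengerShift.

(** The summands are nested as in [defect_sum], and each level of addition costs a factor [2 ^ p].
    The last pair lies one level higher and can afford the third factor because [1 <= 2 ^ p]. *)
Lemma powR_sum6_le {R : realType} (p a b c d e f : R) : 0 <= p ->
  0 <= a -> 0 <= b -> 0 <= c -> 0 <= d -> 0 <= e -> 0 <= f ->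
  (a + b + (c + d) + (e + f)) `^ p <=
  (2 `^ p) ^+ 3 * (a `^ p + b `^ p + (c `^ p + d `^ p) + (e `^ p + f `^ p)).
Proof.
move=> p0 a0 b0 c0 d0 e0 f0.
have K1 : 1 <= 2 `^ p :> R.
  by have := @ler_powR R 2 _ 0 p p0; rewrite powRr0; apply; lra.
have h1 := powRD_le p a b p0 a0 b0.
have h2 := powRD_le p c d p0 c0 d0.
have h3 := powRD_le p e f p0 e0 f0.
have h4 := powRD_le p _ _ p0 (addr_ge0 a0 b0) (addr_ge0 c0 d0).
have h5 := powRD_le p _ _ p0 (addr_ge0 (addr_ge0 a0 b0) (addr_ge0 c0 d0)) (addr_ge0 e0 f0).
have E0 : 0 <= e `^ p + f `^ p by rewrite addr_ge0// powR_ge0.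
move: h1 h2 h3 h4 h5 E0 K1.
move: (2 `^ p) (a `^ p + b `^ p) (c `^ p + d `^ p) (e `^ p + f `^ p) => K A B E.
move: ((a + b) `^ p) ((c + d) `^ p) ((e + f) `^ p) ((a + b + (c + d)) `^ p) => x y z w.
move=> h1 h2 h3 h4 h5 E0 K1; apply: (le_trans h5).
have K0 : 0 <= K by lra.
have h6 : K * (x + y) <= K * (K * (A + B)) by apply: ler_wpM2l => //; lra.
have h7 : K * E <= K * (K * E) by apply: ler_wpM2l => //; rewrite ler_peMl.
have -> : K ^+ 3 * (A + B + E) = K * (K * (K * (A + B)) + K * (K * E)) by ring.
by apply: ler_wpM2l => //; lra.
Qed.

(** * The dominating function *)

Section Domination.
Context {R : realType}.
Variables (p : R) (g dg f df : R -> 'rV[R]_3).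
Hypothesis hp : 3%:R < p.

Definition kernel_pair (i : 'I_3) (s t sg : R) : R :=
  defect_kernel p (fun x : R => g x 0 i) (fun x : R => dg x 0 i) s t sg +
  defect_kernel p (fun x : R => f x 0 i) (fun x : R => df x 0 i) s t sg.

Definition kernel_sum (s t sg : R) : R :=
  kernel_pair 0 s t sg + kernel_pair 1 s t sg + kernel_pair 2%:R s t sg.

(** The sum over all six orderings dominates the estimate for every position of the longest side. *)
Definition symmetrized (k : R -> R -> R -> R) (s t sg : R) : R :=
  k s t sg + k s sg t + (k t s sg + k t sg s) + (k sg s t + k sg t s).

Lemma kernel_sum_ge0 s t sg : 0 <= kernel_sum s t sg.
Proof.
by rewrite /kernel_sum /kernel_pair; do ![apply: addr_ge0 | apply: defect_kernel_ge0].
Qed.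

Lemma triple_integrable_symmetrized (k : R -> R -> R -> R) :
  triple_integrable k -> triple_integrable (symmetrized k).
Proof.
move=> i1.
have i2 := triple_integrable_swap23 _ i1.
have i3 := triple_integrable_swap12 _ i1.
have i4 := triple_integrable_swap12 _ i2.
have i5 := triple_integrable_swap23 _ i3.
have i6 := triple_integrable_swap23 _ i4.
exact: (triple_integrableD _ _ (triple_integrableD _ _ (triple_integrableD _ _ i1 i2)
  (triple_integrableD _ _ i3 i4)) (triple_integrableD _ _ i5 i6)).
Qed.

Lemma kernel_sum_integrable : C1_closed g dg -> C1_closed f df ->
  (forall i, slobodeckij_energy p (fun x : R => dg x 0 i) \is a fin_num) ->
  (forall i, slobodeckij_energy p (fun x : R => df x 0 i) \is a fin_num) ->
  triple_integrable kernel_sum.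
Proof.
move=> gc fc Eg Ef.
have H (h dh : R -> 'rV[R]_3) (i : 'I_3) : C1_closed h dh ->
    (forall i, slobodeckij_energy p (fun x : R => dh x 0 i) \is a fin_num) ->
    triple_integrable (defect_kernel p (fun x : R => h x 0 i) (fun x : R => dh x 0 i)).
  move=> [ph pdh ch dch] Eh; apply: defect_kernel_integrable.
  - exact: hp.
  - exact: ch.
  - by move=> x; rewrite ph.
  - by move=> x; rewrite pdh.
  - exact: Eh.
have P i : triple_integrable (kernel_pair i).
  exact: (triple_integrableD _ _ (H g dg i gc Eg) (H f df i fc Ef)).
exact: (triple_integrableD _ _ (triple_integrableD _ _ (P 0) (P 1)) (P 2%:R)).
Qed.

(** One factor [2 ^ p] separates the two defect sums, three more split each of them into six
    defects. As the maximum is symmetric, the second sum gives the kernel with [t] and [sg]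
    exchanged. *)
Lemma defect_sum_kernel_le s t sg :
  (defect_sum g dg f df s t + defect_sum g dg f df s sg) `^ p *
    Num.max (chord s t) (chord s sg) `^ (- p) <=
  (2 `^ p) ^+ 4 * (kernel_sum s t sg + kernel_sum s sg t).
Proof.
have p0 : 0 <= p by move: hp; lra.
have T0 U u x y : 0 <= @taylor_defect R U u x y.
  by rewrite /taylor_defect divr_ge0// chord_ge0.
have D x y : (defect_sum g dg f df x y) `^ p <= (2 `^ p) ^+ 3 *
    (taylor_defect (fun x : R => g x 0 0) (fun x : R => dg x 0 0) x y `^ p +
     taylor_defect (fun x : R => f x 0 0) (fun x : R => df x 0 0) x y `^ p +
    (taylor_defect (fun x : R => g x 0 1) (fun x : R => dg x 0 1) x y `^ p +
     taylor_defect (fun x : R => f x 0 1) (fun x : R => df x 0 1) x y `^ p) +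
    (taylor_defect (fun x : R => g x 0 2%:R) (fun x : R => dg x 0 2%:R) x y `^ p +
     taylor_defect (fun x : R => f x 0 2%:R) (fun x : R => df x 0 2%:R) x y `^ p)).
  by apply: powR_sum6_le => //; exact: T0.
have h := powRD_le p _ _ p0 (defect_sum_ge0 g dg f df s t) (defect_sum_ge0 g dg f df s sg).
have K0 : 0 <= 2 `^ p :> R by exact: powR_ge0.
have M0 := powR_ge0 (Num.max (chord s t) (chord s sg)) (- p).
apply: (le_trans (ler_wpM2r M0 (le_trans h (ler_wpM2l K0 (lerD (D s t) (D s sg)))))).
rewrite /kernel_sum /kernel_pair /defect_kernel (maxC (chord s sg) (chord s t)).
by rewrite le_eqVlt; apply/orP; left; apply/eqP; ring.
Qed.

End Domination.

Section MengerDominated.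
Context {R : realType}.
Variables (p : R) (g dg f df : R -> 'rV[R]_3) (L c de : R).
Hypothesis hp : 3%:R < p.
Hypotheses (gc : C1_closed g dg) (fc : C1_closed f df).
Hypothesis L0 : 0 <= L.
Hypothesis dgL : forall x (i : 'I_3), `|dg x 0 i| <= L.
Hypothesis dfL : forall x (i : 'I_3), `|df x 0 i| <= L.
Hypothesis gL : forall s t (i : 'I_3), `|g t 0 i - g s 0 i| <= L * chord s t.
Hypothesis fL : forall s t (i : 'I_3), `|f t 0 i - f s 0 i| <= L * chord s t.
Hypothesis c0 : 0 < c.
Hypothesis de1 : de <= 1.
Hypothesis lower : forall tau, `|tau| < de -> forall s t,
  c * chord s t <= l1norm (perturb g f tau t - perturb g f tau s).
Hypothesis dlower : forall tau, `|tau| < de -> forall x,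
  c <= l1norm (perturb dg df tau x).

Let mi (s t sg tau : R) : R := menger_integrand p (perturb g f tau) s t sg.

(** The Lipschitz bounds force both curves to take equal values at [s] and [t], so the triple is
    degenerate for every [tau] and the integrand is identically zero. *)
Let chord0_degenerate s t sg A : chord s t = 0 -> 0 <= A -> C1_bounded de (mi s t sg) A.
Proof.
move=> st0 A0.
have e (h : R -> 'rV[R]_3) :
    (forall s t (i : 'I_3), `|h t 0 i - h s 0 i| <= L * chord s t) -> h s = h t.
  move=> hL; apply/matrixP => j i; rewrite ord1.
  have := hL s t i; rewrite st0 mulr0 normr_le0 subr_eq0 => /eqP ->.
  by [].
have z tau : 0 = mi s t sg tau.
  rewrite /mi menger_integrand_degenerate//; first by move: hp; lra.
  by rewrite /perturb (e _ gL) (e _ fL).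
apply: (C1_bounded_ext _ _ _ _ z).
apply: (C1_bounded_le _ _ _ _ (C1_bounded_cst de (0 : R))).
by rewrite normr0.
Qed.

(* The vertex opposite the longest chord serves as base point. *)
Lemma menger_dominated : exists2 C : R, 0 <= C & forall s t sg,
  C1_bounded de (fun tau => menger_integrand p (perturb g f tau) s t sg)
    (C * symmetrized (kernel_sum p g dg f df) s t sg).
Proof.
have [C0 C00 base0] := menger_base_C1 p g dg f df L c de hp gc fc L0 dgL dfL gL fL c0 de1 lower dlower.
pose k := kernel_sum p g dg f df.
have k0 s t sg : 0 <= k s t sg by exact: kernel_sum_ge0.
pose C := C0 * (2 `^ p) ^+ 4.
have C_ge0 : 0 <= C by apply: mulr_ge0 => //; apply: exprn_ge0; exact: powR_ge0.
have S0 s t sg : 0 <= C * symmetrized k s t sg.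
  by apply: mulr_ge0 => //; rewrite /symmetrized; do ![apply: addr_ge0 => //].
have base s t sg A : 0 < chord s t -> 0 < chord s sg ->
    chord s t <= chord t sg -> chord s sg <= chord t sg ->
    k s t sg + k s sg t <= A -> C1_bounded de (mi s t sg) (C * A).
  move=> h1 h2 h3 h4 hA.
  apply: (C1_bounded_le _ _ _ _ (base0 s t sg h1 h2 h3 h4)).
  apply: (le_trans (ler_wpM2l C00 (defect_sum_kernel_le p g dg f df hp s t sg))).
  rewrite /C -mulrA; apply: ler_wpM2l => //.
  by apply: ler_wpM2l => //; apply: exprn_ge0; exact: powR_ge0.
exists C => // s t sg.
(* Cyclic permutations bring each vertex to the first place, and this suffices because the
   conditions of [base] are symmetric in the other two. *)
have cyc1 tau : mi t sg s tau = mi s t sg tau by rewrite /mi -menger_integrand_cyclic.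
have cyc2 tau : mi sg s t tau = mi s t sg tau.
  by rewrite /mi menger_integrand_cyclic.
have cge (x y : R) : (chord x y = 0) \/ 0 < chord x y.
  by have := chord_ge0 x y; rewrite le_eqVlt => /orP[/eqP <-|]; [left|right].
have [z|st] := cge s t; first exact: chord0_degenerate z (S0 _ _ _).
have [z|tsg] := cge t sg.
  by apply: (C1_bounded_ext _ _ _ _ cyc1); exact: chord0_degenerate z (S0 _ _ _).
have [z|sgs] := cge sg s.
  by apply: (C1_bounded_ext _ _ _ _ cyc2); exact: chord0_degenerate z (S0 _ _ _).
have K1 : k s t sg + k s sg t <= symmetrized k s t sg.
  by have := (k0 t s sg, k0 t sg s, k0 sg s t, k0 sg t s) => -[[[? ?] ?] ?]; rewrite /symmetrized; lra.
have K2 : k t sg s + k t s sg <= symmetrized k s t sg.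
  by have := (k0 s t sg, k0 s sg t, k0 sg s t, k0 sg t s) => -[[[? ?] ?] ?]; rewrite /symmetrized; lra.
have K3 : k sg s t + k sg t s <= symmetrized k s t sg.
  by have := (k0 s t sg, k0 s sg t, k0 t s sg, k0 t sg s) => -[[[? ?] ?] ?]; rewrite /symmetrized; lra.
have [a|a] := leP (chord s t) (chord t sg).
  have [b|b] := leP (chord sg s) (chord t sg).
    by apply: base => //; rewrite (chord_sym s sg).
  apply: (C1_bounded_ext _ _ _ _ cyc1); apply: base => //.
  - by rewrite (chord_sym t s).
  - exact: ltW.
  - by rewrite (chord_sym t s); apply: le_trans (ltW b).
have [b|b] := leP (chord sg s) (chord s t).
  apply: (C1_bounded_ext _ _ _ _ cyc2); apply: base => //.
  - by rewrite (chord_sym sg t).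
  - by rewrite (chord_sym sg t); exact: ltW.
apply: (C1_bounded_ext _ _ _ _ cyc1); apply: base => //.
- by rewrite (chord_sym t s).
- by apply: le_trans (ltW b); exact: ltW.
- by rewrite (chord_sym t s); exact: ltW.
Qed.

End MengerDominated.

Section PerturbedBounds.
Context {R : realType}.
Variables (g dg f df : R -> 'rV[R]_3) (a b L : R).
Hypotheses (a0 : 0 < a) (b0 : 0 < b) (L0 : 0 <= L).
Hypothesis glow : forall s t, a * chord s t <= l1norm (g t - g s).
Hypothesis dglow : forall x, b <= l1norm (dg x).
Hypothesis dfL : forall x (i : 'I_3), `|df x 0 i| <= L.
Hypothesis fL : forall s t (i : 'I_3), `|f t 0 i - f s 0 i| <= L * chord s t.

Lemma perturb_lower_bounds : exists c de : R, [/\ 0 < c, 0 < de, de <= 1,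
  forall tau, `|tau| < de -> forall s t,
    c * chord s t <= l1norm (perturb g f tau t - perturb g f tau s) &
  forall tau, `|tau| < de -> forall x, c <= l1norm (perturb dg df tau x)].
Proof.
pose m := Num.min a b.
have m0 : 0 < m by rewrite lt_min a0 b0.
have ma : m <= a by rewrite ge_min lexx.
have mb : m <= b by rewrite ge_min lexx orbT.
(* With [|tau| * (6 * L + 6) < m] the changes in three coordinates add up to at most [m / 2]; the
   summand [6] keeps the divisor positive for [L = 0]. *)
have d0 : 0 < 6 * L + 6 by move: L0; lra.
have key tau : `|tau| < Num.min 1 (m / (6 * L + 6)) -> 3 * (`|tau| * L) <= m / 2.
  rewrite lt_min => /andP[_]; rewrite ltr_pdivlMr// => h.
  by have := normr_ge0 tau; lra.
exists (m / 2), (Num.min 1 (m / (6 * L + 6))); split.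
- by rewrite divr_gt0.
- by rewrite lt_min ltr01 divr_gt0.
- by rewrite ge_min lexx.
- move=> tau /key h s t.
  have := l1norm_perturb_ge (g t - g s) (tau *: (f t - f s))
    (perturb g f tau t - perturb g f tau s) (a * chord s t) (`|tau| * (L * chord s t)) (glow s t).
  move=> /(_ _ _)/(le_trans _) -> //.
  + have := chord_ge0 s t; move: h ma; nra.
  + by move=> i; rewrite !mxE normrM; apply: ler_wpM2l.
  + by move=> i; rewrite !mxE; ring.
- move=> tau /key h x.
  have := l1norm_perturb_ge (dg x) (tau *: df x) (perturb dg df tau x) b (`|tau| * L) (dglow x).
  move=> /(_ _ _)/(le_trans _) -> //.
  + by move: h mb m0; lra.
  + by move=> i; rewrite !mxE normrM; apply: ler_wpM2l.
  + by move=> i; rewrite !mxE.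
Qed.

End PerturbedBounds.

(** * Continuous differentiability of integral Menger curvature *)

Section MengerC1.
Context {R : realType}.
Local Notation mu := (@lebesgue_measure R).
Local Notation mu3 := ((mu \x @lebesgue2 R)%E).
Variables (p de : R) (gamma Phi : R -> 'rV[R]_3) (G : R -> R -> R -> R).
Hypothesis de0 : 0 < de.
Hypothesis jm : forall tau, jointly_measurable
  (fun s t sg => (menger_integrand p (perturb gamma Phi tau) s t sg)%:E).
Hypothesis iG : triple_integrable G.
Hypothesis fG : forall s t sg, C1_bounded de
  (fun tau => menger_integrand p (perturb gamma Phi tau) s t sg) (G s t sg).

Lemma C1_near0_menger :
  C1_near0 (fun tau => integral_menger_curvature p (perturb gamma Phi tau)).
Proof.
pose f (tau : R) (z : R * (R * R)) : R :=
  menger_integrand p (perturb gamma Phi tau) z.1 z.2.1 z.2.2.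
have E tau : integral_menger_curvature p (perturb gamma Phi tau) =
    (\int[mu3]_(z in cube) (f tau z)%:E)%E.
  apply/esym; apply: (triple_integral_prod
    (fun s t sg => (menger_integrand p (perturb gamma Phi tau) s t sg)%:E) (jm tau)).
  by move=> *; rewrite lee_fin menger_integrand_ge0.
have [_ _ iG3] := iG.
have mf tau : measurable_fun cube (f tau).
  apply: measurable_funTS; apply/measurable_EFinP.
  by apply: jm; [exact: measurable_fst|exact: measurableT_comp|exact: measurableT_comp].
have fG3 (z : R * (R * R)) : C1_bounded de (f ^~ z) (G z.1 z.2.1 z.2.2) by exact: fG.
exists de => // tau td.
rewrite (_ : (fun t => fine _) = (fun tau => \int[mu3]_(z in cube) f tau z)); last first.
  by apply/funext => x; rewrite E.
split.
- rewrite E; apply: integrable_fin_num.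
    exact: measurable_cube.
  apply: (C1_bounded_integrable _ _ mu3 cube f _ de _ de0 _ iG3 fG3 _ td).
    exact: measurable_cube.
  exact: mf.
- apply: (C1_bounded_derivable _ _ mu3 cube f _ de _ de0 _ iG3 fG3 _ td).
    exact: measurable_cube.
  exact: mf.
- apply: (C1_bounded_continuous_derive _ _ mu3 cube f _ de _ de0 _ iG3 fG3 _ td).
    exact: measurable_cube.
  exact: mf.
Qed.

End MengerC1.

Theorem theorem2p33 (R : realType) (p : R) (hp : 3%:R < p)
  (gamma Phi : R -> 'rV[R]_3)
  (hgamma : sobolev_slobodeckij p gamma)
  (hsimple : simple_closed gamma)
  (hregular : regular_curve gamma)
  (hPhi : sobolev_slobodeckij p Phi) :
  C1_near0 (fun tau => shifted_menger_integral p (perturb gamma Phi tau)) /\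
  differentiable_at0
    (fun tau => integral_menger_curvature p (perturb gamma Phi tau)).
Proof.
have [pg [dg [cdg pdg dg_ dgE Eg]]] := sobolev_C1 p gamma hp hgamma.
have [pf [df [cdf pdf df_ _ Ef]]] := sobolev_C1 p Phi hp hPhi.
have gc : C1_closed gamma dg by split.
have fc : C1_closed Phi df by split.
have [Lg Lg0 [dgL gL]] := C1_closed_lipschitz _ _ gc.
have [Lf Lf0 [dfL fL]] := C1_closed_lipschitz _ _ fc.
have [b b0 dglow] := regular_everywhere _ _ gc dgE hregular.
have [a a0 glow] := bilipschitz _ _ _ gc hsimple b0 dglow.
have [c [de [c0 de0 de1 lower dlower]]] :=
  perturb_lower_bounds gamma dg Phi df a b Lf a0 b0 Lf0 glow dglow dfL fL.
have gLL : Lg <= Lg + Lf by rewrite lerDl.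
have fLL : Lf <= Lg + Lf by rewrite lerDr.
have [C C0 dom] : exists2 C : R, 0 <= C & forall s t sg,
    C1_bounded de (fun tau => menger_integrand p (perturb gamma Phi tau) s t sg)
      (C * symmetrized (kernel_sum p gamma dg Phi df) s t sg).
  apply: (menger_dominated p gamma dg Phi df (Lg + Lf) c de hp gc fc) => //.
  - exact: addr_ge0.
  - by move=> x i; apply: le_trans gLL.
  - by move=> x i; apply: le_trans fLL.
  - by move=> s t i; apply: (le_trans (gL s t i)); apply: ler_wpM2r => //; exact: chord_ge0.
  - by move=> s t i; apply: (le_trans (fL s t i)); apply: ler_wpM2r => //; exact: chord_ge0.
have jm tau := jointly_measurable_menger_integrand p _ _ (C1_closed_perturb _ _ _ _ tau gc fc).
have iG := triple_integrableZ C _ C0 (triple_integrable_symmetrized _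
  (kernel_sum_integrable p _ _ _ _ hp gc fc Eg Ef)).
have H := C1_near0_menger p de gamma Phi _ de0 jm iG dom.
(* The C^1 property is obtained for the symmetric domain, on which permutations act, and is carried
   over to the shifted integral by this identity. *)
have e : (fun tau => shifted_menger_integral p (perturb gamma Phi tau)) =
    (fun tau => integral_menger_curvature p (perturb gamma Phi tau)).
  apply/funext => tau.
  exact: (shifted_menger_integralE p _ _ (C1_closed_perturb _ _ _ _ tau gc fc)).
split; first by rewrite e; exact: H.
have [d d0 dP] := H; split.
  apply: filterS (nbhsx_ballx (0 : R) _ d0) => tau; rewrite /ball/= sub0r normrN => td.
  by have [] := dP tau td.
have z0 : `|0 : R| < d by rewrite normr0.
have [_ D0 _] := dP 0 z0; exact: D0.
Qed.
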